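(* (Work in $\mathrm{ZF}+\mathrm{DC}$.) Assume $\mathrm{Ax}_{4,\lambda,\partial}$. For $\kappa<\lambda$, letting $X_\kappa={}^\omega(\mathrm{Fil}^4_{\aleph_1}(\kappa))$, one can $\partial$-uniformly define $\langle(\mathcal S_t,<_t):t\in X_\kappa\rangle$ such that: (a) $\bigcup\{\mathcal S_t:t\in X_\kappa\}={}^\kappa\lambda$; (b) $<_t$ is a well ordering of $\mathcal S_t$; (c) there is an equivalence relation $E$ on ${}^\kappa\lambda$ such that: ($\alpha$) $({}^\kappa\lambda)/E$ is well ordered; ($\beta$) each equivalence class is of power $\le|X_\kappa|$; (d) moreover, for some $\bar g=\langle g_{\bar{\mathfrak y},\alpha}:\bar{\mathfrak y}\in X_\kappa,\alpha\in S_{\bar{\mathfrak y}}\rangle$, $\bar S=\langle S_{\bar{\mathfrak y}}:\bar{\mathfrak y}\in X_\kappa\rangle$ and $\bar{\mathcal F}=\langle\mathcal F_\beta:\beta<\beta( * )\rangle$ we have: ($\alpha$) $\beta( * )<\mathrm{hrtg}([\alpha( * )]^{\aleph_0})$ where $\alpha( * )=\sup\{\mathrm{rk}_D(\lambda):D\in\mathrm{Fil}^1_{\aleph_1}(\kappa)\}$; ($\beta$) $\beta( * )=\bigcup\{S_{\bar{\mathfrak y}}:\bar{\mathfrak y}\in X_\kappa\}$; ($\gamma$) $\{g_{\bar{\mathfrak y},\alpha}:\bar{\mathfrak y}\in X_\kappa,\alpha\in S_{\bar{\mathfrak y}}\}$ is equal to ${}^\kappa\lambda$; ($\delta$) $g_{\bar{\mathfrak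 y}_1,\alpha_1}=g_{\bar{\mathfrak y}_2,\alpha_2}$ implies $\alpha_1=\alpha_2$; ($\varepsilon$) $\bar{\mathcal F}=\langle\mathcal F_\beta:\beta<\beta( * )\rangle$ is a partition of ${}^\kappa\lambda$; ($\zeta$) $|\mathcal F_\beta|\le_{\mathrm{qu}}|X_\kappa|$.
   Context: The axiom of choice is not assumed, only ZF + DC. $\partial\ge\aleph_1$ is a fixed cardinal; $\kappa,\lambda$ are cardinals (alephs). $\mathrm{hrtg}(A)$ is the least ordinal $\alpha>0$ such that there is no function from $A$ onto $\alpha$. $|A|\le|B|$ means there is a one-to-one function from $A$ into $B$; $A\le_{\mathrm{qu}}B$ (also written $|A|\le_{\mathrm{qu}}|B|$) means $A=\emptyset$ or there is a function from $B$ onto $A$. For $\lambda\ge\partial$, $\mathrm{Ax}_{4,\lambda,\partial}$ says there is a well-orderable $\mathcal S\subseteq[\lambda]^{<\partial}$ such that every $u_1\in[\lambda]^{<\aleph_1}$ is contained in some $u_2\in\mathcal S$. ''One can $\partial$-uniformly define'' an object $y$ with property $\psi(y,a)$ from $a$ (here $a=(\kappa,\lambda)$): there is a fixed formula $\varphi$ such that for every large enough $\mu'$, if $\mathrm{Ax}_{4,\mu',\partial}$ holds and $<_*$ is a well ordering of some $\mathcal S_*\subseteq[\mu']^{<\partial}$ witnessing $\mathrm{Ax}_{4,\mu',\partial}$, then there is a unique $y$ such that $\varphi(y,a,<_* )$ and $\psi(y,a)$. $\mathrm{Fil}^1_{\aleph_1}(Y)$ is the set of $\aleph_1$-complete filters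 on $Y$. $\mathrm{Fil}^4_{\aleph_1}(Y)$ is the set of quadruples $(D_1,D_2,h,Z)$ such that $D_1\subseteq D_2$ are $\aleph_1$-complete filters on $Y$ with $\emptyset\notin D_2$, $h$ is a function from $Y$ to some ordinal $\alpha<\mathrm{hrtg}([Y]^{\le\aleph_0}\times\partial)\cup\omega$, and $Z\in D_2$. For a filter $D$ on $Y$ and $f\in{}^Y\mathrm{Ord}$, the Galvin–Hajnal rank is $\mathrm{rk}_D(f)=\sup\{\mathrm{rk}_D(g)+1:g\in{}^Y\mathrm{Ord},\ g<f\bmod D\}\in\mathrm{Ord}\cup\{\infty\}$, where $g<f\bmod D$ means $\{s:g(s)<f(s)\}\in D$; $\mathrm{rk}_D(\lambda)$ is the rank of the constant function with value $\lambda$. *)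

(* Defs.v *)
(* The theorem is a theorem scheme of ZF + DC about first-order definability,
   so it is stated for all models of ZF + DC.  Formulas are deeply embedded:
   the axiom schemes and the notion "there is a fixed formula" need them as
   objects.  All set-theoretic notions are written as first-order conditions
   on the membership relation, every quantifier ranging over the model, and so
   are internal to it (omega, the ordinals, etc. are those of the model). *)

Set Implicit Arguments.
Unset Strict Implicit.

Record structure : Type := Structure {
  carrier :> Type;
  mem : carrier -> carrier -> Prop
}.

Arguments mem {s} _ _.
Notation "x ∈ y" := (mem x y) (at level 70, no associativity).

(* De Bruijn indices: [fAll] binds the variable 0. *)
Inductive formula : Type :=
| fMem (i j : nat)
| fEq (i j : nat)
| fNot (p : formula)
| fAnd (p q : formula)
| fAll (p : formula).

Definition scons {T : Type} (x : T) (e : nat -> T) : nat -> T :=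
  fun n => match n with O => x | S m => e m end.

Fixpoint sat (M : structure) (e : nat -> M) (p : formula) : Prop :=
  match p with
  | fMem i j => e i ∈ e j
  | fEq i j => e i = e j
  | fNot q => ~ sat e q
  | fAnd q r => sat e q /\ sat e r
  | fAll q => forall x : M, sat (scons x e) q
  end.

(* A predicate on the model serves as a class.  The classes used below are
   first-order definable; many of them are sets of the model, and [ext x] is
   the class of elements of the set [x]. *)
Definition class (M : structure) : Type := M -> Prop.

Definition ext {M : structure} (x : M) : class M := fun z => z ∈ x.

Definition subset {M : structure} (x y : M) : Prop :=
  forall z, z ∈ x -> z ∈ y.

Definition is_empty {M : structure} (x : M) : Prop := forall z, ~ z ∈ x.

Definition is_upair {M : structure} (z x y : M) : Prop :=
  forall w, w ∈ z <-> w = x \/ w = y.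

(* Kuratowski pairs: p = {{x}, {x, y}} *)
Definition is_pair {M : structure} (p x y : M) : Prop :=
  forall z, z ∈ p <-> is_upair z x x \/ is_upair z x y.

Definition is_quadruple {M : structure} (q a b c d : M) : Prop :=
  exists p1 p2, is_pair p1 a b /\ is_pair p2 p1 c /\ is_pair q p2 d.

Definition is_succ {M : structure} (s x : M) : Prop :=
  forall z, z ∈ s <-> z ∈ x \/ z = x.

Definition inductive_set {M : structure} (x : M) : Prop :=
  (exists e, is_empty e /\ e ∈ x) /\
  (forall y, y ∈ x -> exists s, is_succ s y /\ s ∈ x).

Definition is_omega {M : structure} (w : M) : Prop :=
  inductive_set w /\ forall v, inductive_set v -> subset w v.

(* [rel r x y]: the ordered pair (x, y) belongs to r.  For a function f,
   [rel f x y] says f(x) = y. *)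
Definition rel {M : structure} (r x y : M) : Prop :=
  exists p, is_pair p x y /\ p ∈ r.

Definition maps {M : structure} (f : M) (A B : class M) : Prop :=
  (forall p, p ∈ f -> exists x y, A x /\ B y /\ is_pair p x y) /\
  (forall x, A x -> exists! y, rel f x y).

Definition is_fun_on {M : structure} (f : M) (A : class M) : Prop :=
  maps f A (fun _ => True).

Definition injective {M : structure} (f : M) : Prop :=
  forall x x' y, rel f x y -> rel f x' y -> x = x'.

Definition onto {M : structure} (f : M) (B : class M) : Prop :=
  forall y, B y -> exists x, rel f x y.

Definition functions {M : structure} (A B : class M) : class M :=
  fun f => maps f A B.

Definition prod {M : structure} (A B : class M) : class M :=
  fun p => exists x y, A x /\ B y /\ is_pair p x y.

Definition extensionality (M : structure) : Prop :=
  forall x y : M, (forall z, z ∈ x <-> z ∈ y) -> x = y.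

Definition foundation (M : structure) : Prop :=
  forall x : M, (exists y, y ∈ x) ->
    exists y, y ∈ x /\ forall z, z ∈ y -> ~ z ∈ x.

Definition pairing (M : structure) : Prop :=
  forall x y : M, exists z, is_upair z x y.

Definition union (M : structure) : Prop :=
  forall x : M, exists u, forall z, z ∈ u <-> exists y, y ∈ x /\ z ∈ y.

Definition power_set (M : structure) : Prop :=
  forall x : M, exists p, forall z, z ∈ p <-> subset z x.

Definition infinity (M : structure) : Prop :=
  exists x : M, inductive_set x.

Definition separation (M : structure) : Prop :=
  forall (p : formula) (e : nat -> M) (a : M),
    exists b, forall x, x ∈ b <-> x ∈ a /\ sat (scons x e) p.

Definition replacement (M : structure) : Prop :=
  forall (p : formula) (e : nat -> M) (a : M),
    (forall x y y', x ∈ a -> sat (scons x (scons y e)) p ->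
       sat (scons x (scons y' e)) p -> y = y') ->
    exists b, forall y,
      y ∈ b <-> exists x, x ∈ a /\ sat (scons x (scons y e)) p.

Definition ZF (M : structure) : Prop :=
  extensionality M /\ foundation M /\ pairing M /\ union M /\ power_set M /\
  infinity M /\ separation M /\ replacement M.

Definition DC (M : structure) : Prop :=
  forall A R : M,
    (exists x, x ∈ A) ->
    (forall x, x ∈ A -> exists y, y ∈ A /\ rel R x y) ->
    exists w f, is_omega w /\ maps f (ext w) (ext A) /\
      forall n s x y, n ∈ w -> is_succ s n -> rel f n x -> rel f s y ->
        rel R x y.

(* [∈] is well founded on [a] by the axiom of foundation. *)
Definition ordinal {M : structure} (a : M) : Prop :=
  (forall x, x ∈ a -> subset x a) /\
  (forall x y, x ∈ a -> y ∈ a -> x ∈ y \/ x = y \/ y ∈ x).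

Definition ord_le {M : structure} (a b : M) : Prop := a ∈ b \/ a = b.

Definition is_sup {M : structure} (C : class M) (a : M) : Prop :=
  ordinal a /\ (forall c, C c -> ord_le c a) /\
  (forall b, ordinal b -> (forall c, C c -> ord_le c b) -> ord_le a b).

(* [r] is a strict well ordering of the set [S], and relates nothing else. *)
Definition well_orders {M : structure} (r S : M) : Prop :=
  (forall p, p ∈ r -> prod (ext S) (ext S) p) /\
  (forall x, ~ rel r x x) /\
  (forall x y z, rel r x y -> rel r y z -> rel r x z) /\
  (forall x y, x ∈ S -> y ∈ S -> rel r x y \/ x = y \/ rel r y x) /\
  (forall T, subset T S -> (exists x, x ∈ T) ->
     exists m, m ∈ T /\ forall x, x ∈ T -> x = m \/ rel r m x).

Definition well_orderable {M : structure} (S : M) : Prop :=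
  exists r, well_orders r S.

Definition card_le {M : structure} (A B : class M) : Prop :=
  exists f, maps f A B /\ injective f.

Definition card_lt {M : structure} (A B : class M) : Prop :=
  card_le A B /\ ~ card_le B A.

Definition card_eq {M : structure} (A B : class M) : Prop :=
  exists f, maps f A B /\ injective f /\ onto f B.

Definition qu_le {M : structure} (A B : class M) : Prop :=
  (forall x, ~ A x) \/ exists f, maps f B A /\ onto f A.

Definition aleph {M : structure} (k : M) : Prop :=
  ordinal k /\ (exists w, is_omega w /\ ord_le w k) /\
  (forall a, a ∈ k -> ~ card_eq (ext a) (ext k)).

Definition is_aleph1 {M : structure} (k : M) : Prop :=
  aleph k /\ exists w, is_omega w /\ w ∈ k /\
    forall k', aleph k' -> w ∈ k' -> ord_le k k'.

Definition is_hrtg {M : structure} (A : class M) (theta : M) : Prop :=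
  let P a := ordinal a /\ ~ is_empty a /\
             ~ exists f, maps f A (ext a) /\ onto f (ext a) in
  P theta /\ forall a, P a -> ord_le theta a.

Definition subsets_card_lt {M : structure} (A : class M) (k : M) : class M :=
  fun u => (forall z, z ∈ u -> A z) /\ card_lt (ext u) (ext k).

Definition subsets_lt_aleph1 {M : structure} (A : class M) : class M :=
  fun u => exists k, is_aleph1 k /\ subsets_card_lt A k u.

Definition subsets_le_aleph0 {M : structure} (A : class M) : class M :=
  fun u => (forall z, z ∈ u -> A z) /\
    exists w, is_omega w /\ card_le (ext u) (ext w).

Definition subsets_aleph0 {M : structure} (A : class M) : class M :=
  fun u => (forall z, z ∈ u -> A z) /\
    exists w, is_omega w /\ card_eq (ext u) (ext w).

Definition Ax4_witness {M : structure} (lam d S : M) : Prop :=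
  (forall u, u ∈ S -> subsets_card_lt (ext lam) d u) /\
  well_orderable S /\
  (forall u1, subsets_lt_aleph1 (ext lam) u1 ->
     exists u2, u2 ∈ S /\ subset u1 u2).

Definition Ax4 {M : structure} (lam d : M) : Prop :=
  exists S, Ax4_witness lam d S.

(* A filter on [Y], possibly the improper one. *)
Definition filter {M : structure} (Y D : M) : Prop :=
  (forall A, A ∈ D -> subset A Y) /\
  Y ∈ D /\
  (forall A B, A ∈ D -> subset A B -> subset B Y -> B ∈ D) /\
  (forall A B C, A ∈ D -> B ∈ D -> (forall z, z ∈ C <-> z ∈ A /\ z ∈ B) ->
     C ∈ D).

Definition aleph1_complete {M : structure} (Y D : M) : Prop :=
  forall C I, subsets_lt_aleph1 (ext D) C ->
    (forall z, z ∈ I <-> z ∈ Y /\ forall A, A ∈ C -> z ∈ A) -> I ∈ D.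

Definition proper {M : structure} (D : M) : Prop :=
  forall e, is_empty e -> ~ e ∈ D.

(* Filters are proper here: the improper filter has rank infinity, which would
   leave the ordinal alpha-star below undefined. *)
Definition Fil1 {M : structure} (Y : M) : class M :=
  fun D => filter Y D /\ aleph1_complete Y D /\ proper D.

Definition Fil4 {M : structure} (d Y : M) : class M :=
  fun q => exists D1 D2 h Z, is_quadruple q D1 D2 h Z /\
    (filter Y D1 /\ aleph1_complete Y D1) /\
    (filter Y D2 /\ aleph1_complete Y D2) /\
    subset D1 D2 /\ proper D2 /\
    (exists theta w a,
       is_hrtg (prod (subsets_le_aleph0 (ext Y)) (ext d)) theta /\
       is_omega w /\ (a ∈ theta \/ a ∈ w) /\ maps h (ext Y) (ext a)) /\
    Z ∈ D2.

Definition ord_functions {M : structure} (Y : M) : class M :=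
  functions (ext Y) ordinal.

Definition lt_mod {M : structure} (Y D g f : M) : Prop :=
  exists A, A ∈ D /\
    forall s, s ∈ A <->
      s ∈ Y /\ exists b a, rel g s b /\ rel f s a /\ b ∈ a.

Definition eq_mod {M : structure} (Y D g f : M) : Prop :=
  exists A, A ∈ D /\
    forall s, s ∈ A <-> s ∈ Y /\ exists a, rel g s a /\ rel f s a.

(* rk_D(f) = alpha (in particular rk_D(f) is not infinity).  The defining
   recursion runs over the proper class of g in ^Y Ord with g < f mod D.  As a
   rank depends on g only modulo D, the recursion is carried out by a set
   function rho on a set W that contains f and, with each h, a representative
   modulo D of every g < h mod D. *)
Definition is_rk {M : structure} (Y D f alpha : M) : Prop :=
  exists W rho,
    (forall h, h ∈ W -> ord_functions Y h) /\
    (forall h g, h ∈ W -> ord_functions Y g -> lt_mod Y D g h ->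
       exists g', g' ∈ W /\ eq_mod Y D g' g) /\
    maps rho (ext W) ordinal /\
    (forall h a, h ∈ W -> rel rho h a ->
       is_sup (fun c => exists g b, g ∈ W /\ lt_mod Y D g h /\
                          rel rho g b /\ is_succ c b) a) /\
    f ∈ W /\ rel rho f alpha.

Definition is_rk_const {M : structure} (Y D lam alpha : M) : Prop :=
  exists f, (forall p, p ∈ f <-> exists s, s ∈ Y /\ is_pair p s lam) /\
    is_rk Y D f alpha.

(* The first conjunct says that no rank in the supremum is infinity. *)
Definition is_alpha_star {M : structure} (kap lam alpha : M) : Prop :=
  (forall D, Fil1 kap D -> exists a, is_rk_const kap D lam a) /\
  is_sup (fun a => exists D, Fil1 kap D /\ is_rk_const kap D lam a) alpha.

(* X_kappa = ^omega (Fil^4(kappa)) *)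
Definition X {M : structure} (d kap : M) : class M :=
  fun t => exists w, is_omega w /\ functions (ext w) (Fil4 d kap) t.

(* y is a sequence <(S_t, <_t) : t in X_kappa> *)
Definition is_sequence {M : structure} (d kap y : M) : Prop :=
  is_fun_on y (X d kap) /\
  forall t v, rel y t v -> exists S r, is_pair v S r.

Definition entry {M : structure} (y t S r : M) : Prop :=
  exists v, rel y t v /\ is_pair v S r.

Definition covers_functions {M : structure} (d kap lam y : M) : Prop :=
  forall f, functions (ext kap) (ext lam) f <->
    exists t S r, X d kap t /\ entry y t S r /\ f ∈ S.

Definition terms_well_ordered {M : structure} (d kap y : M) : Prop :=
  forall t S r, X d kap t -> entry y t S r -> well_orders r S.

Definition equivalence_on {M : structure} (E : M) (A : class M) : Prop :=
  (forall p, p ∈ E -> prod A A p) /\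
  (forall x, A x -> rel E x x) /\
  (forall x y, rel E x y -> rel E y x) /\
  (forall x y z, rel E x y -> rel E y z -> rel E x z).

Definition is_quotient {M : structure} (Q : M) (A : class M) (E : M) : Prop :=
  forall c, c ∈ Q <-> exists x, A x /\ forall z, z ∈ c <-> rel E x z.

Definition well_ordered_quotient {M : structure} (d kap lam : M) : Prop :=
  exists E Q,
    equivalence_on E (functions (ext kap) (ext lam)) /\
    is_quotient Q (functions (ext kap) (ext lam)) E /\
    well_orderable Q /\
    (forall c, c ∈ Q -> card_le (ext c) (X d kap)).

Definition index_pairs {M : structure} (d kap Sb : M) : class M :=
  fun p => exists t s a, X d kap t /\ rel Sb t s /\ a ∈ s /\ is_pair p t a.

Definition is_partition {M : structure} (F beta : M) (A : class M) : Prop :=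
  is_fun_on F (ext beta) /\
  (forall b P, rel F b P -> ~ is_empty P) /\
  (forall b b' P P' f, rel F b P -> rel F b' P' -> f ∈ P -> f ∈ P' ->
     b = b') /\
  (forall f, A f <-> exists b P, rel F b P /\ f ∈ P).

Definition well_ordered_representation {M : structure} (d kap lam : M) : Prop :=
  exists g Sb F beta,
    is_fun_on Sb (X d kap) /\
    is_fun_on g (index_pairs d kap Sb) /\
    ordinal beta /\
    (exists alpha theta, is_alpha_star kap lam alpha /\
       is_hrtg (subsets_aleph0 (ext alpha)) theta /\ beta ∈ theta) /\
    (forall b, b ∈ beta <-> exists t s, X d kap t /\ rel Sb t s /\ b ∈ s) /\
    (forall f, functions (ext kap) (ext lam) f <->
       exists p, index_pairs d kap Sb p /\ rel g p f) /\
    (forall t1 a1 p1 t2 a2 p2 f, is_pair p1 t1 a1 -> is_pair p2 t2 a2 ->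
       rel g p1 f -> rel g p2 f -> a1 = a2) /\
    is_partition F beta (functions (ext kap) (ext lam)) /\
    (forall b P, rel F b P -> qu_le (ext P) (X d kap)).

Definition good_sequence {M : structure} (d kap lam y : M) : Prop :=
  is_sequence d kap y /\ covers_functions d kap lam y /\ terms_well_ordered d kap y /\
  well_ordered_quotient d kap lam /\ well_ordered_representation d kap lam.

(* The values of the free variables 0, ..., 4 of a defining formula.  Every
   other variable also denotes [r], so that no further parameter is allowed.
   The fixed cardinal [d] is a constant of the context, hence a parameter. *)
Definition env {M : structure} (y kap lam d r : M) : nat -> M :=
  fun n => match n with
           | 0 => y | 1 => kap | 2 => lam | 3 => d | _ => r
           end.

(* The formula [phi] d-uniformly defines, from (kap, lam), an object with the
   property [psi]. *)
Definition uniformly_defines {M : structure} (phi : formula) (d kap lam : M)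
    (psi : class M) : Prop :=
  exists mu0, aleph mu0 /\
    forall mu, aleph mu -> ord_le mu0 mu -> ord_le d mu -> Ax4 mu d ->
      forall S r, Ax4_witness mu d S -> well_orders r S ->
        exists! y, sat (env y kap lam d r) phi /\ psi y.

(* Main.v *)
(* Fix a filter D on kap and f : kap -> lam.  The sets A such that A is null
   modulo D or rk_(D+A)(f) > rk_D(f) form an aleph_1-complete ideal, and f
   modulo the dual filter D2 is determined by D, D2 and the ordinal rk_D(f).
   The covering family given by Ax4 yields a closure operation on sets of
   ordinals, for which the closures of the sets f[Z] with Z in D2 intersect in
   a small set, the hull, that depends on f only modulo D2 and contains the
   values of f on a set in D2.  So on that set f is determined by D, D2,
   rk_D(f) and the positions of its values in the hull.

   To cover all of kap in a canonical way, let D_z be the aleph_1-complete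
   filter generated by the complements of the sets obtained from the D_x with
   x < z.  These filters increase strictly until one is improper, and then
   countably many of the sets cover kap.  Let u be the first member of the
   family which is the cover of a countable set of ordinals below alpha-star
   that contains enough of the ranks rk_(D_z)(f).  For each s in kap take the
   first D_z that handles s and whose rank is in u.  The resulting kap-sequence
   of filters is merged into one filter on kap by Goedel's pairing function, so
   that f is determined by u and an element of X_kap, both of them definable
   from f.  Every clause of the theorem follows from this coding: comparing
   functions by u gives the well orderings and the equivalence relation. *)

From Stdlib Require Import Classical ClassicalEpsilon.
From Stdlib Require Import FunctionalExtensionality PropExtensionality.
Require Import Defs.

(** * Definability in models of ZF + DC *)

(** Without choice nothing can be picked separately for each [s] in [kap]: every part of a code has
    to be definable from [f] and the parameters. The order of the tower makes the stage serving [s]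
    definable, once the admissible stages are restricted by a definable set of ranks. DC only shows
    that some countable set of ranks suffices; passing to covers and taking the [r]-first one that
    works makes the set canonical, at the price of size less than [d] instead of countable. Ranks
    are collected rather than stages because they lie below alpha-star, so that their covers are
    counted by [alpha-star]^aleph_0 and exist for all large [mu]. An element of X_kappa holds only
    countably many filters while [kap] many are in use, which is why the filters are merged. The
    bound hrtg([kap]^{<=aleph_0} x d) on the functions [h] suits the construction since a point in
    the closure of the range of [f] is named by a countable subset of [kap] and a position below [d]
    in a cover. *)

Record model : Type := Model {
  str :> structure;
  model_ZF : ZF str;
  model_DC : DC str
}.

(* One formula serves all models, as the defining formula of the theorem must. *)

Definition dprop (P : forall M : model, (nat -> M) -> Prop) : Prop :=
  exists p, forall M e, sat e p <-> P M e.

Definition dterm (t : forall M : model, (nat -> M) -> M) : Prop :=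
  dprop (fun M e => e 0 = t M (fun n => e (S n))).

Fixpoint ren (r : nat -> nat) (p : formula) : formula :=
  match p with
  | fMem i j => fMem (r i) (r j)
  | fEq i j => fEq (r i) (r j)
  | fNot q => fNot (ren r q)
  | fAnd q q' => fAnd (ren r q) (ren r q')
  | fAll q => fAll (ren (fun n => match n with O => O | S m => S (r m) end) q)
  end.

Lemma sat_ren (M : structure) (p : formula) :
  forall r (e : nat -> M), sat e (ren r p) <-> sat (fun n => e (r n)) p.
Proof.
  induction p as [i j|i j|p IH|p IHp q IHq|p IH]; intros r e; simpl; try tauto.
  - now rewrite IH.
  - now rewrite IHp, IHq.
  - split; intros H x; specialize (H x).
    + apply IH in H.
      replace (scons x (fun n => e (r n))) with
        (fun n => scons x e match n with O => O | S m => S (r m) end); auto.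
      extensionality n; destruct n; reflexivity.
    + apply IH.
      replace (fun n => scons x e match n with O => O | S m => S (r m) end)
        with (scons x (fun n => e (r n))); auto.
      extensionality n; destruct n; reflexivity.
Qed.

Lemma dprop_ren (r : nat -> nat) P :
  dprop P -> dprop (fun M e => P M (fun n => e (r n))).
Proof.
  intros [p H]; exists (ren r p); intros M e; rewrite sat_ren; apply H.
Qed.

Lemma dterm_ren (r : nat -> nat) t :
  dterm t -> dterm (fun M e => t M (fun n => e (r n))).
Proof.
  intros H. unfold dterm.
  exact (dprop_ren (fun n => match n with O => O | S m => S (r m) end) _ H).
Qed.

Lemma dprop_ext P Q : (forall M e, P M e <-> Q M e) -> dprop P -> dprop Q.
Proof. intros E [p H]; exists p; intros M e; rewrite H; apply E. Qed.

Lemma d_not P : dprop P -> dprop (fun M e => ~ P M e).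
Proof. intros [p H]; exists (fNot p); intros M e; simpl; now rewrite H. Qed.

Lemma d_and P Q : dprop P -> dprop Q -> dprop (fun M e => P M e /\ Q M e).
Proof.
  intros [p H] [q K]; exists (fAnd p q); intros M e; simpl; now rewrite H, K.
Qed.

(** A binder of the metalanguage corresponds to index 0 with the other indices shifted. All premises
    about predicates with an argument have this shape, so that beta reduction yields a goal to which
    the same rules apply. *)
Lemma d_all P : dprop (fun M e => P M (fun n => e (S n)) (e 0)) ->
  dprop (fun M e => forall x : M, P M e x).
Proof.
  intros [p H]; exists (fAll p); intros M e; simpl.
  split; intros K x; specialize (K x); apply H in K || apply H; exact K.
Qed.

Lemma d_or P Q : dprop P -> dprop Q -> dprop (fun M e => P M e \/ Q M e).
Proof.
  intros H K.
  apply (dprop_ext (fun M e => ~ (~ P M e /\ ~ Q M e))).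
  - intros M e; destruct (classic (P M e)); tauto.
  - auto using d_not, d_and.
Qed.

Lemma d_imp P Q : dprop P -> dprop Q -> dprop (fun M e => P M e -> Q M e).
Proof.
  intros H K.
  apply (dprop_ext (fun M e => ~ (P M e /\ ~ Q M e))).
  - intros M e; destruct (classic (Q M e)); tauto.
  - auto using d_not, d_and.
Qed.

Lemma d_iff P Q : dprop P -> dprop Q -> dprop (fun M e => P M e <-> Q M e).
Proof. intros; apply d_and; apply d_imp; assumption. Qed.

Lemma d_ex P : dprop (fun M e => P M (fun n => e (S n)) (e 0)) ->
  dprop (fun M e => ex (P M e)).
Proof.
  intros H.
  apply (dprop_ext (fun M e => ~ forall x : M, ~ P M e x)).
  - intros M e; split.
    + intros K; apply NNPP; intros N; apply K; intros x Px; apply N; eauto.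
    + intros [x Px] K; exact (K x Px).
  - apply d_not, d_all, d_not, H.
Qed.

(** Formulas have no compound terms: [Q(t)] is expressed as the existence of some [x] with [x = t]
    and [Q(x)]. *)
Lemma d_subst Q t : dprop (fun M e => Q M (fun n => e (S n)) (e 0)) -> dterm t ->
  dprop (fun M e => Q M e (t M e)).
Proof.
  intros [q H] [p K].
  exists (fNot (fAll (fNot (fAnd p q)))); intros M e; simpl; split.
  - intros N; apply NNPP; intros C; apply N; intros x [A B].
    apply H in B; apply K in A; simpl in A, B; subst x; exact (C B).
  - intros A N; apply (N (t M e)); split; [apply K|apply H]; simpl; auto.
Qed.

Lemma t_var k : dterm (fun M e => e k).
Proof. exists (fEq 0 (S k)); intros; simpl; tauto. Qed.

Lemma d_eq s t : dterm s -> dterm t -> dprop (fun M e => s M e = t M e).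
Proof.
  intros Hs Ht.
  apply (d_subst (fun M e x => s M e = x)); [|exact Ht].
  apply (d_subst (fun M e y => y = e 0)); [|exact (dterm_ren S _ Hs)].
  exists (fEq 0 1); intros; simpl; tauto.
Qed.

Lemma d_mem s t : dterm s -> dterm t -> dprop (fun M e => s M e ∈ t M e).
Proof.
  intros Hs Ht.
  apply (d_subst (fun M e x => s M e ∈ x)); [|exact Ht].
  apply (d_subst (fun M e y => y ∈ e 0)); [|exact (dterm_ren S _ Hs)].
  exists (fMem 0 1); intros; simpl; tauto.
Qed.

Lemma d_true : dprop (fun M e => True).
Proof.
  exists (fNot (fAnd (fEq 0 0) (fNot (fEq 0 0)))); intros; simpl; tauto.
Qed.

(** The hints treat constants as opaque, so the uniqueness quantifier is unfolded here, by
    conversion. *)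
Lemma d_exu P :
  dprop (fun M e => exists x : M, P M e x /\ forall y, P M e y -> x = y) ->
  dprop (fun M e => exists! x : M, P M e x).
Proof. intros H; exact H. Qed.

Create HintDb defn discriminated.
#[local] Hint Constants Opaque : defn.
#[local] Hint Variables Opaque : defn.
#[local] Hint Transparent class : defn.
#[local] Hint Resolve d_not d_and d_all d_or d_imp d_iff d_ex t_var d_eq d_mem d_true d_exu : defn.

Ltac dsolve := cbv beta zeta; typeclasses eauto with defn nocore.

(** * Definite descriptions and comprehension terms *)

Definition the_spec {M : model} (P : M -> Prop) (y : M) : Prop :=
  (P y /\ forall z, P z -> z = y) \/
  (~ (exists x, P x /\ forall z, P z -> z = x) /\ is_empty y).

Lemma empty_exists (M : model) : exists x : M, is_empty x.
Proof.
  destruct (model_ZF M) as (_ & _ & _ & _ & _ & [x [[e [He _]] _]] & _).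
  eauto.
Qed.

Lemma ext_eq (M : model) (x y : M) : (forall z, z ∈ x <-> z ∈ y) -> x = y.
Proof. apply (proj1 (model_ZF M)). Qed.

Lemma is_empty_unique (M : model) (x y : M) : is_empty x -> is_empty y -> x = y.
Proof. intros H K; apply ext_eq; intros z; split; intros; exfalso; firstorder. Qed.

(* Opaque, so that conversion never unfolds a description. *)

Lemma the_sig :
  {t : forall M : model, (M -> Prop) -> M | forall M P, the_spec P (t M P)}.
Proof.
  apply constructive_indefinite_description.
  assert (H : forall (M : model) (P : M -> Prop), exists y, the_spec P y).
  { intros M P.
    destruct (classic (exists x, P x /\ forall z, P z -> z = x)) as [[x Hx]|N].
    - exists x; left; exact Hx.
    - destruct (empty_exists M) as [x Hx]; exists x; right; auto. }
  exists (fun M P => proj1_sig (constructive_indefinite_description _ (H M P))).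
  intros M P; apply proj2_sig.
Qed.

(* The unique element satisfying [P], and the empty set if there is none. *)

Definition the {M : model} (P : M -> Prop) : M := proj1_sig the_sig M P.

Lemma the_specP (M : model) (P : M -> Prop) y : y = the P <-> the_spec P y.
Proof.
  assert (H : the_spec P (the P)) by apply (proj2_sig the_sig).
  split; [intros ->; exact H|].
  destruct H as [[A B]|[A B]]; intros [[C D]|[C D]].
  - auto.
  - destruct C; eauto.
  - destruct A; eauto.
  - now apply is_empty_unique.
Qed.

Lemma the_eq (M : model) (P : M -> Prop) y :
  P y -> (forall z, P z -> z = y) -> the P = y.
Proof. intros A B; symmetry; apply the_specP; left; auto. Qed.

Lemma the_ex (M : model) (P : M -> Prop) : (exists! y, P y) -> P (the P).
Proof.
  intros [y [A B]]; rewrite (the_eq _ P y); auto. intros z Hz; symmetry; auto.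
Qed.

Lemma d_is_empty a : dterm a -> dprop (fun M e => is_empty (a M e)).
Proof.
  intros H. apply (d_subst (fun M e x => is_empty x)); [|exact H].
  unfold is_empty; dsolve.
Qed.
#[local] Hint Resolve d_is_empty : defn.

Lemma t_the P : dprop (fun M e => P M (fun n => e (S n)) (e 0)) ->
  dterm (fun M e => the (P M e)).
Proof.
  intros H. unfold dterm.
  apply (dprop_ext (fun M e => the_spec (P M (fun n => e (S n))) (e 0))).
  { intros M e; rewrite the_specP; tauto. }
  unfold the_spec.
  (* Inside [the_spec] the predicate occurs under different numbers of binders, and each occurrence
     needs its own renaming. *)
  assert (K : dprop (fun M e => P M (fun n => e (S (S n))) (e 0))).
  { exact (dprop_ren (fun n => match n with O => O | S m => S (S m) end) _ H). }
  assert (L : dprop (fun M e => P M (fun n => e (S (S (S n)))) (e 0))).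
  { exact (dprop_ren (fun n => match n with O => O | S m => S (S (S m)) end) _ H). }
  assert (K1 : dprop (fun M e => P M (fun n => e (S n)) (e 0))) by exact H.
  apply d_or.
  - apply d_and; [exact K1|]. apply d_all, d_imp; [exact K|dsolve].
  - apply d_and; [|dsolve].
    apply d_not, d_ex, d_and; [exact K|].
    apply d_all, d_imp; [exact L|dsolve].
Qed.

(* The set of all [x] with [P x]; the empty set if these form a proper class. *)

Definition compr {M : model} (P : M -> Prop) : M :=
  the (fun y => forall x, x ∈ y <-> P x).

Lemma t_compr P : dprop (fun M e => P M (fun n => e (S n)) (e 0)) ->
  dterm (fun M e => compr (P M e)).
Proof.
  intros H. unfold compr. apply t_the, d_all, d_iff; [dsolve|].
  exact (dprop_ren (fun n => match n with O => O | S m => S (S m) end) _ H).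
Qed.
#[local] Hint Resolve t_the t_compr : defn.

(* [P] is definable from finitely many parameters in [M]. *)

Definition def1 (M : model) (P : M -> Prop) : Prop :=
  exists (Q : forall N : model, (nat -> N) -> Prop) (e : nat -> M),
    dprop Q /\ forall x, P x <-> Q M (scons x e).

Definition def2 (M : model) (P : M -> M -> Prop) : Prop :=
  exists (Q : forall N : model, (nat -> N) -> Prop) (e : nat -> M),
    dprop Q /\ forall x y, P x y <-> Q M (scons x (scons y e)).

Ltac find_var M P :=
  match P with
  | context [?c] =>
      let _ := match goal with _ => is_var c end in
      let T := type of c in
      let _ := match goal with _ => constr_eq T (carrier (str M)) end in
      c
  end.

(** The elements are abstracted before [M], since their types depend on it. [match constr:(Set)] is
    a choice point whose second branch is taken once [find_var] finds no further element. *)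
Ltac abs_params M P env cont :=
  match constr:(Set) with
  | _ => let c := find_var M P in
         let F := eval pattern c in P in
         lazymatch F with
         | ?G _ => abs_params M G (scons c env) cont
         end
  | _ => cont P env
  end.

Ltac app_env Q k env :=
  lazymatch env with
  | scons _ ?env' =>
      let Q' := constr:(fun (N : model) (e : nat -> N) => Q N e (e k)) in
      app_env Q' (S k) env'
  | _ => Q
  end.

(* Turns the variables of the goal that denote elements of [M] into values of
   an environment, which leaves a predicate that is uniform in the model. *)
Ltac def :=
  lazymatch goal with
  | |- def1 ?M ?P =>
      abs_params M P (fun _ : nat => the (fun _ : M => False)) ltac:(fun H env =>
        let H' := eval pattern M in H in
        lazymatch H' with
        | ?K _ =>
            let Q0 := constr:(fun (N : model) (e : nat -> N) => K N) in
            let Q := app_env Q0 1 env in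
            let Q1 := constr:(fun (N : model) (e : nat -> N) => Q N e (e 0)) in
            let Q2 := eval cbv beta in Q1 in
            exists Q2, env; split; [dsolve|intros; apply iff_refl]
        end)
  | |- def2 ?M ?P =>
      abs_params M P (fun _ : nat => the (fun _ : M => False)) ltac:(fun H env =>
        let H' := eval pattern M in H in
        lazymatch H' with
        | ?K _ =>
            let Q0 := constr:(fun (N : model) (e : nat -> N) => K N) in
            let Q := app_env Q0 2 env in
            let Q1 := constr:(fun (N : model) (e : nat -> N) => Q N e (e 0) (e 1)) in
            let Q2 := eval cbv beta in Q1 in
            exists Q2, env; split; [dsolve|intros; apply iff_refl]
        end)
  end.

(** * Sets, pairs and functions *)

(** In an unfolded definition a class argument occurs under additional binders and at other terms;
    hence the arbitrary renaming [r] and argument [t]. *)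
Lemma d_class A : dprop (fun M e => A M (fun n => e (S n)) (e 0)) ->
  forall r t, dterm t -> dprop (fun M e => A M (fun n => e (r n)) (t M e)).
Proof.
  intros H r t Ht.
  apply (d_subst (fun M e x => A M (fun n => e (r n)) x)); [|exact Ht].
  exact (dprop_ren (fun n => match n with O => O | S m => S (r m) end) _ H).
Qed.

Lemma t_class F : dterm (fun M e => F M (fun n => e (S n)) (e 0)) ->
  forall r t, dterm t -> dterm (fun M e => F M (fun n => e (r n)) (t M e)).
Proof.
  intros H r t Ht. unfold dterm.
  apply (d_subst (fun M e x => e 0 = F M (fun n => e (S (r n))) x));
    [|exact (dterm_ren S _ Ht)].
  exact (dprop_ren (fun n => match n with O => 1 | 1 => 0 | S (S m) => S (S (r m)) end) _ H).
Qed.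

(* makes the hypotheses of the goal usable under quantifiers *)
Ltac dlift :=
  repeat match goal with
  | H : dprop (fun M e => ?A M (fun n => e (S n)) (e 0)) |- _ =>
      generalize (d_class A H); clear H
  | H : dterm (fun M e => ?F M (fun n => e (S n)) (e 0)) |- _ =>
      generalize (t_class F H); clear H
  | H : dterm ?a |- _ => generalize (fun r => dterm_ren r a H); revert H
  end; intros.

Ltac dunfold c := intros; dlift; unfold c; dsolve.

Lemma d_ext a b : dterm a -> dterm b -> dprop (fun M e => ext (a M e) (b M e)).
Proof. dunfold @ext. Qed.

Lemma d_subset a b : dterm a -> dterm b ->
  dprop (fun M e => subset (a M e) (b M e)).
Proof. dunfold @subset. Qed.

Lemma d_is_upair a b c : dterm a -> dterm b -> dterm c ->
  dprop (fun M e => is_upair (a M e) (b M e) (c M e)).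
Proof. dunfold @is_upair. Qed.
#[local] Hint Resolve d_ext d_subset d_is_upair : defn.

Lemma d_is_pair a b c : dterm a -> dterm b -> dterm c ->
  dprop (fun M e => is_pair (a M e) (b M e) (c M e)).
Proof. dunfold @is_pair. Qed.
#[local] Hint Resolve d_is_pair : defn.

Lemma d_is_quadruple q a b c d : dterm q -> dterm a -> dterm b -> dterm c ->
  dterm d -> dprop (fun M e => is_quadruple (q M e) (a M e) (b M e) (c M e) (d M e)).
Proof. dunfold @is_quadruple. Qed.

Lemma d_is_succ a b : dterm a -> dterm b ->
  dprop (fun M e => is_succ (a M e) (b M e)).
Proof. dunfold @is_succ. Qed.

Lemma d_rel a b c : dterm a -> dterm b -> dterm c ->
  dprop (fun M e => rel (a M e) (b M e) (c M e)).
Proof. dunfold @rel. Qed.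
#[local] Hint Resolve d_is_quadruple d_is_succ d_rel : defn.

Lemma d_inductive_set a : dterm a -> dprop (fun M e => inductive_set (a M e)).
Proof. dunfold @inductive_set. Qed.
#[local] Hint Resolve d_inductive_set : defn.

Lemma d_is_omega a : dterm a -> dprop (fun M e => is_omega (a M e)).
Proof. dunfold @is_omega. Qed.

Lemma d_maps f A B : dterm f -> dprop (fun M e => A M (fun n => e (S n)) (e 0)) ->
  dprop (fun M e => B M (fun n => e (S n)) (e 0)) ->
  dprop (fun M e => maps (f M e) (A M e) (B M e)).
Proof. dunfold @maps. Qed.

Lemma d_injective f : dterm f -> dprop (fun M e => injective (f M e)).
Proof. dunfold @injective. Qed.

Lemma d_onto f B : dterm f -> dprop (fun M e => B M (fun n => e (S n)) (e 0)) ->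
  dprop (fun M e => onto (f M e) (B M e)).
Proof. dunfold @onto. Qed.
#[local] Hint Resolve d_is_omega d_maps d_injective d_onto : defn.

Lemma d_functions f A B : dterm f -> dprop (fun M e => A M (fun n => e (S n)) (e 0)) ->
  dprop (fun M e => B M (fun n => e (S n)) (e 0)) ->
  dprop (fun M e => functions (A M e) (B M e) (f M e)).
Proof. dunfold @functions. Qed.

Lemma d_prod p A B : dterm p -> dprop (fun M e => A M (fun n => e (S n)) (e 0)) ->
  dprop (fun M e => B M (fun n => e (S n)) (e 0)) ->
  dprop (fun M e => prod (A M e) (B M e) (p M e)).
Proof. dunfold @prod. Qed.

Lemma d_ordinal a : dterm a -> dprop (fun M e => ordinal (a M e)).
Proof. dunfold @ordinal. Qed.

Lemma d_card_le A B : dprop (fun M e => A M (fun n => e (S n)) (e 0)) ->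
  dprop (fun M e => B M (fun n => e (S n)) (e 0)) ->
  dprop (fun M e => card_le (A M e) (B M e)).
Proof. dunfold @card_le. Qed.
#[local] Hint Resolve d_functions d_prod d_ordinal d_card_le : defn.

Lemma d_card_lt A B : dprop (fun M e => A M (fun n => e (S n)) (e 0)) ->
  dprop (fun M e => B M (fun n => e (S n)) (e 0)) ->
  dprop (fun M e => card_lt (A M e) (B M e)).
Proof. dunfold @card_lt. Qed.

Lemma d_card_eq A B : dprop (fun M e => A M (fun n => e (S n)) (e 0)) ->
  dprop (fun M e => B M (fun n => e (S n)) (e 0)) ->
  dprop (fun M e => card_eq (A M e) (B M e)).
Proof. dunfold @card_eq. Qed.
#[local] Hint Resolve d_card_lt d_card_eq : defn.

Lemma d_ord_le a b : dterm a -> dterm b ->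
  dprop (fun M e => ord_le (a M e) (b M e)).
Proof. dunfold @ord_le. Qed.
#[local] Hint Resolve d_ord_le : defn.

Lemma d_aleph a : dterm a -> dprop (fun M e => aleph (a M e)).
Proof. dunfold @aleph. Qed.
#[local] Hint Resolve d_aleph : defn.

Lemma d_is_aleph1 a : dterm a -> dprop (fun M e => is_aleph1 (a M e)).
Proof. dunfold @is_aleph1. Qed.

Lemma d_is_hrtg A t : dprop (fun M e => A M (fun n => e (S n)) (e 0)) ->
  dterm t -> dprop (fun M e => is_hrtg (A M e) (t M e)).
Proof. dunfold @is_hrtg. Qed.

Lemma d_subsets_card_lt A k u : dprop (fun M e => A M (fun n => e (S n)) (e 0)) ->
  dterm k -> dterm u ->
  dprop (fun M e => subsets_card_lt (A M e) (k M e) (u M e)).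
Proof. dunfold @subsets_card_lt. Qed.
#[local] Hint Resolve d_is_aleph1 d_is_hrtg d_subsets_card_lt : defn.

Lemma d_subsets_lt_aleph1 A u : dprop (fun M e => A M (fun n => e (S n)) (e 0)) ->
  dterm u -> dprop (fun M e => subsets_lt_aleph1 (A M e) (u M e)).
Proof. dunfold @subsets_lt_aleph1. Qed.

Lemma d_subsets_le_aleph0 A u : dprop (fun M e => A M (fun n => e (S n)) (e 0)) ->
  dterm u -> dprop (fun M e => subsets_le_aleph0 (A M e) (u M e)).
Proof. dunfold @subsets_le_aleph0. Qed.

Lemma d_subsets_aleph0 A u : dprop (fun M e => A M (fun n => e (S n)) (e 0)) ->
  dterm u -> dprop (fun M e => subsets_aleph0 (A M e) (u M e)).
Proof. dunfold @subsets_aleph0. Qed.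

Lemma d_filter Y D : dterm Y -> dterm D -> dprop (fun M e => filter (Y M e) (D M e)).
Proof. dunfold @filter. Qed.
#[local] Hint Resolve d_subsets_lt_aleph1 d_subsets_le_aleph0 d_subsets_aleph0 d_filter : defn.

Lemma d_aleph1_complete Y D : dterm Y -> dterm D ->
  dprop (fun M e => aleph1_complete (Y M e) (D M e)).
Proof. dunfold @aleph1_complete. Qed.

Lemma d_proper D : dterm D -> dprop (fun M e => proper (D M e)).
Proof. dunfold @proper. Qed.
#[local] Hint Resolve d_aleph1_complete d_proper : defn.

Lemma d_Fil4 d Y q : dterm d -> dterm Y -> dterm q ->
  dprop (fun M e => Fil4 (d M e) (Y M e) (q M e)).
Proof. dunfold @Fil4. Qed.
#[local] Hint Resolve d_Fil4 : defn.

Lemma d_X d Y t : dterm d -> dterm Y -> dterm t ->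
  dprop (fun M e => X (d M e) (Y M e) (t M e)).
Proof. dunfold @X. Qed.
#[local] Hint Resolve d_X : defn.

Section Sets.
Context {M : model}.
Implicit Types a b c f x y z : M.

Lemma separation_ex (P : M -> Prop) a : def1 M P ->
  exists b, forall x, x ∈ b <-> x ∈ a /\ P x.
Proof.
  intros (Q & e & [p Hp] & H).
  destruct (model_ZF M) as (_ & _ & _ & _ & _ & _ & Sep & _).
  destruct (Sep p e a) as [b Hb]; exists b; intros x.
  rewrite Hb, H, Hp; tauto.
Qed.

(** [compr] has a default value for proper classes; the bound [a] rules it out. *)
Lemma in_compr (P : M -> Prop) a : def1 M P -> (forall x, P x -> x ∈ a) ->
  forall x, x ∈ compr P <-> P x.
Proof.
  intros HP Ha. unfold compr.
  apply (the_ex M (fun y => forall x, x ∈ y <-> P x)).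
  destruct (separation_ex P a HP) as [b Hb]; exists b; split.
  - intros x; rewrite Hb; split; [tauto|auto].
  - intros c Hc; apply ext_eq; intros x; rewrite Hb, Hc; split; [tauto|auto].
Qed.

Lemma compr_ext (P Q : M -> Prop) : (forall x, P x <-> Q x) -> compr P = compr Q.
Proof.
  intros H; f_equal; extensionality x; apply propositional_extensionality, H.
Qed.

Definition empty : M := compr (fun _ => False).

Lemma in_empty x : ~ x ∈ empty.
Proof.
  unfold empty. rewrite (in_compr (fun _ => False) (the (fun _ => False))); auto.
  - exists (fun _ _ => ~ True), (fun _ => the (fun _ : M => False)).
    split; [dsolve|tauto].
  - tauto.
Qed.

Lemma is_empty_iff x : is_empty x <-> x = empty.
Proof.
  split; [|intros -> z; apply in_empty].
  intros H; apply ext_eq; intros z; split; intros K; exfalso.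
  - exact (H z K).
  - exact (in_empty z K).
Qed.

Lemma mem_nonempty x z : z ∈ x -> x <> empty.
Proof. intros H ->; exact (in_empty z H). Qed.

Lemma nonempty_ex x : x <> empty -> exists z, z ∈ x.
Proof.
  intros H; apply NNPP; intros N; apply H, is_empty_iff; intros z Hz; eauto.
Qed.

Definition upair x y : M := compr (fun z => z = x \/ z = y).

Lemma in_upair x y z : z ∈ upair x y <-> z = x \/ z = y.
Proof.
  destruct (model_ZF M) as (_ & _ & Pr & _).
  destruct (Pr x y) as [u Hu].
  unfold upair; apply (in_compr (fun z => z = x \/ z = y) u); [def|apply Hu].
Qed.

Definition sing x : M := upair x x.

Lemma in_sing x z : z ∈ sing x <-> z = x.
Proof. unfold sing; rewrite in_upair; tauto. Qed.

Definition pair x y : M := upair (sing x) (upair x y).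

Lemma is_upair_iff z x y : is_upair z x y <-> z = upair x y.
Proof.
  split.
  - intros H; apply ext_eq; intros w; rewrite in_upair; apply H.
  - intros -> w; apply in_upair.
Qed.

Lemma is_pair_iff p x y : is_pair p x y <-> p = pair x y.
Proof.
  unfold is_pair; split.
  - intros H; apply ext_eq; intros w; rewrite H; unfold pair.
    rewrite in_upair, !is_upair_iff; tauto.
  - intros -> w; unfold pair; rewrite in_upair, !is_upair_iff; tauto.
Qed.

Lemma upair_inj x y x' y' : upair x y = upair x' y' ->
  (x = x' /\ y = y') \/ (x = y' /\ y = x').
Proof.
  intros H.
  assert (A : x ∈ upair x' y') by (rewrite <- H; apply in_upair; auto).
  assert (B : y ∈ upair x' y') by (rewrite <- H; apply in_upair; auto).
  assert (C : x' ∈ upair x y) by (rewrite H; apply in_upair; auto).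
  assert (D : y' ∈ upair x y) by (rewrite H; apply in_upair; auto).
  rewrite in_upair in A, B, C, D. intuition congruence.
Qed.

Lemma pair_inj x y x' y' : pair x y = pair x' y' -> x = x' /\ y = y'.
Proof.
  intros H; apply upair_inj in H as [[A B]|[A B]].
  - apply upair_inj in A, B; intuition congruence.
  - apply upair_inj in A, B; intuition congruence.
Qed.

Lemma rel_iff r x y : rel r x y <-> pair x y ∈ r.
Proof.
  unfold rel; split.
  - intros [p [A B]]; apply is_pair_iff in A; subst; auto.
  - intros H; exists (pair x y); split; auto; apply is_pair_iff; auto.
Qed.

Lemma prod_iff (A B : class M) p :
  prod A B p <-> exists x y, A x /\ B y /\ p = pair x y.
Proof.
  unfold prod; split; intros (x & y & Hx & Hy & Hp); exists x, y;
    rewrite is_pair_iff in *; auto.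
Qed.

Definition bigU x : M := compr (fun z => exists y, y ∈ x /\ z ∈ y).

Lemma in_bigU x z : z ∈ bigU x <-> exists y, y ∈ x /\ z ∈ y.
Proof.
  destruct (model_ZF M) as (_ & _ & _ & U & _).
  destruct (U x) as [u Hu].
  apply (in_compr (fun z => exists y, y ∈ x /\ z ∈ y) u); [def|apply Hu].
Qed.

Definition power x : M := compr (fun z => subset z x).

Lemma in_power x z : z ∈ power x <-> subset z x.
Proof.
  destruct (model_ZF M) as (_ & _ & _ & _ & U & _).
  destruct (U x) as [u Hu].
  apply (in_compr (fun z => subset z x) u); [def|apply Hu].
Qed.

Definition cup x y : M := compr (fun z => z ∈ x \/ z ∈ y).

Lemma in_cup x y z : z ∈ cup x y <-> z ∈ x \/ z ∈ y.
Proof.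
  apply (in_compr (fun z => z ∈ x \/ z ∈ y) (bigU (upair x y))); [def|].
  intros w H; apply in_bigU.
  destruct H; [exists x|exists y]; rewrite in_upair; auto.
Qed.

Definition cap x y : M := compr (fun z => z ∈ x /\ z ∈ y).

Lemma in_cap x y z : z ∈ cap x y <-> z ∈ x /\ z ∈ y.
Proof.
  apply (in_compr (fun z => z ∈ x /\ z ∈ y) x); [def|]. intros w [H _]; auto.
Qed.

Definition diff x y : M := compr (fun z => z ∈ x /\ ~ z ∈ y).

Lemma in_diff x y z : z ∈ diff x y <-> z ∈ x /\ ~ z ∈ y.
Proof.
  apply (in_compr (fun z => z ∈ x /\ ~ z ∈ y) x); [def|]. intros w [H _]; auto.
Qed.

Definition succ x : M := compr (fun z => z ∈ x \/ z = x).

Lemma in_succ x z : z ∈ succ x <-> z ∈ x \/ z = x.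
Proof.
  apply (in_compr (fun z => z ∈ x \/ z = x) (cup x (sing x))); [def|].
  intros w H; rewrite in_cup, in_sing; auto.
Qed.

Lemma is_succ_iff s x : is_succ s x <-> s = succ x.
Proof.
  unfold is_succ; split.
  - intros H; apply ext_eq; intros z; rewrite in_succ; apply H.
  - intros -> z; apply in_succ.
Qed.

Definition times x y : M :=
  compr (fun p => exists s t, s ∈ x /\ t ∈ y /\ p = pair s t).
End Sets.

Lemma t_empty : dterm (fun M _ => empty).
Proof.
  unfold empty. apply t_compr. apply (dprop_ext (fun _ _ => ~ True)); [tauto|].
  dsolve.
Qed.

Lemma t_upair a b : dterm a -> dterm b -> dterm (fun M e => upair (a M e) (b M e)).
Proof. dunfold @upair. Qed.
#[local] Hint Resolve t_empty t_upair : defn.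

Lemma t_sing a : dterm a -> dterm (fun M e => sing (a M e)).
Proof. dunfold @sing. Qed.
#[local] Hint Resolve t_sing : defn.

Lemma t_pair a b : dterm a -> dterm b -> dterm (fun M e => pair (a M e) (b M e)).
Proof. dunfold @pair. Qed.

Lemma t_bigU a : dterm a -> dterm (fun M e => bigU (a M e)).
Proof. dunfold @bigU. Qed.

Lemma t_power a : dterm a -> dterm (fun M e => power (a M e)).
Proof. dunfold @power. Qed.

Lemma t_cup a b : dterm a -> dterm b -> dterm (fun M e => cup (a M e) (b M e)).
Proof. dunfold @cup. Qed.

Lemma t_diff a b : dterm a -> dterm b -> dterm (fun M e => diff (a M e) (b M e)).
Proof. dunfold @diff. Qed.

Lemma t_succ a : dterm a -> dterm (fun M e => succ (a M e)).
Proof. dunfold @succ. Qed.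
#[local] Hint Resolve t_pair t_bigU t_power t_cup t_diff t_succ : defn.

Lemma t_times a b : dterm a -> dterm b -> dterm (fun M e => times (a M e) (b M e)).
Proof. dunfold @times. Qed.
#[local] Hint Resolve t_times : defn.

(** * Functions as sets of pairs *)

Definition dfun (M : model) (F : M -> M) : Prop := def2 M (fun x y => y = F x).

Definition image {M : model} (F : M -> M) (a : M) : M :=
  compr (fun y => exists x, x ∈ a /\ y = F x).

Definition fn {M : model} (a : M) (F : M -> M) : M :=
  compr (fun p => exists x, x ∈ a /\ p = pair x (F x)).

Definition app {M : model} (f x : M) : M := the (fun y => pair x y ∈ f).

Definition funs {M : model} (a b : M) : M :=
  compr (fun f => maps f (ext a) (ext b)).

Definition dom {M : model} (f : M) : M := compr (fun x => exists y, pair x y ∈ f).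

Definition ran {M : model} (f : M) : M := compr (fun y => exists x, pair x y ∈ f).

Lemma t_image F a : dterm (fun M e => F M (fun n => e (S n)) (e 0)) -> dterm a ->
  dterm (fun M e => image (F M e) (a M e)).
Proof. dunfold @image. Qed.

Lemma t_fn F a : dterm a -> dterm (fun M e => F M (fun n => e (S n)) (e 0)) ->
  dterm (fun M e => fn (a M e) (F M e)).
Proof. dunfold @fn. Qed.

Lemma t_app a b : dterm a -> dterm b -> dterm (fun M e => app (a M e) (b M e)).
Proof. dunfold @app. Qed.

Lemma t_funs a b : dterm a -> dterm b -> dterm (fun M e => funs (a M e) (b M e)).
Proof. dunfold @funs. Qed.

Lemma t_dom a : dterm a -> dterm (fun M e => dom (a M e)).
Proof. dunfold @dom. Qed.

Lemma t_ran a : dterm a -> dterm (fun M e => ran (a M e)).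
Proof. dunfold @ran. Qed.
#[local] Hint Resolve t_image t_fn t_app t_funs t_dom t_ran : defn.

Section Functions.
Context {M : model}.
Implicit Types a b c f x y z : M.

Lemma in_times x y p :
  p ∈ times x y <-> exists s t, s ∈ x /\ t ∈ y /\ p = pair s t.
Proof.
  apply (in_compr (fun p => exists s t, s ∈ x /\ t ∈ y /\ p = pair s t)
    (power (power (cup x y)))); [def|].
  intros p' (s & t & Hs & Ht & ->). apply in_power; intros u.
  unfold pair; rewrite in_upair; intros Hu; apply in_power; intros v Hv.
  apply in_cup. destruct Hu; subst u; [apply in_sing in Hv|apply in_upair in Hv];
    intuition subst; auto.
Qed.

Lemma pair_in_times x y s t : pair s t ∈ times x y <-> s ∈ x /\ t ∈ y.
Proof.
  rewrite in_times; split; [|intros []; eauto].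
  intros (s' & t' & A & B & E); apply pair_inj in E as [-> ->]; auto.
Qed.

Lemma in_dom f x : x ∈ dom f <-> exists y, pair x y ∈ f.
Proof.
  apply (in_compr (fun x => exists y, pair x y ∈ f) (bigU (bigU f))); [def|].
  intros z [y Hy]. apply in_bigU; exists (sing z); rewrite in_sing, in_bigU; split; auto.
  exists (pair z y); unfold pair; rewrite in_upair; auto.
Qed.

Lemma in_ran f y : y ∈ ran f <-> exists x, pair x y ∈ f.
Proof.
  apply (in_compr (fun y => exists x, pair x y ∈ f) (bigU (bigU f))); [def|].
  intros z [x Hx]. apply in_bigU; exists (upair x z); rewrite in_upair, in_bigU; split; auto.
  exists (pair x z); unfold pair; rewrite in_upair; auto.
Qed.

Lemma in_image (F : M -> M) a y : dfun M F ->
  (y ∈ image F a <-> exists x, x ∈ a /\ y = F x).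
Proof.
  intros (Q & e & [p Hp] & H).
  assert (E : exists b, forall y, y ∈ b <-> exists x, x ∈ a /\ y = F x).
  { destruct (model_ZF M) as (_ & _ & _ & _ & _ & _ & _ & Rep).
    destruct (Rep p e a) as [b Hb].
    - intros x u v _ A B; apply Hp, H in A; apply Hp, H in B; congruence.
    - exists b; intros u; rewrite Hb; split; intros (x & A & B); exists x; split;
        auto; [apply H, Hp|apply Hp, H]; exact B. }
  destruct E as [b Hb]. unfold image.
  assert (E : compr (fun u => exists x, x ∈ a /\ u = F x) = b).
  { apply the_eq; auto. intros c Hc; apply ext_eq; intros z; rewrite Hc, Hb; tauto. }
  rewrite E; apply Hb.
Qed.

Lemma maps_app f a (B : class M) x :
  maps f (ext a) B -> x ∈ a -> B (app f x) /\ pair x (app f x) ∈ f.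
Proof.
  intros [H K] Hx.
  assert (A : pair x (app f x) ∈ f).
  { apply (the_ex M (fun y => pair x y ∈ f)).
    destruct (K x Hx) as [y [A B']]; exists y; split.
    - now apply rel_iff.
    - intros z Hz; apply B', rel_iff, Hz. }
  split; auto. destruct (H _ A) as (x' & y' & Hx' & Hy' & E).
  apply is_pair_iff, pair_inj in E as [E1 E2]; rewrite E2; auto.
Qed.

Lemma maps_eq f a (B : class M) x y :
  maps f (ext a) B -> pair x y ∈ f -> x ∈ a /\ y = app f x.
Proof.
  intros [H K] Hp. destruct (H _ Hp) as (x' & y' & Hx' & Hy' & E).
  apply is_pair_iff, pair_inj in E as [E1 E2]; subst x' y'.
  split; auto. symmetry; apply the_eq; auto.
  intros z Hz. destruct (K x Hx') as [w [_ A]].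
  rewrite <- (A y), <- (A z); auto; apply rel_iff; auto.
Qed.

Lemma app_rel f a (B : class M) x y : maps f (ext a) B ->
  (rel f x y <-> x ∈ a /\ y = app f x).
Proof.
  intros H; rewrite rel_iff; split; [apply (maps_eq _ _ _ _ _ H)|].
  intros [A ->]; now apply (maps_app _ _ _ _ H).
Qed.

Lemma maps_ext f g a (B B' : class M) : maps f (ext a) B -> maps g (ext a) B' ->
  (forall x, x ∈ a -> app f x = app g x) -> f = g.
Proof.
  intros Hf Hg H; apply ext_eq; intros p; split; intros Hp.
  - destruct (proj1 Hf p Hp) as (x & y & A & _ & E). apply is_pair_iff in E; subst.
    apply (maps_eq _ _ _ _ _ Hf) in Hp as [_ ->]. rewrite H; auto.
    now apply (maps_app _ _ _ _ Hg).
  - destruct (proj1 Hg p Hp) as (x & y & A & _ & E). apply is_pair_iff in E; subst.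
    apply (maps_eq _ _ _ _ _ Hg) in Hp as [_ ->]. rewrite <- H; auto.
    now apply (maps_app _ _ _ _ Hf).
Qed.

Lemma maps_weaken f a (B B' : class M) : maps f (ext a) B ->
  (forall x, x ∈ a -> B' (app f x)) -> maps f (ext a) B'.
Proof.
  intros Hf H; split; [|apply Hf].
  intros p Hp; destruct (proj1 Hf p Hp) as (x & y & A & _ & E); exists x, y.
  split; [exact A|split; [|exact E]]. apply is_pair_iff in E; subst p.
  apply (maps_eq _ _ _ _ _ Hf) in Hp as [_ ->]; auto.
Qed.

Lemma image_ext (F F' : M -> M) a : (forall x, x ∈ a -> F x = F' x) ->
  image F a = image F' a.
Proof.
  intros H; apply compr_ext; intros y; split; intros (x & Hx & ->); exists x;
    split; auto; symmetry; auto.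
Qed.

(** The graph of [F] on a set is the image of that set under this map, so [fn] inherits its
    existence from replacement through [in_image]. *)
Lemma dfun_graph (F : M -> M) : dfun M F -> dfun M (fun x => pair x (F x)).
Proof.
  intros (Q & e & HQ & H).
  exists (fun (N : model) (e : nat -> N) => exists y : N, Q N (scons (e 0) (scons y (fun n => e (S (S n))))) /\
     e 1 = pair (e 0) y), e.
  split.
  - apply d_ex, d_and; [|dsolve].
    refine (dprop_ext _ _ _ (dprop_ren (fun n => match n with O => 1 | 1 => 0 |
      S (S n) => S (S (S n)) end) _ HQ)).
    intros N e'; simpl.
    replace (fun n => e' match n with O => 1 | 1 => 0 | S (S n) => S (S (S n)) end)
      with (scons (e' 1) (scons (e' 0) (fun n => e' (S (S (S n)))))); [tauto|].
    extensionality n; destruct n as [|[|n]]; reflexivity.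
  - intros x y; simpl; split.
    + intros ->; exists (F x); split; auto.
      apply (proj1 (H x (F x))); auto.
    + intros (z & A & ->). now apply (proj2 (H x z)) in A as ->.
Qed.

Lemma in_fn (F : M -> M) a p : dfun M F ->
  (p ∈ fn a F <-> exists x, x ∈ a /\ p = pair x (F x)).
Proof. intros H; exact (in_image _ a p (dfun_graph F H)). Qed.

Lemma fn_maps (F : M -> M) a (B : class M) : dfun M F ->
  (forall x, x ∈ a -> B (F x)) -> maps (fn a F) (ext a) B.
Proof.
  intros HF H; split.
  - intros p Hp; apply in_fn in Hp as (x & Hx & ->); auto.
    exists x, (F x); split; [exact Hx|split; [auto|now apply is_pair_iff]].
  - intros x Hx; exists (F x); split.
    + apply rel_iff, in_fn; eauto.
    + intros y Hy; apply rel_iff, in_fn in Hy as (x' & _ & E); auto.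
      apply pair_inj in E as [-> ->]; auto.
Qed.

Lemma app_fn (F : M -> M) a x : dfun M F -> x ∈ a -> app (fn a F) x = F x.
Proof.
  intros HF Hx.
  assert (K := fn_maps F a (fun _ => True) HF (fun _ _ => I)).
  symmetry; apply (maps_eq _ _ _ _ _ K). apply in_fn; eauto.
Qed.

Lemma in_funs a b f : f ∈ funs a b <-> maps f (ext a) (ext b).
Proof.
  apply (in_compr (fun f => maps f (ext a) (ext b)) (power (times a b))); [def|].
  intros g Hg; apply in_power; intros p Hp.
  destruct (proj1 Hg p Hp) as (x & y & A & B & E).
  apply is_pair_iff in E; subst; apply pair_in_times; auto.
Qed.

Lemma funs_fn (F : M -> M) a b : dfun M F -> (forall x, x ∈ a -> F x ∈ b) ->
  fn a F ∈ funs a b.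
Proof. intros; apply in_funs, fn_maps; auto. Qed.

Lemma app_funs a b f x : f ∈ funs a b -> x ∈ a -> app f x ∈ b.
Proof. intros H; apply in_funs in H; apply (maps_app _ _ _ _ H). Qed.

Lemma funs_ext a b b' f g : f ∈ funs a b -> g ∈ funs a b' ->
  (forall x, x ∈ a -> app f x = app g x) -> f = g.
Proof. rewrite !in_funs; apply maps_ext. Qed.
End Functions.
Opaque the compr empty upair sing pair bigU power cup cap diff succ times image fn app funs dom ran.

(** * Ordinals and dependent choice *)

Ltac dfn := unfold dfun; def.

Definition omega {M : model} : M := the is_omega.

Lemma t_omega : dterm (fun M _ => omega).
Proof. unfold omega. apply (t_the (fun M _ => @is_omega M)). dsolve. Qed.
#[local] Hint Resolve t_omega : defn.

Section Ordinals.
Context {M : model}.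
Implicit Types a b c f m n w x y z : M.

Lemma foundation_min x : (exists y, y ∈ x) -> exists y, y ∈ x /\ forall z, z ∈ y -> ~ z ∈ x.
Proof. apply (proj1 (proj2 (model_ZF M))). Qed.

Lemma mem_asym x y : x ∈ y -> ~ y ∈ x.
Proof.
  intros H K. destruct (foundation_min (upair x y)) as [z [Hz Hm]].
  - exists x; apply in_upair; auto.
  - apply in_upair in Hz as [->| ->].
    + apply (Hm y); auto; apply in_upair; auto.
    + apply (Hm x); auto; apply in_upair; auto.
Qed.

Lemma mem_irrefl x : ~ x ∈ x.
Proof. intros H; exact (mem_asym x x H H). Qed.

Lemma mem_no_cycle3 x y z : x ∈ y -> y ∈ z -> ~ z ∈ x.
Proof.
  intros H K L.
  destruct (foundation_min (cup (upair x y) (sing z))) as [w [Hw Hm]].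
  - exists x; apply in_cup; left; apply in_upair; auto.
  - rewrite in_cup, in_upair, in_sing in Hw.
    destruct Hw as [[->| ->]| ->];
      [apply (Hm z)|apply (Hm x)|apply (Hm y)]; auto;
      rewrite in_cup, in_upair, in_sing; auto.
Qed.

Lemma ord_trans a x y : ordinal a -> x ∈ a -> y ∈ x -> y ∈ a.
Proof. intros [H _] Hx; exact (H x Hx y). Qed.

Lemma ord_in a x : ordinal a -> x ∈ a -> ordinal x.
Proof.
  intros [T C] Hx; split.
  - intros y Hy z Hz.
    assert (Ya := T x Hx y Hy). assert (Za := T y Ya z Hz).
    destruct (C z x Za Hx) as [|[->|K]]; auto.
    + destruct (mem_asym x y Hz Hy).
    + destruct (mem_no_cycle3 x z y K Hz Hy).
  - intros y z Hy Hz; apply C; eapply T; eauto.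
Qed.

Lemma ord_subset_mem a b : ordinal a -> ordinal b -> subset a b -> a <> b -> a ∈ b.
Proof.
  intros Ha Hb S N.
  destruct (foundation_min (diff b a)) as [m [Hm Hmin]].
  - apply nonempty_ex; intros E; apply N, ext_eq; intros z; split; [apply S|].
    intros Hz; apply NNPP; intros Nz. apply (in_empty z); rewrite <- E.
    apply in_diff; auto.
  - apply in_diff in Hm as [Hm Nm].
    assert (m = a); [|congruence].
    apply ext_eq; intros z; split; intros Hz.
    + apply NNPP; intros Nz; apply (Hmin z Hz), in_diff; split; auto.
      eapply ord_trans; eauto.
    + destruct (proj2 Hb z m (S z Hz) Hm) as [|[->|K]]; auto.
      * tauto.
      * destruct Nm; eapply ord_trans; eauto.
Qed.

Lemma ord_cap a b : ordinal a -> ordinal b -> ordinal (cap a b).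
Proof.
  intros Ha Hb; split.
  - intros x Hx y Hy; apply in_cap in Hx as [Hx Hx']; apply in_cap.
    split; eapply ord_trans; eauto.
  - intros x y Hx Hy; apply in_cap in Hx as [Hx _], Hy as [Hy _]; now apply Ha.
Qed.

Lemma ord_total a b : ordinal a -> ordinal b -> a ∈ b \/ a = b \/ b ∈ a.
Proof.
  intros Ha Hb. assert (Hc := ord_cap a b Ha Hb).
  assert (Sa : subset (cap a b) a) by (intros z; rewrite in_cap; tauto).
  assert (Sb : subset (cap a b) b) by (intros z; rewrite in_cap; tauto).
  destruct (classic (cap a b = a)) as [Ea|Na].
  - destruct (classic (cap a b = b)) as [Eb|Nb]; [right; left; congruence|].
    left; rewrite <- Ea at 1; apply ord_subset_mem; auto.
  - destruct (classic (cap a b = b)) as [Eb|Nb].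
    + right; right; rewrite <- Eb at 1; apply ord_subset_mem; auto.
    + destruct (mem_irrefl (cap a b)). apply in_cap; split; apply ord_subset_mem; auto.
Qed.

Lemma ord_subset_iff a b : ordinal a -> ordinal b -> (subset a b <-> ord_le a b).
Proof.
  intros Ha Hb; unfold ord_le; split.
  - intros S; destruct (classic (a = b)); auto; left; apply ord_subset_mem; auto.
  - intros [H| ->] z Hz; auto; eapply ord_trans; eauto.
Qed.

Lemma ord_not_mem a b : ordinal a -> ordinal b -> ~ a ∈ b -> subset b a.
Proof.
  intros Ha Hb N; apply ord_subset_iff; auto.
  destruct (ord_total a b Ha Hb) as [|[->|]]; unfold ord_le; tauto.
Qed.

Lemma ord_succ a : ordinal a -> ordinal (succ a).
Proof.
  intros Ha; split.
  - intros x Hx y Hy; apply in_succ in Hx as [Hx| ->]; apply in_succ; left; auto.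
    eapply ord_trans; eauto.
  - intros x y Hx Hy; apply in_succ in Hx as [Hx| ->], Hy as [Hy| ->]; auto.
    apply Ha; auto.
Qed.

Lemma ord_bigU x : (forall a, a ∈ x -> ordinal a) -> ordinal (bigU x).
Proof.
  intros H; split.
  - intros y Hy z Hz; apply in_bigU in Hy as (a & Ha & Hy); apply in_bigU.
    exists a; split; auto; apply (ord_trans a y z); auto.
  - intros y z Hy Hz; apply in_bigU in Hy as (a & Ha & Hy), Hz as (b & Hb & Hz).
    apply ord_total; [apply (ord_in a)|apply (ord_in b)]; auto.
Qed.

Lemma ord_empty : ordinal (empty : M).
Proof. split; intros x; intros; exfalso; eapply in_empty; eauto. Qed.

Lemma ord_least (P : M -> Prop) : def1 M P -> forall a, ordinal a -> P a ->
  exists b, ordinal b /\ P b /\ forall c, c ∈ b -> ~ P c.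
Proof.
  intros HP a Ha Pa.
  destruct (separation_ex P (succ a) HP) as [s Hs].
  destruct (foundation_min s) as [b [Hb Hm]].
  - exists a; apply Hs; rewrite in_succ; auto.
  - apply Hs in Hb as [Hb Pb]. assert (Ob := ord_in _ _ (ord_succ a Ha) Hb).
    exists b; repeat split; auto; try apply Ob. intros c Hc Pc. apply (Hm c Hc).
    apply Hs; split; auto. apply (ord_trans _ b); auto using ord_succ.
Qed.

Lemma def1_not (P : M -> Prop) : def1 M P -> def1 M (fun x => ~ P x).
Proof.
  intros (Q & e & HQ & H); exists (fun N e => ~ Q N e), e; split.
  - now apply d_not.
  - intros x; now rewrite H.
Qed.

Lemma ord_ind (P : M -> Prop) : def1 M P ->
  (forall a, ordinal a -> (forall b, b ∈ a -> P b) -> P a) ->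
  forall a, ordinal a -> P a.
Proof.
  intros HP H a Ha; apply NNPP; intros N.
  destruct (ord_least (fun x => ~ P x) (def1_not P HP) a Ha N) as (b & Ob & Nb & L).
  apply Nb, H; auto. intros c Hc; apply NNPP, L, Hc.
Qed.

Lemma inductive_iff x :
  inductive_set x <-> empty ∈ x /\ forall y, y ∈ x -> succ y ∈ x.
Proof.
  unfold inductive_set; split.
  - intros [[e [He Hx]] H]; split.
    + apply is_empty_iff in He as ->; auto.
    + intros y Hy; destruct (H y Hy) as [s [Hs Hs']].
      apply is_succ_iff in Hs as ->; auto.
  - intros [H K]; split.
    + exists empty; split; auto; now apply is_empty_iff.
    + intros y Hy; exists (succ y); split; auto; now apply is_succ_iff.
Qed.

Lemma is_omega_iff w : is_omega w <-> w = omega.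
Proof.
  assert (U : forall v w, is_omega v -> is_omega w -> v = w).
  { intros v w' [A B] [C D]; apply ext_eq; intros z; split; [apply B|apply D]; auto. }
  assert (E : is_omega (omega : M)).
  { apply (the_ex M (fun v => is_omega v)).
    destruct (model_ZF M) as (_ & _ & _ & _ & _ & [i Hi] & _ & _).
    assert (K : exists w, is_omega w).
    { exists (compr (fun n => forall v, inductive_set v -> n ∈ v)).
      assert (S : forall n, n ∈ compr (fun n => forall v, inductive_set v -> n ∈ v)
        <-> forall v, inductive_set v -> n ∈ v).
      { apply (in_compr _ i); [def|auto]. }
      split.
      - apply inductive_iff; split.
        + apply S; intros v Hv; now apply inductive_iff.
        + intros y Hy; apply S; intros v Hv.
          apply inductive_iff; auto. exact (proj1 (S y) Hy v Hv).
      - intros v Hv n Hn; exact (proj1 (S n) Hn v Hv). }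
    destruct K as [w0 Hw]; exists w0; split; auto. }
  split; [intros H; now apply U|intros ->; exact E].
Qed.

Lemma omega_inductive : inductive_set (omega : M).
Proof. now apply (proj2 (is_omega_iff omega)). Qed.

Lemma zero_omega : empty ∈ (omega : M).
Proof. apply inductive_iff, omega_inductive. Qed.

Lemma succ_omega n : n ∈ omega -> succ n ∈ omega.
Proof. apply inductive_iff, omega_inductive. Qed.

Lemma omega_ind (P : M -> Prop) : def1 M P -> P empty ->
  (forall n, n ∈ omega -> P n -> P (succ n)) -> forall n, n ∈ omega -> P n.
Proof.
  intros HP H0 HS.
  destruct (separation_ex P omega HP) as [s Hs].
  assert (K : subset omega s).
  { apply (proj2 (proj2 (is_omega_iff omega) eq_refl)).
    apply inductive_iff; split.
    - apply Hs; split; auto using zero_omega.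
    - intros y Hy; apply Hs in Hy as [A B]; apply Hs; auto using succ_omega. }
  intros n Hn; apply Hs, K, Hn.
Qed.

Lemma omega_mem_ord n : n ∈ omega -> ordinal n.
Proof.
  apply (omega_ind (fun n => ordinal n)); [def|apply ord_empty|].
  intros; now apply ord_succ.
Qed.

Lemma omega_ord : ordinal (omega : M).
Proof.
  split.
  - apply (omega_ind (fun n => subset n omega)); [def| |].
    + intros z Hz; destruct (in_empty z Hz).
    + intros n Hn H z Hz; apply in_succ in Hz as [Hz| ->]; auto.
  - intros x y Hx Hy; apply ord_total; now apply omega_mem_ord.
Qed.

Lemma mem_succ a : a ∈ succ a.
Proof. apply in_succ; auto. Qed.

Lemma succ_inj a b : succ a = succ b -> a = b.
Proof.
  intros E. assert (A : a ∈ succ b) by (rewrite <- E; apply mem_succ).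
  assert (B : b ∈ succ a) by (rewrite E; apply mem_succ).
  apply in_succ in A as [A| ->], B as [B|B]; auto. destruct (mem_asym a b A B).
Qed.

Lemma succ_neq_empty a : succ a <> empty.
Proof. intros E; apply (in_empty a); rewrite <- E; apply mem_succ. Qed.

Definition graph a b (R : M -> M -> Prop) : M :=
  compr (fun p => exists x y, x ∈ a /\ y ∈ b /\ p = pair x y /\ R x y).

Lemma def2_graph (R : M -> M -> Prop) a b : def2 M R ->
  def1 M (fun p => exists x y, x ∈ a /\ y ∈ b /\ p = pair x y /\ R x y).
Proof.
  intros (Q & e & HQ & H).
  exists (fun (N : model) (e : nat -> N) => exists x y : N, x ∈ e 1 /\ y ∈ e 2 /\
    e 0 = pair x y /\ Q N (scons x (scons y (fun i => e (S (S (S i))))))),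
    (scons a (scons b e)).
  split.
  - apply d_ex, d_ex, d_and; [dsolve|apply d_and; [dsolve|apply d_and; [dsolve|]]].
    refine (dprop_ext _ _ _ (dprop_ren (fun i => match i with O => 1 | 1 => 0 |
      S (S i) => S (S (S (S (S i)))) end) _ HQ)).
    intros N e'; simpl.
    replace (fun i => e' match i with O => 1 | 1 => 0 | S (S i) => S (S (S (S (S i)))) end)
      with (scons (e' 1) (scons (e' 0) (fun i => e' (S (S (S (S (S i)))))))); [tauto|].
    extensionality i; destruct i as [|[|i]]; reflexivity.
  - intros p; simpl; split; intros (x & y & A & B & C & D); exists x, y;
      repeat split; auto; now apply H.
Qed.

Lemma in_graph R a b x y : def2 M R ->
  (pair x y ∈ graph a b R <-> x ∈ a /\ y ∈ b /\ R x y).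
Proof.
  intros HR. unfold graph.
  rewrite (in_compr _ (times a b) (def2_graph R a b HR)).
  - split; [|intros (A & B & C); exists x, y; auto].
    intros (x' & y' & A & B & C & D); apply pair_inj in C as [-> ->]; auto.
  - intros p (x' & y' & A & B & -> & D); apply pair_in_times; auto.
Qed.

Lemma graph_subset R a b : def2 M R -> subset (graph a b R) (times a b).
Proof.
  intros HR p Hp. unfold graph in Hp.
  rewrite (in_compr _ (times a b) (def2_graph R a b HR)) in Hp.
  - destruct Hp as (x & y & A & B & -> & _); apply pair_in_times; auto.
  - intros q (x & y & A & B & -> & _); apply pair_in_times; auto.
Qed.

Lemma dependent_choice a (R : M -> M -> Prop) : def2 M R -> (exists x, x ∈ a) ->
  (forall x, x ∈ a -> exists y, y ∈ a /\ R x y) ->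
  exists f, f ∈ funs omega a /\
    forall n, n ∈ omega -> R (app f n) (app f (succ n)).
Proof.
  intros HR Ha H.
  destruct (model_DC M a (graph a a R) Ha) as (w & f & Hw & Hf & Hs).
  - intros x Hx; destruct (H x Hx) as [y [Hy Ry]]; exists y; split; auto.
    apply rel_iff, in_graph; auto.
  - apply is_omega_iff in Hw as ->. exists f; split; [now apply in_funs|].
    intros n Hn. assert (K : rel (graph a a R) (app f n) (app f (succ n))).
    { apply (Hs n (succ n)); auto; try now apply is_succ_iff.
      - apply (app_rel _ _ _ _ _ Hf); auto.
      - apply (app_rel _ _ _ _ _ Hf); auto using succ_omega. }
    apply rel_iff, in_graph in K; tauto.
Qed.

(** A definition by cases has to be a definable term, so the case distinction is put into a
    description with exclusive conditions. *)
Lemma the_case (P Q : Prop) x y : P -> ~ Q ->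
  the (fun v => (P /\ v = x) \/ (Q /\ v = y)) = x.
Proof. intros HP HQ; apply the_eq; [auto|]. intros z; tauto. Qed.

Lemma the_case' (P Q : Prop) x y : ~ P -> Q ->
  the (fun v => (P /\ v = x) \/ (Q /\ v = y)) = y.
Proof. intros HP HQ; apply the_eq; [auto|]. intros z; tauto. Qed.

(** DC is applied to finite partial choice functions. The relation asks only that the length grow by
    one, not that the functions extend each other: the value at [k] is read off a single member of
    the sequence, the one at [succ k], whose domain contains [k]. *)
Lemma countable_choice b (P : M -> M -> Prop) : def2 M P ->
  (forall n, n ∈ omega -> exists x, x ∈ b /\ P n x) ->
  exists c, c ∈ funs omega b /\ forall n, n ∈ omega -> P n (app c n).
Proof.
  intros HP H.
  (* Replacing [P] by the set [g] leaves only elements of the model as parameters, as [def]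
     requires. *)
  pose (g := graph omega b P).
  assert (Hg : forall n x, pair n x ∈ g <-> n ∈ omega /\ x ∈ b /\ P n x).
  { intros; now apply in_graph. }
  clearbody g.
  pose (A := compr (fun s => exists n, n ∈ omega /\ s ∈ funs n b /\
    forall k, k ∈ n -> pair k (app s k) ∈ g)).
  assert (HA : forall s, s ∈ A <-> exists n, n ∈ omega /\ s ∈ funs n b /\
    forall k, k ∈ n -> pair k (app s k) ∈ g).
  { apply (in_compr _ (power (times omega b))); [def|].
    intros s (n & Hn & Hs & _). apply in_power; intros p Hp. apply in_funs in Hs.
    destruct (proj1 Hs p Hp) as (x & y & X & Y & E).
    apply is_pair_iff in E; subst; apply pair_in_times; split; auto.
    apply (ord_trans _ n); auto using omega_ord. }
  destruct (dependent_choice A (fun s s' => exists n, n ∈ omega /\ s ∈ funs n b /\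
    s' ∈ funs (succ n) b)) as (f & Hf & Hs).
  - def.
  - exists empty; apply HA; exists empty; split; [apply zero_omega|split].
    + apply in_funs; split; [intros p Hp|intros x Hx]; exfalso; eapply in_empty; eauto.
    + intros k Hk; destruct (in_empty k Hk).
  - intros s Hs; apply HA in Hs as (n & Hn & Hs & Hk).
    destruct (H n Hn) as (x & Hx & Px).
    assert (E1 : forall k, k ∈ n -> the (fun v => (k ∈ n /\ v = app s k) \/ (k = n /\ v = x)) = app s k).
    { intros k K; apply the_case; auto. intros ->; exact (mem_irrefl n K). }
    assert (E2 : the (fun v => (n ∈ n /\ v = app s n) \/ (n = n /\ v = x)) = x).
    { apply the_case'; auto using mem_irrefl. }
    assert (D : dfun M (fun k => the (fun v => (k ∈ n /\ v = app s k) \/ (k = n /\ v = x)))) by dfn.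
    exists (fn (succ n) (fun k => the (fun v => (k ∈ n /\ v = app s k) \/ (k = n /\ v = x)))).
    assert (K : fn (succ n) (fun k => the (fun v => (k ∈ n /\ v = app s k) \/ (k = n /\ v = x)))
      ∈ funs (succ n) b).
    { apply funs_fn; auto. intros k Kk; apply in_succ in Kk as [Kk| ->].
      - rewrite E1; auto. eapply app_funs; eauto.
      - rewrite E2; auto. }
    split; [|exists n; auto].
    apply HA; exists (succ n); split; [now apply succ_omega|split; auto].
    intros k Kk; rewrite app_fn; auto. apply in_succ in Kk as [Kk| ->].
    + rewrite E1; auto.
    + rewrite E2; apply Hg; auto.
  - exists (fn omega (fun k => app (app f (succ k)) k)).
    assert (D : dfun M (fun k => app (app f (succ k)) k)) by dfn.
    assert (dom_eq : forall s n n', s ∈ funs n b -> s ∈ funs n' b -> n = n').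
    { intros s n n' S S'; apply in_funs in S, S'; apply ext_eq; intros k; split; intros K.
      - apply (maps_eq _ _ _ _ (app s k) S'); now apply (maps_app _ _ _ _ S).
      - apply (maps_eq _ _ _ _ (app s k) S); now apply (maps_app _ _ _ _ S'). }
    assert (L : forall k, k ∈ omega -> exists n, n ∈ omega /\ subset k n /\ app f k ∈ funs n b).
    { apply (omega_ind (fun k => exists n, n ∈ omega /\ subset k n /\ app f k ∈ funs n b)); [def| |].
      - assert (K := app_funs _ _ _ _ Hf zero_omega). apply HA in K as (n & Hn & K & _).
        exists n; split; [auto|split; auto]. intros z Hz; destruct (in_empty z Hz).
      - intros k Hk (n & Hn & S & K).
        destruct (Hs k Hk) as (n' & Hn' & K1 & K2).
        assert (n' = n) by eauto. subst n'.
        exists (succ n); split; [now apply succ_omega|split; auto].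
        assert (Kn : k ∈ succ n).
        { apply ord_subset_iff in S; auto using omega_mem_ord. apply in_succ. destruct S; auto. }
        intros z Hz; apply in_succ in Hz as [Hz| ->]; auto.
        apply in_succ; auto. }
    assert (K : forall k, k ∈ omega -> pair k (app (app f (succ k)) k) ∈ g).
    { intros k Hk. assert (Hk' := succ_omega k Hk).
      destruct (L _ Hk') as (n & Hn & S & K).
      assert (K' := app_funs _ _ _ _ Hf Hk'). apply HA in K' as (n' & Hn' & K' & G).
      assert (n' = n) by eauto; subst n'. apply G, S, mem_succ. }
    split.
    + apply funs_fn; auto. intros k Hk. apply (Hg k), K, Hk.
    + intros n Hn; rewrite app_fn; auto. apply Hg, K, Hn.
Qed.
End Ordinals.

Lemma t_graph a b (R : forall M : model, (nat -> M) -> M -> M -> Prop) :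
  dterm a -> dterm b ->
  dprop (fun M e => R M (fun n => e (S (S n))) (e 1) (e 0)) ->
  dterm (fun M e => graph (a M e) (b M e) (R M e)).
Proof.
  intros Ha Hb HR. dlift. unfold graph. apply t_compr, d_ex, d_ex.
  repeat (apply d_and; [dsolve|]).
  exact (dprop_ren (fun n => match n with O => 0 | 1 => 1 | S (S n) => S (S (S n)) end) _ HR).
Qed.
#[local] Hint Resolve t_graph : defn.
Opaque omega graph.

(** * Recursion on well-founded relations *)

Lemma class_eq {M : model} (A : class M) (a : M) :
  (forall x, x ∈ a <-> A x) -> A = ext a.
Proof.
  intros H; extensionality x; apply propositional_extensionality.
  unfold ext; now rewrite H.
Qed.

Definition pred {M : model} (a r x : M) : M := compr (fun y => y ∈ a /\ pair y x ∈ r).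

Definition wf {M : model} (a r : M) : Prop :=
  forall t, subset t a -> t <> empty -> exists m, m ∈ t /\ forall y, y ∈ t -> ~ pair y m ∈ r.

Lemma t_pred a r x : dterm a -> dterm r -> dterm x ->
  dterm (fun M e => pred (a M e) (r M e) (x M e)).
Proof. dunfold @pred. Qed.
#[local] Hint Resolve t_pred : defn.

(** [G] is given in all models at once and takes its parameters packed into one element, so that the
    recursion is again a term definable by one formula. It sees the set of earlier values, not the
    function listing them. *)
Definition rec (G : forall N : model, N -> N -> N) {M : model} (p a r : M) : M :=
  the (fun F => maps F (ext a) (fun _ => True) /\
    forall x, x ∈ a -> app F x = G M p (image (app F) (pred a r x))).

Section Recursion.
Context {M : model}.
Implicit Types a b c f m n r w x y z : M.

Lemma in_pred a r x y : y ∈ pred a r x <-> y ∈ a /\ pair y x ∈ r.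
Proof.
  apply (in_compr (fun y => y ∈ a /\ pair y x ∈ r) a); [def|tauto].
Qed.

Lemma wf_ind (P : M -> Prop) a r : def1 M P -> wf a r ->
  (forall x, x ∈ a -> (forall y, y ∈ a -> pair y x ∈ r -> P y) -> P x) ->
  forall x, x ∈ a -> P x.
Proof.
  intros HP W H x Hx; apply NNPP; intros N.
  destruct (separation_ex (fun x => ~ P x) a (def1_not P HP)) as [t Ht].
  destruct (W t) as [m [Hm L]].
  - intros y Hy; apply Ht in Hy; tauto.
  - intros E. apply (in_empty x). rewrite <- E. apply Ht; auto.
  - apply Ht in Hm as [Hm Nm]. apply Nm, H; auto.
    intros y Hy Hr; apply NNPP; intros Ny; apply (L y); auto. apply Ht; auto.
Qed.

Context (G : forall N : model, N -> N -> N).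
Context (HG : forall p s, dterm p -> dterm s -> dterm (fun N e => G N (p N e) (s N e))).
Hint Resolve HG : defn.

Let good p a r b h := subset b a /\ (forall x, x ∈ b -> subset (pred a r x) b) /\
  maps h (ext b) (fun _ => True) /\
  forall x, x ∈ b -> app h x = G M p (image (app h) (pred a r x)).

(** [good] describes partial solutions on sets closed under predecessors. Any two agree where both
    are defined; [val] amalgamates them, and a minimal point outside their union [D] could be added
    to it. *)
Lemma rec_spec p a r : wf a r -> maps (rec G p a r) (ext a) (fun _ => True) /\
  forall x, x ∈ a ->
    app (rec G p a r) x = G M p (image (app (rec G p a r)) (pred a r x)).
Proof.
  intros W.
  assert (U : forall b h b' h', good p a r b h -> good p a r b' h' -> forall x, x ∈ a ->
    (x ∈ b -> x ∈ b' -> app h x = app h' x)).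
  { intros b h b' h' (S & P & _ & E) (S' & P' & _ & E').
    apply (wf_ind (fun x => x ∈ b -> x ∈ b' -> app h x = app h' x) a r); [def|auto|].
    intros x Hx IH B B'. rewrite E, E'; auto. f_equal; apply image_ext.
    intros y Hy. apply IH; [|apply in_pred in Hy; tauto|now apply (P x)|now apply (P' x)].
    apply in_pred in Hy; tauto. }
  apply (the_ex M (fun F => maps F (ext a) (fun _ => True) /\
    forall x, x ∈ a -> app F x = G M p (image (app F) (pred a r x)))).
  assert (A : forall F, maps F (ext a) (fun _ => True) /\
    (forall x, x ∈ a -> app F x = G M p (image (app F) (pred a r x))) -> good p a r a F).
  { intros F [A B]; split; [intros z; auto|split; auto].
    intros x _ y Hy; apply in_pred in Hy; tauto. }
  pose (val := fun x => the (fun v => exists b h, good p a r b h /\ x ∈ b /\ v = app h x)).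
  assert (Hval : forall b h x, good p a r b h -> x ∈ b -> val x = app h x).
  { intros b h x Hb Hx; apply the_eq; [eauto|].
    intros z (b' & h' & Hb' & Hx' & ->). apply (U b' h' b h); auto. now apply Hb. }
  assert (Dv : dfun M val) by (unfold val, good; dfn).
  pose (D := compr (fun x => x ∈ a /\ exists b h, good p a r b h /\ x ∈ b)).
  assert (HD : forall x, x ∈ D <-> x ∈ a /\ exists b h, good p a r b h /\ x ∈ b).
  { apply (in_compr _ a); [unfold good; def|tauto]. }
  assert (PD : forall x, x ∈ D -> subset (pred a r x) D).
  { intros x Hx y Hy; apply HD in Hx as (_ & b & h & Hb & Hx).
    apply HD; split; [apply in_pred in Hy; tauto|].
    exists b, h; split; auto. now apply (proj1 (proj2 Hb) x). }
  assert (VD : forall x, x ∈ D -> val x = G M p (image val (pred a r x))).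
  { intros x Hx; apply HD in Hx as (_ & b & h & Hb & Hx).
    rewrite (Hval b h); auto. rewrite (proj2 (proj2 (proj2 Hb)) x); auto. f_equal.
    apply image_ext; intros y Hy; symmetry; apply Hval with b; auto.
    now apply (proj1 (proj2 Hb) x). }
  assert (E : D = a).
  { apply NNPP; intros N.
    destruct (W (diff a D)) as [m [Hm L]].
    - intros x Hx; apply in_diff in Hx; tauto.
    - intros E; apply N, ext_eq; intros z; split; [intros Hz; apply HD in Hz; tauto|].
      intros Hz; apply NNPP; intros Nz; apply (in_empty z); rewrite <- E; apply in_diff; auto.
    - apply in_diff in Hm as [Hm Nm]. apply Nm, HD; split; auto.
      assert (Pm : subset (pred a r m) D).
      { intros y Hy; apply in_pred in Hy as [Hy Hr]; apply NNPP; intros Ny.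
        apply (L y); auto; apply in_diff; auto. }
      pose (h := fun x => the (fun v => (x ∈ D /\ v = val x) \/
        (x = m /\ v = G M p (image val (pred a r m))))).
      assert (H1 : forall x, x ∈ D -> h x = val x).
      { intros x Hx; apply the_case; auto. intros ->; auto. }
      assert (H2 : h m = G M p (image val (pred a r m))).
      { apply the_case'; auto. }
      assert (Dh : dfun M h) by (unfold h, val, good; dfn).
      exists (cup D (sing m)), (fn (cup D (sing m)) h); split; [|apply in_cup; rewrite in_sing; auto].
      assert (I : forall x, x ∈ D -> x ∈ cup D (sing m)) by (intros; apply in_cup; auto).
      assert (I2 : m ∈ cup D (sing m)) by (apply in_cup; rewrite in_sing; auto).
      split; [|split; [|split]].
      + intros x Hx; rewrite in_cup, in_sing in Hx; destruct Hx as [Hx| ->]; auto.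
        apply HD in Hx; tauto.
      + intros x Hx y Hy; rewrite in_cup, in_sing in Hx; apply I; destruct Hx as [Hx| ->].
        * now apply (PD x).
        * now apply Pm.
      + apply fn_maps; auto.
      + intros x Hx. rewrite app_fn by auto.
        rewrite in_cup, in_sing in Hx; destruct Hx as [Hx| ->].
        * rewrite H1, VD; auto. f_equal; apply image_ext; intros y Hy.
          assert (y ∈ D) by now apply (PD x). rewrite app_fn, H1; auto.
        * rewrite H2; auto. f_equal; apply image_ext; intros y Hy.
          assert (y ∈ D) by now apply Pm. rewrite app_fn, H1; auto. }
  exists (fn a val); split.
  - split; [apply fn_maps; auto|].
    intros x Hx. rewrite app_fn, VD by (congruence || auto).
    f_equal; apply image_ext; intros y Hy; rewrite app_fn; auto.
    apply in_pred in Hy; tauto.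
  - intros F HF. destruct (A F HF) as (_ & _ & HF' & _).
    apply (maps_ext _ _ a (fun _ => True) (fun _ => True)); auto.
    + apply fn_maps; auto.
    + intros x Hx; rewrite app_fn; auto. apply Hval with a; auto.
Qed.
End Recursion.

Lemma t_rec (G : forall N : model, N -> N -> N) :
  (forall p s, dterm p -> dterm s -> dterm (fun N e => G N (p N e) (s N e))) ->
  forall p a r, dterm p -> dterm a -> dterm r ->
  dterm (fun M e => rec G (p M e) (a M e) (r M e)).
Proof. intros HG p a r Hp Ha Hr; dlift; unfold rec; dsolve. Qed.

Definition sup_succ (N : model) (_ s : N) : N := bigU (image succ s).

(** Order types, Goedel's pairing function and the Galvin-Hajnal rank are all built from this rank,
    so it is defined for well-founded relations that need not be linear. *)
Definition rank {M : model} (a r x : M) : M := app (rec sup_succ empty a r) x.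

Lemma t_rank a r x : dterm a -> dterm r -> dterm x ->
  dterm (fun M e => rank (a M e) (r M e) (x M e)).
Proof.
  intros Ha Hr Hx; unfold rank; apply t_app; auto; apply t_rec; auto; [|dsolve].
  intros p s Hp Hs; dlift; unfold sup_succ; dsolve.
Qed.
#[local] Hint Resolve t_rank : defn.

(* [r] well-orders [a]; it may relate further elements as well. *)

Definition wo {M : model} (a r : M) : Prop :=
  wf a r /\
  (forall x y z, x ∈ a -> y ∈ a -> z ∈ a -> pair x y ∈ r -> pair y z ∈ r -> pair x z ∈ r) /\
  (forall x y, x ∈ a -> y ∈ a -> pair x y ∈ r \/ x = y \/ pair y x ∈ r).

Definition memrel {M : model} (u : M) : M := graph u u (fun x y => x ∈ y).

(** For a set [u] of ordinals and [x] in [u] this is the order type of the members of [u] below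
    [x]. *)
Definition pos {M : model} (u x : M) : M := rank u (memrel u) x.

Definition otype {M : model} (a r : M) : M := image (rank a r) a.

Lemma t_memrel u : dterm u -> dterm (fun M e => memrel (u M e)).
Proof.
  intros Hu; unfold memrel.
  apply (t_graph u u (fun M e x y => x ∈ y)); auto; dsolve.
Qed.
#[local] Hint Resolve t_memrel : defn.

Lemma t_pos u x : dterm u -> dterm x -> dterm (fun M e => pos (u M e) (x M e)).
Proof. dunfold @pos. Qed.
#[local] Hint Resolve t_pos : defn.

Section Rank.
Context {M : model}.
Implicit Types a b c f m n r u v w x y z : M.

Lemma in_rank a r x z : wf a r -> x ∈ a ->
  (z ∈ rank a r x <-> exists y, y ∈ a /\ pair y x ∈ r /\ z ∈ succ (rank a r y)).
Proof.
  intros W Hx. unfold rank at 1.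
  rewrite (proj2 (rec_spec sup_succ ltac:(intros; dlift; unfold sup_succ; dsolve) empty a r W) x Hx).
  unfold sup_succ at 1. rewrite in_bigU. 
  assert (E : forall s, s ∈ image succ (image (app (rec sup_succ empty a r)) (pred a r x))
    <-> exists y, y ∈ a /\ pair y x ∈ r /\ s = succ (rank a r y)).
  { intros s. rewrite in_image by dfn.
    assert (D : dfun M (fun y => app (rec sup_succ empty a r) y)).
    { change (dfun M (fun y => rank a r y)); dfn. }
    split.
    - intros (v & Hv & ->). apply in_image in Hv as (y & Hy & ->); auto.
      apply in_pred in Hy as [A B]; eauto.
    - intros (y & A & B & ->); exists (rank a r y); split; auto. apply in_image; auto.
      exists y; rewrite in_pred; auto. }
  split.
  - intros (s & Hs & Hz); apply E in Hs as (y & A & B & ->); eauto.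
  - intros (y & A & B & C); exists (succ (rank a r y)); split; auto. apply E; eauto.
Qed.

Lemma rank_ord a r x : wf a r -> x ∈ a -> ordinal (rank a r x).
Proof.
  intros W. apply (wf_ind (fun x => ordinal (rank a r x)) a r); [def|auto|].
  intros y Hy IH.
  pose (R := compr (fun s => exists z, z ∈ a /\ pair z y ∈ r /\ s = succ (rank a r z))).
  assert (K : forall s, s ∈ R <-> exists z, z ∈ a /\ pair z y ∈ r /\ s = succ (rank a r z)).
  { apply (in_compr _ (image (fun z => succ (rank a r z)) a)); [def|].
    intros s (v & B & C & ->); apply in_image; [dfn|eauto]. }
  assert (A : rank a r y = bigU R).
  { apply ext_eq; intros z. rewrite in_rank, in_bigU; auto. split.
    - intros (v & B & C & D); exists (succ (rank a r v)); split; auto. apply K; eauto.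
    - intros (s & B & C); apply K in B as (v & B & D & ->); eauto. }
  rewrite A; apply ord_bigU. intros s Hs.
  apply K in Hs as (z & B & C & ->); apply ord_succ; auto.
Qed.

Lemma rank_lt a r x y : wf a r -> x ∈ a -> y ∈ a -> pair x y ∈ r ->
  rank a r x ∈ rank a r y.
Proof. intros; apply in_rank; auto. exists x; auto using mem_succ. Qed.

(** Transitivity turns everything reached through a chain of predecessors into a predecessor of [x]
    itself, so the ranks below that of [x] leave no gaps. *)
Lemma rank_surj a r x z : wf a r ->
  (forall x y z, x ∈ a -> y ∈ a -> z ∈ a -> pair x y ∈ r -> pair y z ∈ r -> pair x z ∈ r) ->
  x ∈ a -> z ∈ rank a r x -> exists y, y ∈ a /\ pair y x ∈ r /\ rank a r y = z.
Proof.
  intros W T Hx. revert x Hx.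
  apply (wf_ind (fun x => z ∈ rank a r x -> exists y, y ∈ a /\ pair y x ∈ r /\ rank a r y = z) a r);
    [def|auto|].
  intros x Hx IH Hz; apply in_rank in Hz as (y & Hy & Hr & Hz); auto.
  apply in_succ in Hz as [Hz| ->]; [|eauto].
  destruct (IH y Hy Hr Hz) as (w & A & B & C); exists w; split; [auto|split; auto]. now apply (T w y x).
Qed.

Lemma rank_inj a r x y : wo a r -> x ∈ a -> y ∈ a -> rank a r x = rank a r y -> x = y.
Proof.
  intros (W & T & C) Hx Hy E. destruct (C x y Hx Hy) as [H|[H|H]]; auto;
    apply (rank_lt a r) in H; auto; rewrite E in H; destruct (mem_irrefl _ H).
Qed.

Lemma in_otype a r z : z ∈ otype a r <-> exists x, x ∈ a /\ z = rank a r x.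
Proof. apply in_image. dfn. Qed.

Lemma otype_ord a r : wo a r -> ordinal (otype a r).
Proof.
  intros (W & T & C); split.
  - intros z Hz y Hy; apply in_otype in Hz as (x & Hx & ->).
    destruct (rank_surj a r x y W T Hx Hy) as (v & A & B & <-).
    apply in_otype; eauto.
  - intros y z Hy Hz; apply in_otype in Hy as (x & Hx & ->), Hz as (v & Hv & ->).
    apply ord_total; now apply rank_ord.
Qed.

Definition ords u : Prop := forall x, x ∈ u -> ordinal x.

Lemma in_memrel u x y : pair x y ∈ memrel u <-> x ∈ u /\ y ∈ u /\ x ∈ y.
Proof. apply in_graph; def. Qed.

Lemma ords_sub u a : ordinal a -> subset u a -> ords u.
Proof. intros Ha H x Hx; apply (ord_in a); auto. Qed.

Lemma memrel_wo u : ords u -> wo u (memrel u).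
Proof.
  intros Hu; split; [|split].
  - intros t Ht Nt. destruct (nonempty_ex t Nt) as [x Hx].
    destruct (ord_least (fun x => x ∈ t) ltac:(def) x) as (b & Ob & Hb & L); auto.
    exists b; split; auto. intros y Hy K; apply in_memrel in K as (_ & _ & K).
    exact (L y K Hy).
  - intros x y z Hx Hy Hz K L; apply in_memrel in K as (_ & _ & K), L as (_ & _ & L).
    apply in_memrel; split; [auto|split; auto]. apply (ord_trans z y x); auto.
  - intros x y Hx Hy; rewrite !in_memrel.
    destruct (ord_total x y (Hu x Hx) (Hu y Hy)) as [|[|]]; auto.
Qed.

(** Positions in different sets become comparable inside a common superset; the hulls belonging to
    one function are later treated in this way. *)
Lemma pos_mono u v x : ords v -> subset u v -> x ∈ u -> subset (pos u x) (pos v x).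
Proof.
  intros Hv S. assert (Hu : ords u) by (intros z Hz; auto).
  assert (Wu := memrel_wo u Hu). assert (Wv := memrel_wo v Hv).
  apply (wf_ind (fun x => subset (pos u x) (pos v x)) u (memrel u)); [def|apply Wu|].
  intros y Hy IH z Hz; apply in_rank in Hz as (w & A & B & C); auto; [|apply Wu].
  apply in_rank; auto; [apply Wv|]. exists w; split; [auto|split].
  - apply in_memrel in B as (_ & _ & B); apply in_memrel; auto.
  - assert (K := IH w A B). apply ord_subset_iff in K; try (apply rank_ord; auto; try apply Wu; try apply Wv; fail).
    apply in_succ in C as [C| ->].
    + apply in_succ; left. destruct K as [K|K].
      * apply (ord_trans _ (pos u w)); auto. apply rank_ord; auto; apply Wv.
      * unfold pos in K; rewrite K in C; auto.
    + apply in_succ. destruct K; auto.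
Qed.

Lemma pos_le u x : ords u -> x ∈ u -> subset (pos u x) x.
Proof.
  intros Hu. assert (Wu := memrel_wo u Hu).
  apply (wf_ind (fun x => subset (pos u x) x) u (memrel u)); [def|apply Wu|].
  intros y Hy IH z Hz; apply in_rank in Hz as (w & A & B & C); auto; [|apply Wu].
  assert (K := IH w A B). apply in_memrel in B as (_ & _ & B).
  apply in_succ in C as [C| ->].
  - apply (ord_trans y w); auto.
  - apply ord_subset_iff in K; auto; [|apply rank_ord; auto; apply Wu].
    destruct K as [K|K]; [apply (ord_trans y w); auto|unfold pos in K; now rewrite K].
Qed.

Lemma pos_inj u x y : ords u -> x ∈ u -> y ∈ u -> pos u x = pos u y -> x = y.
Proof. intros Hu; apply rank_inj, memrel_wo, Hu. Qed.

Lemma pos_in_otype u x : x ∈ u -> pos u x ∈ otype u (memrel u).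
Proof. intros; apply in_otype; eauto. Qed.

Lemma pos_ord u x : ords u -> x ∈ u -> ordinal (pos u x).
Proof. intros Hu Hx; apply rank_ord; auto. now apply memrel_wo. Qed.

Lemma in_otype_pos u z : z ∈ otype u (memrel u) <-> exists x, x ∈ u /\ z = pos u x.
Proof. apply in_otype. Qed.

Lemma otype_le u a : ordinal a -> subset u a -> ord_le (otype u (memrel u)) a.
Proof.
  intros Ha S. assert (Hu := ords_sub u a Ha S).
  apply ord_subset_iff; auto; [now apply otype_ord, memrel_wo|].
  intros z Hz; apply in_otype in Hz as (x & Hx & ->).
  assert (K := pos_le u x Hu Hx). apply ord_subset_iff in K; auto.
  - destruct K as [K|K]; [apply (ord_trans a x); auto|unfold pos in K; rewrite K; auto].
  - apply rank_ord; auto. now apply memrel_wo.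
Qed.
End Rank.
Opaque rec rank memrel pos otype pred.

(** * Cardinals *)

Definition surj {M : model} (a b : M) : Prop :=
  exists f, f ∈ funs a b /\ forall y, y ∈ b -> exists x, x ∈ a /\ app f x = y.

Definition le_card {M : model} (a b : M) : Prop :=
  exists f, f ∈ funs a b /\
    forall x y, x ∈ a -> y ∈ a -> app f x = app f y -> x = y.

Lemma d_surj a b : dterm a -> dterm b -> dprop (fun M e => surj (a M e) (b M e)).
Proof. dunfold @surj. Qed.

Lemma d_le_card a b : dterm a -> dterm b -> dprop (fun M e => le_card (a M e) (b M e)).
Proof. dunfold @le_card. Qed.
#[local] Hint Resolve d_surj d_le_card : defn.

(* The least nonzero ordinal onto which [a] cannot be mapped. *)

Definition hartogs {M : model} (a : M) : M :=
  compr (fun b => ordinal b /\ (b = empty \/ surj a b)).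

Lemma t_hartogs a : dterm a -> dterm (fun M e => hartogs (a M e)).
Proof. dunfold @hartogs. Qed.
#[local] Hint Resolve t_hartogs : defn.

Section Cardinals.
Context {M : model}.
Implicit Types a b c f k m n r u v w x y z : M.

Lemma injective_iff f a b : f ∈ funs a b ->
  (injective f <-> forall x y, x ∈ a -> y ∈ a -> app f x = app f y -> x = y).
Proof.
  intros Hf; apply in_funs in Hf; split.
  - intros I x y Hx Hy E; apply (I x y (app f x)); apply (app_rel _ _ _ _ _ Hf); auto.
  - intros I x y z H K; apply (app_rel _ _ _ _ _ Hf) in H as [H ->], K as [K E]; auto.
Qed.

Lemma card_le_iff a b : card_le (ext a) (ext b) <-> le_card a b.
Proof.
  unfold card_le, le_card; split; intros (f & Hf & I); exists f.
  - apply in_funs in Hf; split; auto. now apply (injective_iff f a b).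
  - split; [now apply in_funs|]. now apply (injective_iff f a b).
Qed.

Lemma le_card_fn (F : M -> M) a b : dfun M F -> (forall x, x ∈ a -> F x ∈ b) ->
  (forall x y, x ∈ a -> y ∈ a -> F x = F y -> x = y) -> le_card a b.
Proof.
  intros HF H I; exists (fn a F); split; [now apply funs_fn|].
  intros x y Hx Hy; rewrite !app_fn; auto.
Qed.

Lemma le_card_refl a : le_card a a.
Proof. apply (le_card_fn (fun x => x)); auto. dfn. Qed.

Lemma le_card_subset a b : subset a b -> le_card a b.
Proof. intros; apply (le_card_fn (fun x => x)); auto. dfn. Qed.

Lemma le_card_trans a b c : le_card a b -> le_card b c -> le_card a c.
Proof.
  intros (f & Hf & I) (g & Hg & J).
  apply (le_card_fn (fun x => app g (app f x))); [dfn| |].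
  - intros x Hx; apply (app_funs b c); auto; apply (app_funs a b); auto.
  - intros x y Hx Hy E. apply J in E; try apply (app_funs a b); auto.
Qed.

Lemma le_card_times a b c d : le_card a c -> le_card b d -> le_card (times a b) (times c d).
Proof.
  intros (f & Hf & I) (g & Hg & J).
  apply (le_card_fn (fun p => the (fun q => exists x y, p = pair x y /\ q = pair (app f x) (app g y)))).
  - dfn.
  - intros p Hp; apply in_times in Hp as (x & y & Hx & Hy & ->).
    rewrite (the_eq _ _ (pair (app f x) (app g y))); [|eauto|].
    + apply pair_in_times; split; eapply app_funs; eauto.
    + intros z (x' & y' & E & ->); apply pair_inj in E as [-> ->]; auto.
  - intros p p' Hp Hp'; apply in_times in Hp as (x & y & Hx & Hy & ->),
      Hp' as (x' & y' & Hx' & Hy' & ->).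
    rewrite (the_eq _ _ (pair (app f x) (app g y))); [|eauto|];
      [rewrite (the_eq _ _ (pair (app f x') (app g y'))); [|eauto|]|].
    + intros E; apply pair_inj in E as [E1 E2]; f_equal; auto.
    + intros z (x1 & y1 & E & ->); apply pair_inj in E as [-> ->]; auto.
    + intros z (x1 & y1 & E & ->); apply pair_inj in E as [-> ->]; auto.
Qed.

Lemma surj_of_le_card a b z : z ∈ a -> le_card a b -> surj b a.
Proof.
  intros Hz (f & Hf & I).
  pose (F := fun y => the (fun x => (exists v, v ∈ a /\ app f v = y) /\ x ∈ a /\ app f x = y \/
    ~ (exists v, v ∈ a /\ app f v = y) /\ x = z)).
  assert (E : forall x, x ∈ a -> F (app f x) = x).
  { intros x Hx; apply the_eq; [left; eauto|]. intros x' [(_ & A & B)|[A _]]; [auto|].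
    destruct A; eauto. }
  assert (HF : dfun M F) by (unfold F; dfn).
  exists (fn b F); split.
  - apply funs_fn; auto. intros y Hy.
    destruct (classic (exists v, v ∈ a /\ app f v = y)) as [[v [Hv <-]]|N].
    + rewrite E; auto.
    + assert (F y = z) as ->; auto. apply the_eq; [auto|]. tauto.
  - intros x Hx; exists (app f x); split; [eapply app_funs; eauto|].
    rewrite app_fn, E; auto. eapply app_funs; eauto.
Qed.

(** The point is that these ordinals form a set: a map [f] of [a] onto [b] is the rank function of
    the relation [app f x ∈ app f y] on [a], so [b] is recovered from a subset of [times a a]. *)
Lemma in_hartogs a b : b ∈ hartogs a <-> ordinal b /\ (b = empty \/ surj a b).
Proof.
  set (R := fun f => graph a a (fun x y => app f x ∈ app f y)).
  apply (in_compr (fun b => ordinal b /\ (b = empty \/ surj a b)) (cup (sing empty)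
    (image (fun f => image (rank a f) a) (power (times a a))))); [def|].
  intros b' [Hb [->|(f & Hf & S)]]; apply in_cup; [left; now apply in_sing|right].
  apply in_image; [dfn|].
  assert (HR : forall x y, pair x y ∈ R f <-> x ∈ a /\ y ∈ a /\ app f x ∈ app f y).
  { intros; apply (in_graph (fun x y => app f x ∈ app f y) a a); def. }
  exists (R f); split.
  - apply in_power, graph_subset. def.
  - assert (W : wf a (R f)).
    { intros t Ht Nt. destruct (nonempty_ex t Nt) as [x Hx].
      destruct (ord_least (fun v => exists x, x ∈ t /\ v = app f x) ltac:(def) (app f x))
        as (v & Ov & (y & Hy & ->) & L); eauto.
      - apply (ord_in b'); auto; eapply app_funs; eauto.
      - exists y; split; auto. intros w Hw K; apply HR in K as (_ & _ & K).
        apply (L _ K); eauto. }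
    assert (E : forall x, x ∈ a -> rank a (R f) x = app f x).
    { apply (wf_ind (fun x => rank a (R f) x = app f x) a (R f)); auto.
      - unfold R. def.
      - intros x Hx IH; apply ext_eq; intros z. rewrite in_rank; auto. split.
        + intros (y & A & B & C). rewrite IH in C; auto. apply HR in B as (_ & _ & B).
          apply in_succ in C as [C| ->]; auto.
          apply (ord_trans _ (app f y)); auto. apply (ord_in b'); auto; eapply app_funs; eauto.
        + intros Hz. destruct (S z) as (y & Hy & E).
          { apply (ord_trans _ (app f x)); auto; eapply app_funs; eauto. }
          exists y; split; [auto|split]; [apply HR; subst; auto|].
          rewrite IH; auto; [subst; apply mem_succ|]. apply HR; subst; auto. }
    apply ext_eq; intros z; rewrite in_image by (unfold R; dfn). split.
    + intros Hz; destruct (S z Hz) as (x & Hx & <-); exists x; rewrite E; auto.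
    + intros (x & Hx & ->); rewrite E; auto; eapply app_funs; eauto.
Qed.

Lemma surj_le a b c : ordinal b -> surj a b -> c ∈ b -> c = empty \/ surj a c.
Proof.
  intros Hb (f & Hf & S) Hc.
  destruct (classic (c = empty)) as [E|E]; auto. right.
  destruct (nonempty_ex c E) as [z Hz].
  pose (F := fun x => the (fun y => (app f x ∈ c /\ y = app f x) \/ (~ app f x ∈ c /\ y = z))).
  assert (HF : dfun M F) by (unfold F; dfn).
  exists (fn a F); split.
  - apply funs_fn; auto. intros x Hx. unfold F.
    destruct (classic (app f x ∈ c)); [rewrite the_case|rewrite the_case']; auto.
  - intros y Hy; destruct (S y) as (x & Hx & Ex); [apply (ord_trans b c); auto|].
    exists x; split; auto. rewrite app_fn; auto. unfold F; subst y.
    rewrite the_case; auto.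
Qed.

Lemma hartogs_ord a : ordinal (hartogs a).
Proof.
  split.
  - intros x Hx y Hy; apply in_hartogs in Hx as [Ox Hx]; apply in_hartogs.
    split; [now apply (ord_in x)|].
    destruct Hx as [->|Hx]; [destruct (in_empty y Hy)|now apply (surj_le a x)].
  - intros x y Hx Hy; apply in_hartogs in Hx as [Hx _], Hy as [Hy _]; now apply ord_total.
Qed.

Lemma hartogs_not_surj a : ~ surj a (hartogs a).
Proof.
  intros S; apply (mem_irrefl (hartogs a)), in_hartogs; split; auto using hartogs_ord.
Qed.

Lemma empty_in_hartogs a : empty ∈ hartogs a.
Proof. apply in_hartogs; split; auto using ord_empty. Qed.

Lemma surj_iff a b :
  (exists f, maps f (ext a) (ext b) /\ onto f (ext b)) <-> surj a b.
Proof.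
  unfold surj, onto; split; intros (f & Hf & S); exists f; rewrite in_funs in *; split; auto.
  - intros y Hy; destruct (S y Hy) as [x Hx].
    apply (app_rel _ _ _ _ _ Hf) in Hx as [A ->]; eauto.
  - intros y Hy; destruct (S y Hy) as (x & Hx & E); exists x.
    apply (app_rel _ _ _ _ _ Hf); auto.
Qed.

Lemma is_hrtg_hartogs a : is_hrtg (ext a) (hartogs a).
Proof.
  split.
  - split; [apply hartogs_ord|split].
    + intros E; apply (E empty), empty_in_hartogs.
    + rewrite surj_iff; apply hartogs_not_surj.
  - intros b (Hb & Nb & S). rewrite surj_iff in S.
    destruct (ord_total (hartogs a) b (hartogs_ord a) Hb) as [H|[H|H]]; [left; auto|right; auto|].
    apply in_hartogs in H as [_ [->|H]]; [|tauto].
    destruct Nb; intros z; apply in_empty.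
Qed.

Lemma is_hrtg_iff a t : is_hrtg (ext a) t <-> t = hartogs a.
Proof.
  split; [|intros ->; apply is_hrtg_hartogs].
  intros [A B]. destruct (is_hrtg_hartogs a) as [C D].
  assert (K := B _ C). assert (L := D _ A).
  destruct K as [K|K], L as [L|L]; auto. destruct (mem_asym _ _ K L).
Qed.

(** The image of [u] in [a] is a set of ordinals and collapses to its order type. *)
Lemma le_card_otype u a : ordinal a -> le_card u a ->
  exists b, ord_le b a /\ card_eq (ext u) (ext b) /\ ordinal b.
Proof.
  intros Ha (f & Hf & I).
  pose (v := image (app f) u).
  assert (Hv : forall y, y ∈ v <-> exists x, x ∈ u /\ y = app f x) by (intros; apply in_image; dfn).
  assert (S : subset v a) by (intros y Hy; apply Hv in Hy as (x & Hx & ->); eapply app_funs; eauto).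
  assert (Ov := ords_sub v a Ha S). assert (Wv := memrel_wo v Ov).
  exists (otype v (memrel v)); split; [now apply otype_le|split; [|now apply otype_ord]].
  assert (D : dfun M (fun x => pos v (app f x))) by dfn.
  assert (K : fn u (fun x => pos v (app f x)) ∈ funs u (otype v (memrel v))).
  { apply funs_fn; auto. intros x Hx; apply pos_in_otype, Hv; eauto. }
  exists (fn u (fun x => pos v (app f x))); split; [now apply in_funs|split].
  - apply (injective_iff _ _ _ K). intros x y Hx Hy; rewrite !app_fn; auto.
    intros E; apply pos_inj in E; auto; apply Hv; eauto.
  - intros y Hy. apply in_otype in Hy as (z & Hz & ->). apply Hv in Hz as (x & Hx & ->).
    exists x. apply in_funs in K; apply (app_rel _ _ _ _ _ K); rewrite app_fn; auto.
Qed.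

Lemma card_eq_inv a b : card_eq (ext a) (ext b) -> card_eq (ext b) (ext a).
Proof.
  intros (f & Hf & I & S).
  assert (Hf' : f ∈ funs a b) by now apply in_funs.
  rewrite (injective_iff _ _ _ Hf') in I.
  pose (F := fun y => the (fun x => x ∈ a /\ app f x = y)).
  assert (E : forall x, x ∈ a -> F (app f x) = x).
  { intros x Hx; apply the_eq; auto. intros z [A B]; auto. }
  assert (S' : forall y, y ∈ b -> exists x, x ∈ a /\ y = app f x).
  { intros y Hy; destruct (S y Hy) as [x Hx]. apply (app_rel _ _ _ _ _ Hf) in Hx; eauto. }
  assert (HF : dfun M F) by (unfold F; dfn).
  assert (K : fn b F ∈ funs b a).
  { apply funs_fn; auto. intros y Hy; destruct (S' y Hy) as (x & Hx & ->); rewrite E; auto. }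
  exists (fn b F); split; [now apply in_funs|split].
  - apply (injective_iff _ _ _ K); intros x y Hx Hy; rewrite !app_fn; auto.
    destruct (S' x Hx) as (x1 & A & ->), (S' y Hy) as (y1 & B & ->). rewrite !E; auto.
    now intros ->.
  - intros x Hx; exists (app f x). apply in_funs in K.
    assert (app f x ∈ b) by (eapply app_funs; eauto).
    apply (app_rel _ _ _ _ _ K); rewrite app_fn, E; auto.
Qed.

Lemma card_eq_le a b : card_eq (ext a) (ext b) -> le_card a b.
Proof. intros (f & A & B & _); apply card_le_iff; exists f; auto. Qed.

Lemma aleph_iff k : aleph k <->
  ordinal k /\ ord_le omega k /\ forall a, a ∈ k -> ~ card_eq (ext a) (ext k).
Proof.
  unfold aleph; split; intros (A & B & C); split; auto; split; auto.
  - destruct B as (w & Hw & B); apply is_omega_iff in Hw as ->; auto.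
  - exists omega; split; auto. now apply is_omega_iff.
Qed.

Lemma aleph_not_le k a : aleph k -> a ∈ k -> ~ le_card k a.
Proof.
  intros Hk Ha L. apply aleph_iff in Hk as (Ok & _ & Hk).
  destruct (le_card_otype k a (ord_in k a Ok Ha) L) as (b & Hb & E & Ob).
  apply (Hk b); [|now apply card_eq_inv].
  destruct Hb as [Hb| ->]; auto. apply (ord_trans k a); auto.
Qed.

(** * Finite sets, as the sets into which omega does not embed *)

Lemma le_card_omega_unbounded x : subset x omega ->
  (forall n, n ∈ omega -> exists m, m ∈ x /\ n ∈ m) -> le_card omega x.
Proof.
  intros S H.
  destruct (dependent_choice x (fun n m => n ∈ m)) as (f & Hf & K); [def| | |].
  - destruct (H empty zero_omega) as (m & Hm & _); eauto.
  - intros n Hn; destruct (H n) as (m & Hm & L); eauto.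
  - assert (O : forall n, n ∈ omega -> ordinal (app f n)).
    { intros n Hn; apply omega_mem_ord, S; eapply app_funs; eauto. }
    assert (L : forall m, m ∈ omega -> forall n, n ∈ m -> app f n ∈ app f m).
    { apply (omega_ind (fun m => forall n, n ∈ m -> app f n ∈ app f m)); [def| |].
      - intros n Hn; destruct (in_empty n Hn).
      - intros m Hm IH n Hn; apply in_succ in Hn as [Hn| ->]; auto.
        apply (ord_trans _ (app f m)); auto using succ_omega. }
    exists f; split; auto. intros m n Hm Hn E.
    destruct (ord_total m n) as [N|[N|N]]; auto using omega_mem_ord.
    + apply L in N; auto. rewrite E in N; destruct (mem_irrefl _ N).
    + apply L in N; auto. rewrite E in N; destruct (mem_irrefl _ N).
Qed.

(** An injection of omega into the union takes an unbounded set of integers into [a], or else all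
    integers beyond some point into [b]; and an unbounded set of integers contains a copy of
    omega. *)
Lemma finite_cup a b : ~ le_card omega a -> ~ le_card omega b -> ~ le_card omega (cup a b).
Proof.
  intros Ha Hb (f & Hf & I).
  pose (x := compr (fun n => n ∈ omega /\ app f n ∈ a)).
  assert (Hx : forall n, n ∈ x <-> n ∈ omega /\ app f n ∈ a).
  { apply (in_compr _ omega); [def|tauto]. }
  clearbody x.
  destruct (classic (forall n, n ∈ omega -> exists m, m ∈ x /\ n ∈ m)) as [U|U].
  - apply Ha, (le_card_trans _ x).
    + apply le_card_omega_unbounded; auto. intros n Hn; now apply Hx.
    + apply (le_card_fn (app f)); [dfn| |].
      * intros n Hn; now apply Hx.
      * intros n m Hn Hm; apply I; now apply Hx.
  - assert (B : exists n0, n0 ∈ omega /\ forall m, m ∈ x -> ~ n0 ∈ m).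
    { apply NNPP; intros N; apply U; intros n Hn; apply NNPP; intros N'; apply N.
      exists n; split; auto. intros m Hm K; eauto. }
    destruct B as (n0 & Hn0 & B).
    apply Hb, (le_card_trans _ (diff omega x)).
    + apply le_card_omega_unbounded; [intros n Hn; apply in_diff in Hn; tauto|].
      intros n Hn.
      assert (J : exists j, j ∈ omega /\ subset n j /\ subset n0 j).
      { destruct (ord_total n n0) as [K|[->|K]]; auto using omega_mem_ord.
        - exists n0; split; [auto|split; [|intros z; auto]].
          apply ord_subset_iff; auto using omega_mem_ord; now left.
        - exists n0; split; [auto|split; intros z; auto].
        - exists n; split; [auto|split; [intros z; auto|]].
          apply ord_subset_iff; auto using omega_mem_ord; now left. }
      destruct J as (j & Hj & S1 & S2).
      assert (T : forall i, i ∈ omega -> subset i j -> i ∈ succ j).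
      { intros i Hi S; apply in_succ. apply ord_subset_iff in S; auto using omega_mem_ord. }
      exists (succ j); split; [|auto].
      apply in_diff; split; [now apply succ_omega|].
      intros K; apply (B _ K); auto.
    + apply (le_card_fn (app f)); [dfn| |].
      * intros n Hn; apply in_diff in Hn as [Hn N].
        assert (K := app_funs _ _ _ _ Hf Hn). apply in_cup in K as [K|K]; auto.
        destruct N; apply Hx; auto.
      * intros n m Hn Hm; apply in_diff in Hn as [Hn _], Hm as [Hm _]; auto.
Qed.

Lemma finite_sing a : ~ le_card omega (sing a).
Proof.
  intros (f & Hf & I). apply (succ_neq_empty (empty : M)).
  apply I; auto using succ_omega, zero_omega.
  assert (A := app_funs _ _ _ _ Hf (succ_omega _ zero_omega)).
  assert (B := app_funs _ _ _ _ Hf zero_omega).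
  apply in_sing in A, B; congruence.
Qed.

Lemma finite_empty : ~ le_card omega (empty : M).
Proof.
  intros (f & Hf & _). exact (in_empty _ (app_funs _ _ _ _ Hf zero_omega)).
Qed.

Lemma finite_nat n : n ∈ omega -> ~ le_card omega n.
Proof.
  apply (omega_ind (fun n => ~ le_card omega n)); [def|apply finite_empty|].
  intros m Hm IH L. apply (finite_cup m (sing m)); auto using finite_sing.
  assert (cup m (sing m) = succ m) as ->; auto.
  apply ext_eq; intros z; rewrite in_cup, in_succ, in_sing; tauto.
Qed.

Lemma finite_times n m : n ∈ omega -> m ∈ omega -> ~ le_card omega (times n m).
Proof.
  intros Hn Hm. revert n Hn.
  apply (omega_ind (fun n => ~ le_card omega (times n m))); [def| |].
  - intros L; apply finite_empty. eapply le_card_trans; [exact L|].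
    apply le_card_subset; intros p Hp; apply in_times in Hp as (x & y & Hx & _).
    destruct (in_empty x Hx).
  - intros n Hn IH L. apply (finite_cup (times n m) (times (sing n) m)); auto.
    + intros K; apply (finite_nat m Hm). apply (le_card_trans _ _ _ K).
      apply (le_card_fn (fun p => the (fun y => p = pair n y))); [dfn| |].
      * intros p Hp; apply in_times in Hp as (x & y & Hx & Hy & ->).
        apply in_sing in Hx as ->. rewrite (the_eq _ _ y); auto.
        intros z E; apply pair_inj in E; symmetry; tauto.
      * intros p q Hp Hq; apply in_times in Hp as (x & y & Hx & Hy & ->),
          Hq as (x' & y' & Hx' & Hy' & ->). apply in_sing in Hx as ->, Hx' as ->.
        rewrite (the_eq _ _ y), (the_eq _ _ y'); auto; try congruence;
          intros z E; apply pair_inj in E; symmetry; tauto.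
    + apply (le_card_trans _ _ _ L), le_card_subset.
      intros p Hp; apply in_times in Hp as (x & y & Hx & Hy & ->).
      apply in_cup; rewrite !pair_in_times, in_sing. apply in_succ in Hx; tauto.
Qed.
End Cardinals.
Opaque hartogs.

(** * Goedel's pairing function and countable sets *)

(** The union of two ordinals is their maximum: pairs are ordered by maximum, then
    lexicographically. *)
Definition goedel_lt {M : model} (s t s' t' : M) : Prop :=
  cup s t ∈ cup s' t' \/
  cup s t = cup s' t' /\ (s ∈ s' \/ s = s' /\ t ∈ t').

Definition goedel_order {M : model} (k : M) : M :=
  graph (times k k) (times k k) (fun p q => exists s t s' t',
    p = pair s t /\ q = pair s' t' /\ goedel_lt s t s' t').

Definition goedel {M : model} (k s t : M) : M := rank (times k k) (goedel_order k) (pair s t).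

Lemma d_goedel_lt s t s' t' : dterm s -> dterm t -> dterm s' -> dterm t' ->
  dprop (fun M e => goedel_lt (s M e) (t M e) (s' M e) (t' M e)).
Proof. dunfold @goedel_lt. Qed.
#[local] Hint Resolve d_goedel_lt : defn.

Lemma t_goedel_order k : dterm k -> dterm (fun M e => goedel_order (k M e)).
Proof.
  intros Hk; unfold goedel_order.
  apply (t_graph (fun M e => times (k M e) (k M e)) (fun M e => times (k M e) (k M e))
    (fun M e p q => exists s t s' t',
    p = pair s t /\ q = pair s' t' /\ goedel_lt s t s' t')); dsolve.
Qed.
#[local] Hint Resolve t_goedel_order : defn.

Lemma t_goedel k s t : dterm k -> dterm s -> dterm t ->
  dterm (fun M e => goedel (k M e) (s M e) (t M e)).
Proof. dunfold @goedel. Qed.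
#[local] Hint Resolve t_goedel : defn.

Section Pairing.
Context {M : model}.
Implicit Types a b c f k m n r s t u v w x y z : M.

Lemma cup_ord a b : ordinal a -> ordinal b ->
  cup a b = a /\ ord_le b a \/ cup a b = b /\ a ∈ b.
Proof.
  intros Ha Hb. unfold ord_le.
  destruct (ord_total a b Ha Hb) as [H|[->|H]].
  - right; split; auto. apply ext_eq; intros z; rewrite in_cup; split; auto.
    intros [K|K]; auto. apply (ord_trans b a); auto.
  - left; split; auto. apply ext_eq; intros z; rewrite in_cup; tauto.
  - left; split; auto. apply ext_eq; intros z; rewrite in_cup; split; auto.
    intros [K|K]; auto. apply (ord_trans a b); auto.
Qed.

Lemma cup_mem k a b : ordinal k -> a ∈ k -> b ∈ k -> cup a b ∈ k.
Proof.
  intros Hk Ha Hb. destruct (cup_ord a b) as [[-> _]|[-> _]]; auto; eapply ord_in; eauto.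
Qed.

Lemma in_goedel_order k s t s' t' : pair (pair s t) (pair s' t') ∈ goedel_order k <->
  (s ∈ k /\ t ∈ k) /\ (s' ∈ k /\ t' ∈ k) /\ goedel_lt s t s' t'.
Proof.
  unfold goedel_order; rewrite in_graph by def. rewrite !pair_in_times. split.
  - intros (A & B & s1 & t1 & s1' & t1' & E & E' & C).
    apply pair_inj in E as [-> ->], E' as [-> ->]; auto.
  - intros (A & B & C); split; [auto|split; auto]. exists s, t, s', t'; auto.
Qed.

Lemma goedel_order_wo k : ordinal k -> wo (times k k) (goedel_order k).
Proof.
  intros Hk. split; [|split].
  - intros T HT NT. destruct (nonempty_ex T NT) as [p Hp].
    assert (TT : forall s t, pair s t ∈ T -> s ∈ k /\ t ∈ k).
    { intros s t H; apply pair_in_times, HT, H. }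
    assert (Hp' := HT p Hp). apply in_times in Hp' as (s0 & t0 & A & B & ->).
    destruct (ord_least (fun m => exists s t, pair s t ∈ T /\ m = cup s t) ltac:(def) (cup s0 t0))
      as (m & Om & (s1 & t1 & H1 & E1) & L1); [|eauto|].
    { apply (ord_in k); auto; now apply cup_mem. }
    destruct (ord_least (fun s => exists t, pair s t ∈ T /\ m = cup s t) ltac:(def) s1)
      as (s2 & Os & (t2 & H2 & E2) & L2); [|eauto|].
    { apply (ord_in k); auto; now apply (TT s1 t1). }
    destruct (ord_least (fun t => pair s2 t ∈ T /\ m = cup s2 t) ltac:(def) t2)
      as (t3 & Ot & [H3 E3] & L3); [|eauto|].
    { apply (ord_in k); auto; now apply (TT s2 t2). }
    exists (pair s2 t3); split; auto. intros q Hq K.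
    assert (Hq' := HT q Hq). apply in_times in Hq' as (s & t & Hs & Ht & ->).
    apply in_goedel_order in K as (_ & _ & [K|[E [K|[-> K]]]]); rewrite <- E3 in *.
    + apply (L1 _ K); eauto.
    + apply (L2 _ K); eauto.
    + apply (L3 _ K); auto.
  - intros p q p' Hp Hq Hp'.
    apply in_times in Hp as (s1 & t1 & A1 & B1 & ->), Hq as (s2 & t2 & A2 & B2 & ->),
      Hp' as (s3 & t3 & A3 & B3 & ->).
    rewrite !in_goedel_order. intros (_ & _ & C) (_ & _ & D). repeat (split; [auto|]).
    assert (Os := ord_in k s3 Hk A3). assert (Ot := ord_in k t3 Hk B3).
    assert (Om := ord_in k _ Hk (cup_mem k s3 t3 Hk A3 B3)).
    unfold goedel_lt in *.
    destruct C as [C|[C [C'|[C' C'']]]], D as [D|[D [D'|[D' D'']]]]; subst;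
      try rewrite C in *; try rewrite D in *; auto.
    + left; now apply (ord_trans _ (cup s2 t2)).
    + right; split; auto. left; now apply (ord_trans _ s2).
    + right; split; auto. right; split; auto. now apply (ord_trans _ t2).
  - intros p q Hp Hq. apply in_times in Hp as (s1 & t1 & A1 & B1 & ->),
      Hq as (s2 & t2 & A2 & B2 & ->).
    rewrite !in_goedel_order. unfold goedel_lt.
    destruct (ord_total (cup s1 t1) (cup s2 t2)) as [H|[H|H]];
      try (apply (ord_in k); auto using cup_mem); [tauto| |tauto].
    destruct (ord_total s1 s2) as [K|[->|K]]; try (apply (ord_in k); auto; fail);
      [tauto| |symmetry in H; tauto].
    destruct (ord_total t1 t2) as [L|[->|L]]; try (apply (ord_in k); auto; fail);
      [tauto|tauto|symmetry in H; tauto].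
Qed.

Lemma goedel_inj k s t s' t' : ordinal k -> s ∈ k -> t ∈ k -> s' ∈ k -> t' ∈ k ->
  goedel k s t = goedel k s' t' -> s = s' /\ t = t'.
Proof.
  intros Hk Hs Ht Hs' Ht' E. apply pair_inj.
  apply (rank_inj (times k k) (goedel_order k)); auto using goedel_order_wo; apply pair_in_times; auto.
Qed.

(** Hilbert's hotel: [m] goes to 0, the integers move up by one, and everything else stays. *)
Lemma succ_le_card m : ordinal m -> subset omega m -> le_card (succ m) m.
Proof.
  intros Hm S.
  assert (Nm : ~ m ∈ omega) by (intros K; exact (mem_irrefl m (S m K))).
  pose (F := fun x => the (fun v => (x = m /\ v = empty) \/
    ((x <> m /\ x ∈ omega) /\ v = succ x) \/ ((x <> m /\ ~ x ∈ omega) /\ v = x))).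
  assert (F1 : F m = empty).
  { apply the_eq; [auto|]. intuition. }
  assert (F2 : forall x, x ∈ omega -> F x = succ x).
  { intros x Hx; assert (x <> m) by congruence. apply the_eq; [auto|]. intuition. }
  assert (F3 : forall x, x <> m -> ~ x ∈ omega -> F x = x).
  { intros x H1 H2. apply the_eq; [auto|]. intuition. }
  apply (le_card_fn F); [unfold F; dfn| |].
  - intros x Hx; apply in_succ in Hx as [Hx| ->].
    + destruct (classic (x ∈ omega)) as [H|H].
      * rewrite F2; auto using succ_omega.
      * rewrite F3; auto. intros ->; exact (mem_irrefl m Hx).
    + rewrite F1; auto using zero_omega.
  - assert (C : forall x, x = m /\ F x = empty \/ x ∈ omega /\ F x = succ x \/
      ~ x ∈ omega /\ F x = x).
    { intros x. destruct (classic (x = m)) as [->|N]; [auto|].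
      destruct (classic (x ∈ omega)); auto. }
    intros x y _ _.
    destruct (C x) as [[-> ->]|[[Hx ->]|[Hx ->]]], (C y) as [[-> ->]|[[Hy ->]|[Hy ->]]];
      auto using succ_inj; intros E; exfalso.
    + exact (succ_neq_empty _ (eq_sym E)).
    + apply Hy; rewrite <- E; apply zero_omega.
    + exact (succ_neq_empty _ E).
    + apply Hy; rewrite <- E; now apply succ_omega.
    + apply Hx; rewrite E; apply zero_omega.
    + apply Hx; rewrite E; now apply succ_omega.
Qed.

(** Otherwise [k] embeds into the pairs below [(s, t)], hence into the square of [succ m] for the
    maximum [m] of [s] and [t], and that square is too small. The bound on smaller squares is a
    premise because this is a step of the induction in [times_le_card]. *)
Lemma goedel_in_aleph k : aleph k ->
  (forall m, m ∈ k -> subset omega m -> le_card (times m m) m) ->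
  forall s t, s ∈ k -> t ∈ k -> goedel k s t ∈ k.
Proof.
  intros Hk IH s t Hs Ht. assert (Hk' := Hk). apply aleph_iff in Hk' as (Ok & Lk & _).
  assert (W := goedel_order_wo k Ok). assert (Hp : pair s t ∈ times k k) by (apply pair_in_times; auto).
  apply NNPP; intros N. apply ord_not_mem in N; auto; [|apply rank_ord; auto; apply W].
  pose (m := cup s t). assert (Hm : m ∈ k) by now apply cup_mem.
  assert (Om := ord_in k m Ok Hm).
  assert (K : le_card k (times (succ m) (succ m))).
  { pose (F := fun x => the (fun q => q ∈ times k k /\ rank (times k k) (goedel_order k) q = x)).
    assert (HF : forall x, x ∈ k -> exists q, q ∈ times (succ m) (succ m) /\
      rank (times k k) (goedel_order k) q = x /\ F x = q).
    { intros x Hx. destruct (rank_surj (times k k) (goedel_order k) (pair s t) x) as (q & Hq & Hr & E);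
        auto; try apply W.
      exists q. split; [|split; auto; apply the_eq; auto].
      - assert (Hq' := Hq). apply in_times in Hq as (s' & t' & Hs' & Ht' & ->).
        apply in_goedel_order in Hr as (_ & _ & Hr).
        assert (L : subset (cup s' t') m).
        { unfold m. destruct Hr as [Hr|[-> _]]; [|intros z; auto].
          intros z Hz. apply (ord_trans _ (cup s' t')); auto. }
        assert (J : forall z, z ∈ k -> subset z (cup s' t') -> z ∈ succ m).
        { intros z Hz Sz; apply in_succ. apply ord_subset_iff; auto; [now apply (ord_in k)|].
          intros y Hy; auto. }
        apply pair_in_times; split; apply J; auto; intros z Hz; apply in_cup; auto.
      - intros z [A B]. apply (rank_inj (times k k) (goedel_order k)); auto; congruence. }
    apply (le_card_fn F); [unfold F; dfn| |].
    - intros x Hx; destruct (HF x Hx) as (q & A & B & ->); auto.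
    - intros x y Hx Hy. destruct (HF x Hx) as (q & A & <- & ->), (HF y Hy) as (q' & A' & <- & ->).
      congruence. }
  destruct (classic (m ∈ omega)) as [Hw|Hw].
  - apply (finite_times (succ m) (succ m)); auto using succ_omega.
    apply (le_card_trans _ k); auto. apply le_card_subset, ord_subset_iff; auto using omega_ord.
  - apply ord_not_mem in Hw; auto using omega_ord.
    apply (aleph_not_le k m Hk Hm).
    apply (le_card_trans _ _ _ K). apply (le_card_trans _ (times m m)); auto.
    apply le_card_times; now apply succ_le_card.
Qed.

(** At an aleph the pairing function is the embedding; any other infinite ordinal is equipotent with
    a smaller one. *)
Lemma times_le_card a : ordinal a -> subset omega a -> le_card (times a a) a.
Proof.
  apply (ord_ind (fun a => subset omega a -> le_card (times a a) a)); [def|].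
  intros k Ok IH Sk. destruct (classic (aleph k)) as [Hk|Hk].
  - apply (le_card_fn (rank (times k k) (goedel_order k))); [dfn| |].
    + intros p Hp; apply in_times in Hp as (s & t & Hs & Ht & ->).
      now apply goedel_in_aleph.
    + intros p q; apply rank_inj; now apply goedel_order_wo.
  - assert (E : exists b, b ∈ k /\ card_eq (ext b) (ext k)).
    { apply NNPP; intros N; apply Hk, aleph_iff; split; [auto|split].
      - apply ord_subset_iff; auto using omega_ord.
      - intros b Hb E; eauto. }
    destruct E as (b & Hb & E). assert (Ob := ord_in k b Ok Hb).
    assert (L := card_eq_le _ _ E). assert (L' := card_eq_le _ _ (card_eq_inv _ _ E)).
    assert (Sb : subset omega b).
    { apply ord_not_mem; auto using omega_ord. intros K; apply (finite_nat b K).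
      apply (le_card_trans _ k); auto. now apply le_card_subset. }
    apply (le_card_trans _ (times b b)); [now apply le_card_times|].
    apply (le_card_trans _ b); auto.
Qed.

Lemma goedel_in k s t : aleph k -> s ∈ k -> t ∈ k -> goedel k s t ∈ k.
Proof.
  intros Hk; apply goedel_in_aleph; auto. intros m Hm; apply times_le_card.
  apply (ord_in k); auto. apply Hk.
Qed.

(** Each value is sent to the least integer that codes one of its preimages, so no choice is
    made. *)
Lemma le_card_image (F : M -> M) b : dfun M F -> le_card b omega -> le_card (image F b) omega.
Proof.
  intros HF (f & Hf & I).
  assert (HI : forall y, y ∈ image F b <-> exists x, x ∈ b /\ y = F x) by (intros; now apply in_image).
  pose (g := fn b F). assert (Hg : forall x, x ∈ b -> app g x = F x) by (intros; now apply app_fn).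
  pose (P := fun y n => n ∈ omega /\ exists x, x ∈ b /\ app g x = y /\ app f x = n).
  pose (H := fun y => the (fun n => P y n /\ forall m, m ∈ n -> ~ P y m)).
  assert (K : forall y, y ∈ image F b -> P y (H y)).
  { intros y Hy. apply HI in Hy as (x & Hx & Ey). rewrite <- Hg in Ey by auto.
    clearbody g.
    destruct (ord_least (P y) ltac:(unfold P; def) (app f x)) as (n & On & Pn & L).
    - apply omega_mem_ord; eapply app_funs; eauto.
    - split; [eapply app_funs; eauto|]. exists x; auto.
    - assert (E : H y = n); [|now rewrite E].
      apply the_eq; [split; auto|]. intros m [Pm Lm].
      destruct (ord_total m n) as [K|[K|K]]; auto; [apply omega_mem_ord, Pm| |].
      + destruct (L m K Pm).
      + destruct (Lm n K Pn). }
  apply (le_card_fn H).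
  - clearbody g; unfold H, P; dfn.
  - intros y Hy; now apply K.
  - intros y z Hy Hz E. destruct (K y Hy) as (_ & x & Hx & <- & A).
    destruct (K z Hz) as (_ & x' & Hx' & <- & A').
    rewrite (I x x'); auto. congruence.
Qed.

Lemma le_card_omega_times : le_card (times omega (omega : M)) omega.
Proof. apply times_le_card; [apply omega_ord|intros z; auto]. Qed.

Lemma subsets_le_aleph0_iff (A : class M) u :
  subsets_le_aleph0 A u <-> (forall z, z ∈ u -> A z) /\ le_card u omega.
Proof.
  unfold subsets_le_aleph0; split; intros [H K]; split; auto.
  - destruct K as (w & Hw & K); apply is_omega_iff in Hw as ->; now apply card_le_iff.
  - exists omega; split; [now apply is_omega_iff|now apply card_le_iff].
Qed.

Lemma subsets_aleph0_iff (A : class M) u :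
  subsets_aleph0 A u <-> (forall z, z ∈ u -> A z) /\ le_card u omega /\ le_card omega u.
Proof.
  unfold subsets_aleph0; split; intros [H K]; split; auto.
  - destruct K as (w & Hw & K); apply is_omega_iff in Hw as ->.
    split; apply card_eq_le; auto using card_eq_inv.
  - destruct K as [K L]. exists omega; split; [now apply is_omega_iff|].
    destruct (le_card_otype u omega omega_ord K) as (b & [Hb| ->] & E & _); auto.
    destruct (finite_nat b Hb). apply (le_card_trans _ u); auto. now apply card_eq_le.
Qed.

(** The least ordinal into which [b] embeds would be an aleph if it exceeded omega, hence at least
    [k], although [b] embeds into itself. *)
Lemma aleph1_le k b : is_aleph1 k -> b ∈ k -> le_card b omega.
Proof.
  intros (Hk & w & Hw & Lw & Lk) Hb. apply is_omega_iff in Hw as ->.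
  assert (Ok : ordinal k) by apply Hk. assert (Ob := ord_in k b Ok Hb).
  destruct (ord_least (fun c => le_card b c) ltac:(def) b Ob (le_card_refl b)) as (c & Oc & Hc & L).
  destruct (ord_total omega c) as [H|[H|H]]; auto using omega_ord.
  - assert (Ac : aleph c).
    { apply aleph_iff; split; [auto|split; [now left|]].
      intros a Ha E. apply (L a Ha), (le_card_trans _ c); auto.
      now apply card_eq_le, card_eq_inv. }
    assert (K := Lk c Ac H). apply ord_subset_iff in K; auto.
    destruct (L b (K b Hb) (le_card_refl b)).
  - now subst.
  - apply (le_card_trans _ c); auto. apply le_card_subset, ord_subset_iff; auto using omega_ord.
    now left.
Qed.

Lemma subsets_lt_aleph1_countable (A : class M) u :
  subsets_lt_aleph1 A u -> (forall z, z ∈ u -> A z) /\ le_card u omega.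
Proof.
  intros (k & Hk & H & K & L); split; auto. apply card_le_iff in K.
  rewrite card_le_iff in L.
  destruct (le_card_otype u k) as (b & [Hb| ->] & E & _); auto; [apply Hk| |].
  - apply (le_card_trans _ b); [now apply card_eq_le|now apply (aleph1_le k)].
  - destruct L; now apply card_eq_le, card_eq_inv.
Qed.

Lemma countable_subsets_lt_aleph1 (A : class M) u w1 : is_aleph1 w1 ->
  (forall z, z ∈ u -> A z) -> le_card u omega -> subsets_lt_aleph1 A u.
Proof.
  intros Hw H K. exists w1; split; auto. split; auto.
  destruct Hw as (Hk & w & Hw & Lw & _). apply is_omega_iff in Hw as ->.
  split; rewrite card_le_iff.
  - apply (le_card_trans _ omega); auto. apply le_card_subset, ord_subset_iff; auto using omega_ord.
    + apply Hk.
    + now left.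
  - intros L. apply (aleph_not_le w1 omega Hk Lw). now apply (le_card_trans _ u).
Qed.

Lemma surj_trans a b c : surj a b -> surj b c -> surj a c.
Proof.
  intros (f & Hf & S) (g & Hg & T).
  exists (fn a (fun x => app g (app f x))).
  assert (D : dfun M (fun x => app g (app f x))) by dfn. split.
  - apply funs_fn; auto. intros x Hx; apply (app_funs b c); auto; apply (app_funs a b); auto.
  - intros z Hz. destruct (T z Hz) as (y & Hy & <-), (S y Hy) as (x & Hx & <-).
    exists x; split; auto. now rewrite app_fn.
Qed.

Lemma mem_hartogs a : ordinal a -> a ∈ hartogs a.
Proof.
  intros Ha; apply in_hartogs; split; auto.
  destruct (classic (a = empty)) as [E|E]; auto; right.
  destruct (nonempty_ex a E) as [z Hz].
  apply (surj_of_le_card a a z); auto using le_card_refl.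
Qed.

(** Provides the bound beyond which [mu] counts as large enough in [the_sequence_uniform]. *)
Lemma hartogs_aleph a : ordinal a -> subset omega a -> aleph (hartogs a).
Proof.
  intros Ha S. assert (H := hartogs_ord a).
  apply aleph_iff; split; [auto|split].
  - left. apply ord_subset_iff in S; auto using omega_ord.
    assert (K := mem_hartogs a Ha).
    destruct S as [S| ->]; auto. now apply (ord_trans _ a).
  - intros b Hb E. apply in_hartogs in Hb as [Ob [->|Hb]].
    + destruct (card_eq_le _ _ (card_eq_inv _ _ E)) as (f & Hf & _).
      exact (in_empty _ (app_funs _ _ _ _ Hf (empty_in_hartogs a))).
    + apply (hartogs_not_surj a), (surj_trans _ b); auto.
      apply (surj_of_le_card _ _ empty); [apply empty_in_hartogs|].
      now apply card_eq_le, card_eq_inv.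
Qed.
End Pairing.
Opaque goedel_order goedel.

(** * Galvin-Hajnal ranks *)

Definition cint {M : model} (Y c : M) : M :=
  compr (fun s => s ∈ Y /\ forall n, n ∈ omega -> s ∈ app c n).

Definition cunion {M : model} (Y c : M) : M :=
  compr (fun s => s ∈ Y /\ exists n, n ∈ omega /\ s ∈ app c n).

(** Completeness is phrased with omega-sequences, which fit dependent choice and give finite
    intersections by repetition. [complete_filter_iff] matches this with the notions of the theorem;
    the improper filter is included. *)
Definition complete_filter {M : model} (Y D : M) : Prop :=
  (forall A, A ∈ D -> subset A Y) /\ Y ∈ D /\
  (forall A B, A ∈ D -> subset A B -> subset B Y -> B ∈ D) /\
  (forall c, c ∈ funs omega D -> cint Y c ∈ D).

Definition lts {M : model} (Y f g : M) : M := compr (fun s => s ∈ Y /\ app f s ∈ app g s).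

Definition eqs {M : model} (Y f g : M) : M := compr (fun s => s ∈ Y /\ app f s = app g s).

(* The filter generated by [D] and [A]. *)

Definition plus {M : model} (Y D A : M) : M :=
  compr (fun B => subset B Y /\ cup B (diff Y A) ∈ D).

(** The rank is computed inside the set of functions into [succ lam], which contains the constant
    function [lam]. By [W_represents] nothing below such a function is lost modulo [D]; [is_rk_rk]
    and [is_rk_unique] identify the result with the rank over all ordinal functions. *)
Definition rk {M : model} (Y lam D f : M) : M :=
  rank (funs Y (succ lam))
    (graph (funs Y (succ lam)) (funs Y (succ lam)) (fun g h => lts Y g h ∈ D)) f.

(* The filter dual to the ideal of all sets [A] with [A = 0 mod D] or
   [rk_(D+A)(f) > rk_D(f)]. *)

Definition dual {M : model} (Y lam f D : M) : M :=
  compr (fun Z => subset Z Y /\ (Z ∈ D \/ rk Y lam (plus Y D (diff Y Z)) f <> rk Y lam D f)).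

Lemma t_cint Y c : dterm Y -> dterm c -> dterm (fun M e => cint (Y M e) (c M e)).
Proof. dunfold @cint. Qed.

Lemma t_cunion Y c : dterm Y -> dterm c -> dterm (fun M e => cunion (Y M e) (c M e)).
Proof. dunfold @cunion. Qed.
#[local] Hint Resolve t_cint t_cunion : defn.

Lemma d_complete_filter Y D : dterm Y -> dterm D ->
  dprop (fun M e => complete_filter (Y M e) (D M e)).
Proof. dunfold @complete_filter. Qed.

Lemma t_lts Y f g : dterm Y -> dterm f -> dterm g ->
  dterm (fun M e => lts (Y M e) (f M e) (g M e)).
Proof. dunfold @lts. Qed.

Lemma t_eqs Y f g : dterm Y -> dterm f -> dterm g ->
  dterm (fun M e => eqs (Y M e) (f M e) (g M e)).
Proof. dunfold @eqs. Qed.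

Lemma t_plus Y D A : dterm Y -> dterm D -> dterm A ->
  dterm (fun M e => plus (Y M e) (D M e) (A M e)).
Proof. dunfold @plus. Qed.
#[local] Hint Resolve d_complete_filter t_lts t_eqs t_plus : defn.

Lemma t_rk Y lam D f : dterm Y -> dterm lam -> dterm D -> dterm f ->
  dterm (fun M e => rk (Y M e) (lam M e) (D M e) (f M e)).
Proof.
  intros HY Hl HD Hf; unfold rk. apply t_rank; [dsolve| |dsolve].
  apply (t_graph _ _ (fun M e g h => lts (Y M e) g h ∈ D M e)); [dsolve|dsolve|].
  dlift; dsolve.
Qed.
#[local] Hint Resolve t_rk : defn.

Lemma t_dual Y lam f D : dterm Y -> dterm lam -> dterm f -> dterm D ->
  dterm (fun M e => dual (Y M e) (lam M e) (f M e) (D M e)).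
Proof. dunfold @dual. Qed.
#[local] Hint Resolve t_dual : defn.

Section Filters.
Context {M : model}.
Implicit Types a b c f g h k m n r s t u v w x y z A B D Y Z : M.

Lemma in_cint Y c s : s ∈ cint Y c <-> s ∈ Y /\ forall n, n ∈ omega -> s ∈ app c n.
Proof.
  apply (in_compr (fun s => s ∈ Y /\ forall n, n ∈ omega -> s ∈ app c n) Y); [def|tauto].
Qed.

Lemma in_cunion Y c s : s ∈ cunion Y c <-> s ∈ Y /\ exists n, n ∈ omega /\ s ∈ app c n.
Proof.
  apply (in_compr (fun s => s ∈ Y /\ exists n, n ∈ omega /\ s ∈ app c n) Y); [def|tauto].
Qed.

Lemma in_lts Y f g s : s ∈ lts Y f g <-> s ∈ Y /\ app f s ∈ app g s.
Proof. apply (in_compr (fun s => s ∈ Y /\ app f s ∈ app g s) Y); [def|tauto]. Qed.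

Lemma in_eqs Y f g s : s ∈ eqs Y f g <-> s ∈ Y /\ app f s = app g s.
Proof. apply (in_compr (fun s => s ∈ Y /\ app f s = app g s) Y); [def|tauto]. Qed.

Lemma in_plus Y D A B : B ∈ plus Y D A <-> subset B Y /\ cup B (diff Y A) ∈ D.
Proof.
  apply (in_compr (fun B => subset B Y /\ cup B (diff Y A) ∈ D) (power Y)); [def|].
  intros x [H _]; now apply in_power.
Qed.

Lemma diff_diff Y Z : subset Z Y -> diff Y (diff Y Z) = Z.
Proof.
  intros H; apply ext_eq; intros z; rewrite !in_diff; split.
  - intros [A B]; apply NNPP; tauto.
  - intros K; split; auto; tauto.
Qed.

Lemma in_dual Y lam f D Z : Z ∈ dual Y lam f D <->
  subset Z Y /\ (Z ∈ D \/ rk Y lam (plus Y D (diff Y Z)) f <> rk Y lam D f).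
Proof.
  apply (in_compr (fun Z => subset Z Y /\ (Z ∈ D \/ rk Y lam (plus Y D (diff Y Z)) f <> rk Y lam D f))
    (power Y)); [def|]. intros x [H _]; now apply in_power.
Qed.

Lemma complete_filter_sub Y D A : complete_filter Y D -> A ∈ D -> subset A Y.
Proof. intros H; apply H. Qed.

Lemma complete_filter_top Y D : complete_filter Y D -> Y ∈ D.
Proof. intros H; apply H. Qed.

Lemma complete_filter_up Y D A B : complete_filter Y D -> A ∈ D ->
  (forall s, s ∈ A -> s ∈ B) -> subset B Y -> B ∈ D.
Proof. intros H K L N; apply (proj1 (proj2 (proj2 H)) A); auto. Qed.

Lemma complete_filter_cint Y D (F : M -> M) A : complete_filter Y D -> dfun M F ->
  (forall n, n ∈ omega -> F n ∈ D) -> subset A Y ->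
  (forall s, s ∈ Y -> (forall n, n ∈ omega -> s ∈ F n) -> s ∈ A) -> A ∈ D.
Proof.
  intros H HF K S L. apply (complete_filter_up Y D (cint Y (fn omega F))); auto.
  - apply H, funs_fn; auto.
  - intros s Hs; apply in_cint in Hs as [Hs Hn]; apply L; auto.
    intros n Hn'; specialize (Hn n Hn'). now rewrite app_fn in Hn.
Qed.

Lemma complete_filter_cap Y D A B C : complete_filter Y D -> A ∈ D -> B ∈ D ->
  subset C Y -> (forall s, s ∈ A -> s ∈ B -> s ∈ C) -> C ∈ D.
Proof.
  intros H HA HB S L.
  pose (F := fun n => the (fun v => (n = empty /\ v = A) \/ (n <> empty /\ v = B))).
  assert (F1 : F empty = A) by (apply the_case; auto).
  assert (F2 : forall n, n <> empty -> F n = B) by (intros; now apply the_case').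
  apply (complete_filter_cint Y D F); auto.
  - unfold F; dfn.
  - intros n Hn; destruct (classic (n = empty)) as [->|N]; [rewrite F1|rewrite F2]; auto.
  - intros s Hs K. apply L.
    + rewrite <- F1; apply K, zero_omega.
    + rewrite <- (F2 (succ empty)) by apply succ_neq_empty; apply K, succ_omega, zero_omega.
Qed.

Lemma complete_filter_iff Y D : (exists w1 : M, is_aleph1 w1) ->
  (complete_filter Y D <-> filter Y D /\ aleph1_complete Y D).
Proof.
  intros [w1 Hw]; split.
  - intros H; split.
    + split; [apply H|split; [apply H|split; [apply H|]]].
      intros A B C HA HB HC. apply (complete_filter_cap Y D A B); auto.
      * intros s Hs; apply HC in Hs as [Hs _]; now apply (complete_filter_sub Y D A).
      * intros s K L; apply HC; auto.
    + intros C I HC HI. apply subsets_lt_aleph1_countable in HC as [HC K].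
      destruct (classic (C = empty)) as [->|N].
      * assert (I = Y) as ->; [|apply H]. apply ext_eq; intros z; rewrite HI.
        split; [tauto|]. intros Hz; split; auto. intros A HA; destruct (in_empty A HA).
      * destruct (nonempty_ex C N) as [A0 HA0].
        destruct (surj_of_le_card C omega A0 HA0 K) as (f & Hf & S).
        apply (complete_filter_cint Y D (app f)); auto; [dfn| | |].
        -- intros n Hn; apply HC; eapply app_funs; eauto.
        -- intros s Hs; apply HI in Hs; tauto.
        -- intros s Hs L; apply HI; split; auto. intros A HA.
           destruct (S A HA) as (n & Hn & <-); auto.
  - intros [F C]. split; [apply F|split; [apply F|split; [apply F|]]].
    intros c Hc. apply (C (image (app c) omega)).
    + apply (countable_subsets_lt_aleph1 _ _ w1); auto.
      * intros z Hz; apply in_image in Hz as (n & Hn & ->); [|dfn]. eapply app_funs; eauto.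
      * apply le_card_image; [dfn|apply le_card_refl].
    + intros z; rewrite in_cint. split; intros [A B]; split; auto.
      * intros A' HA; apply in_image in HA as (n & Hn & ->); [auto|dfn].
      * intros n Hn; apply B, in_image; [dfn|eauto].
Qed.

Lemma proper_iff D : proper D <-> ~ empty ∈ D.
Proof.
  split.
  - intros H; apply H; now apply is_empty_iff.
  - intros H e He; apply is_empty_iff in He as ->; auto.
Qed.

Lemma plus_complete Y D A : complete_filter Y D -> complete_filter Y (plus Y D A).
Proof.
  intros H. split; [|split; [|split]].
  - intros B HB; apply in_plus in HB; tauto.
  - apply in_plus; split; [intros z; auto|].
    apply (complete_filter_up Y D Y); auto using complete_filter_top.
    + intros s Hs; apply in_cup; auto.
    + intros s Hs; apply in_cup in Hs as [Hs|Hs]; auto; apply in_diff in Hs; tauto.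
  - intros B C HB S T; apply in_plus in HB as [HB K]; apply in_plus; split; auto.
    apply (complete_filter_up Y D _ _ H K).
    + intros s Hs; apply in_cup in Hs as [Hs|Hs]; apply in_cup; auto.
    + intros s Hs; apply in_cup in Hs as [Hs|Hs]; auto; apply in_diff in Hs; tauto.
  - intros c Hc; apply in_plus; split; [intros s Hs; apply in_cint in Hs; tauto|].
    apply (complete_filter_cint Y D (fun n => cup (app c n) (diff Y A))); auto; [dfn| | |].
    + intros n Hn. assert (K := app_funs _ _ _ _ Hc Hn). apply in_plus in K; tauto.
    + intros s Hs; apply in_cup in Hs as [Hs|Hs]; [apply in_cint in Hs|apply in_diff in Hs]; tauto.
    + intros s Hs K; apply in_cup. destruct (classic (s ∈ A)) as [HA|HA].
      * left; apply in_cint; split; auto. intros n Hn.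
        destruct (proj1 (in_cup _ _ _) (K n Hn)) as [L|L]; auto. apply in_diff in L; tauto.
      * right; apply in_diff; auto.
Qed.

Lemma plus_proper Y D A : ~ diff Y A ∈ D -> ~ empty ∈ plus Y D A.
Proof.
  intros N H; apply in_plus in H as [_ H]; apply N.
  assert (diff Y A = cup empty (diff Y A)) as ->; auto.
  apply ext_eq; intros z; rewrite in_cup. split; auto. intros [K|K]; auto.
  destruct (in_empty z K).
Qed.

Lemma plus_sub Y D A : complete_filter Y D -> subset D (plus Y D A).
Proof.
  intros H B HB; assert (K := complete_filter_sub Y D B H HB).
  apply in_plus; split; auto. apply (complete_filter_up Y D B); auto.
  - intros s Hs; apply in_cup; auto.
  - intros s Hs; apply in_cup in Hs as [Hs|Hs]; auto; apply in_diff in Hs; tauto.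
Qed.

Lemma plus_mem Y D A B : complete_filter Y D -> subset B Y ->
  (forall s, s ∈ Y -> s ∈ A -> s ∈ B) -> B ∈ plus Y D A.
Proof.
  intros H S K. apply in_plus; split; auto.
  apply (complete_filter_up Y D Y); auto using complete_filter_top.
  - intros s Hs; apply in_cup. destruct (classic (s ∈ A)); auto. right; apply in_diff; auto.
  - intros s Hs; apply in_cup in Hs as [Hs|Hs]; auto; apply in_diff in Hs; tauto.
Qed.

Lemma plus_anti Y D A B : complete_filter Y D -> (forall s, s ∈ Y -> s ∈ A -> s ∈ B) ->
  subset (plus Y D B) (plus Y D A).
Proof.
  intros H S C HC; apply in_plus in HC as [HC K]; apply in_plus; split; auto.
  apply (complete_filter_up Y D _ _ H K).
  - intros s Hs; apply in_cup; apply in_cup in Hs as [Hs|Hs]; auto.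
    apply in_diff in Hs as [Hs N]; right; apply in_diff; split; auto.
  - intros s Hs; apply in_cup in Hs as [Hs|Hs]; auto; apply in_diff in Hs; tauto.
Qed.

Lemma positive_mono Y D A B : complete_filter Y D -> (forall s, s ∈ Y -> s ∈ A -> s ∈ B) ->
  ~ diff Y A ∈ D -> ~ diff Y B ∈ D.
Proof.
  intros H S N K; apply N. apply (complete_filter_up Y D _ _ H K).
  - intros s Hs; apply in_diff in Hs as [Hs N']; apply in_diff; split; auto.
  - intros s Hs; apply in_diff in Hs; tauto.
Qed.
End Filters.

Opaque cint cunion lts eqs plus dual.

(** * Ranks modulo a filter, and the dual filter *)

Section Ranks.
Context {M : model}.
Implicit Types a b c f g h k m n r s t u v w x y z A B D Z : M.
Context (Y lam : M) (Hlam : ordinal lam).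

Let W : M := funs Y (succ lam).
Let R D : M := graph W W (fun g h => lts Y g h ∈ D).

Lemma in_R D g h : pair g h ∈ R D <-> g ∈ W /\ h ∈ W /\ lts Y g h ∈ D.
Proof. apply (in_graph (fun g h => lts Y g h ∈ D) W W); def. Qed.

Lemma W_ord f s : f ∈ W -> s ∈ Y -> ordinal (app f s).
Proof.
  intros Hf Hs. apply (ord_in (succ lam)); [now apply ord_succ|]. now apply (app_funs Y).
Qed.

(** DC gives a sequence decreasing modulo [D]. Countably many members of a proper complete filter
    have a common point, and there the values would form an infinite decreasing sequence of
    ordinals. *)
Lemma R_wf D : complete_filter Y D -> ~ empty ∈ D -> wf W (R D).
Proof.
  intros H P T HT NT; apply NNPP; intros N.
  assert (K : forall f, f ∈ T -> exists g, g ∈ T /\ lts Y g f ∈ D).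
  { intros f Hf; apply NNPP; intros N'; apply N; exists f; split; auto.
    intros g Hg K; apply in_R in K as (_ & _ & K); eauto. }
  destruct (dependent_choice T (fun f g => lts Y g f ∈ D)) as (F & HF & HL); auto.
  - def.
  - now apply nonempty_ex.
  - assert (E : exists s, s ∈ Y /\ forall n, n ∈ omega -> app (app F (succ n)) s ∈ app (app F n) s).
    { apply NNPP; intros N'; apply P.
      apply (complete_filter_cint Y D (fun n => lts Y (app F (succ n)) (app F n))); auto; [dfn| |].
      - intros z Hz; destruct (in_empty z Hz).
      - intros s Hs L; exfalso; apply N'; exists s; split; auto.
        intros n Hn; specialize (L n Hn); apply in_lts in L; tauto. }
    destruct E as (s & Hs & E).
    assert (HI : forall y, y ∈ image (fun n => app (app F n) s) omega <->
      exists n, n ∈ omega /\ y = app (app F n) s) by (intros; apply in_image; dfn).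
    destruct (foundation_min (image (fun n => app (app F n) s) omega)) as (y & Hy & L).
    + exists (app (app F empty) s); apply HI; eauto using zero_omega.
    + apply HI in Hy as (n & Hn & ->). apply (L _ (E n Hn)), HI.
      eauto using succ_omega.
Qed.

Lemma R_trans D : complete_filter Y D -> forall f g h, f ∈ W -> g ∈ W -> h ∈ W ->
  pair f g ∈ R D -> pair g h ∈ R D -> pair f h ∈ R D.
Proof.
  intros H f g h Hf Hg Hh; rewrite !in_R. intros (_ & _ & K) (_ & _ & L).
  split; [auto|split; auto].
  apply (complete_filter_cap Y D _ _ _ H K L).
  - intros s Hs; apply in_lts in Hs; tauto.
  - intros s K' L'; apply in_lts in K' as [Hs K'], L' as [_ L']; apply in_lts; split; auto.
    apply (ord_trans _ (app g s)); auto. now apply W_ord.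
Qed.

Definition proper_filter D : Prop := complete_filter Y D /\ ~ empty ∈ D.

Lemma rk_ord D f : proper_filter D -> f ∈ W -> ordinal (rk Y lam D f).
Proof. intros [H P] Hf; apply rank_ord; auto. now apply R_wf. Qed.

Lemma in_rk D f z : proper_filter D -> f ∈ W ->
  (z ∈ rk Y lam D f <-> exists g, g ∈ W /\ lts Y g f ∈ D /\ rk Y lam D g = z).
Proof.
  intros [H P] Hf. assert (Hw := R_wf D H P). split.
  - intros Hz. destruct (rank_surj W (R D) f z Hw (R_trans D H) Hf Hz) as (g & A & B & C).
    apply in_R in B as (_ & _ & B); eauto.
  - intros (g & A & B & <-). apply (rank_lt W (R D)); auto. apply in_R; auto.
Qed.

Opaque rk.

Lemma rk_lt D g f : proper_filter D -> g ∈ W -> f ∈ W -> lts Y g f ∈ D ->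
  rk Y lam D g ∈ rk Y lam D f.
Proof. intros H Hg Hf L; apply in_rk; auto. exists g; auto. Qed.

Lemma rk_le D f g A : proper_filter D -> f ∈ W -> g ∈ W -> A ∈ D ->
  (forall s, s ∈ A -> subset (app f s) (app g s)) -> subset (rk Y lam D f) (rk Y lam D g).
Proof.
  intros H Hf Hg HA K z Hz; apply in_rk in Hz as (h & Hh & L & <-); auto.
  apply rk_lt; auto. apply (complete_filter_cap Y D A _ _ (proj1 H) HA L).
  - intros s Hs; apply in_lts in Hs; tauto.
  - intros s Hs L'; apply in_lts in L' as [Hs' L']; apply in_lts; split; auto.
    now apply (K s Hs).
Qed.

Lemma rk_eq D f g A : proper_filter D -> f ∈ W -> g ∈ W -> A ∈ D ->
  (forall s, s ∈ A -> app f s = app g s) -> rk Y lam D f = rk Y lam D g.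
Proof.
  intros H Hf Hg HA K. apply ext_eq; intros z; split.
  - apply (rk_le D f g A); auto. intros s Hs; rewrite (K s Hs); intros y; auto.
  - apply (rk_le D g f A); auto. intros s Hs; rewrite (K s Hs); intros y; auto.
Qed.

Lemma rk_mono D D' f : proper_filter D -> proper_filter D' -> subset D D' -> f ∈ W ->
  subset (rk Y lam D f) (rk Y lam D' f).
Proof.
  intros H H' S.
  apply (wf_ind (fun f => subset (rk Y lam D f) (rk Y lam D' f)) W (R D));
    [def|now apply R_wf; apply H|].
  intros g Hg IH z Hz; apply in_rk in Hz as (h & Hh & L & <-); auto.
  assert (K := IH h Hh ltac:(apply in_R; auto)).
  assert (L' : rk Y lam D' h ∈ rk Y lam D' g) by (apply rk_lt; auto).
  apply ord_subset_iff in K; try (apply rk_ord; assumption).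
  destruct K as [K|K]; [|now rewrite K].
  apply (ord_trans _ (rk Y lam D' h)); try assumption. now apply rk_ord.
Qed.

Lemma plus_proper_filter D A : proper_filter D -> ~ diff Y A ∈ D ->
  proper_filter (plus Y D A).
Proof. intros [H _] N; split; [now apply plus_complete|now apply plus_proper]. Qed.

(* Functions that witness the rank on the pieces are glued along the first
   piece that contains a given point. *)

Lemma rk_cunion D : proper_filter D -> forall z, ordinal z ->
  forall f c, f ∈ W -> c ∈ funs omega (power Y) ->
  (forall n, n ∈ omega -> ~ diff Y (app c n) ∈ D -> z ∈ rk Y lam (plus Y D (app c n)) f) ->
  ~ diff Y (cunion Y c) ∈ D -> z ∈ rk Y lam (plus Y D (cunion Y c)) f.
Proof.
  intros H.
  apply (ord_ind (fun z => forall f c, f ∈ W -> c ∈ funs omega (power Y) ->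
  (forall n, n ∈ omega -> ~ diff Y (app c n) ∈ D -> z ∈ rk Y lam (plus Y D (app c n)) f) ->
  ~ diff Y (cunion Y c) ∈ D -> z ∈ rk Y lam (plus Y D (cunion Y c)) f)); [unfold W; def|].
  intros z Hz IH f c Hf Hc Hp Np.
  set (U := cunion Y c) in *.
  assert (Hc' : forall n, n ∈ omega -> subset (app c n) Y).
  { intros n Hn; apply in_power; eapply app_funs; eauto. }
  assert (HU : proper_filter (plus Y D U)) by now apply plus_proper_filter.
  assert (CF := proj1 H).
  (* On each positive piece a function below [f] of rank at least [z] is chosen; a null piece
     imposes nothing, and [f] itself fills the place. *)
  destruct (countable_choice W (fun n g => g ∈ W /\ (~ diff Y (app c n) ∈ D ->
    lts Y g f ∈ plus Y D (app c n) /\ subset z (rk Y lam (plus Y D (app c n)) g))))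
    as (G & HG & KG); [unfold W; def| |].
  { intros n Hn. destruct (classic (diff Y (app c n) ∈ D)) as [N|N].
    - exists f; split; auto; split; auto; tauto.
    - assert (K := Hp n Hn N). apply in_rk in K as (g & Hg & L & <-); auto.
      + exists g; split; auto; split; auto. intros _; split; auto. intros y; auto.
      + now apply plus_proper_filter. }
  pose (fst_at := fun s n => n ∈ omega /\ s ∈ app c n /\ forall m, m ∈ n -> ~ s ∈ app c m).
  assert (FA : forall s, s ∈ U -> exists n, fst_at s n).
  { intros s Hs; apply in_cunion in Hs as (Hs & n & Hn & K).
    destruct (ord_least (fun n => n ∈ omega /\ s ∈ app c n) ltac:(def) n) as (m & Om & [A B] & L); auto.
    - now apply omega_mem_ord.
    - exists m; split; [auto|split; auto]. intros i Hi Ki. apply (L i Hi); split; auto.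
      apply (ord_trans omega m); auto using omega_ord. }
  assert (FU : forall s n m, fst_at s n -> fst_at s m -> n = m).
  { intros s n m (A & B & C) (A' & B' & C').
    destruct (ord_total n m) as [K|[K|K]]; auto using omega_mem_ord.
    - destruct (C' n K B).
    - destruct (C m K B'). }
  pose (gs := fun s => the (fun v => (exists n, fst_at s n /\ v = app (app G n) s) \/
    ~ (exists n, fst_at s n) /\ v = app f s)).
  assert (G1 : forall s n, fst_at s n -> gs s = app (app G n) s).
  { intros s n Hn; apply the_eq; [left; eauto|].
    intros y [(m & Hm & ->)|[N _]]; [now rewrite (FU s n m)|destruct N; eauto]. }
  assert (G2 : forall s, ~ (exists n, fst_at s n) -> gs s = app f s).
  { intros s N; apply the_eq; [auto|]. intros y [(m & Hm & _)|[_ K]]; auto. destruct N; eauto. }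
  assert (Dg : dfun M gs) by (unfold gs, fst_at; dfn).
  set (g := fn Y gs).
  assert (Hg : g ∈ W).
  { apply funs_fn; auto. intros s Hs. destruct (classic (exists n, fst_at s n)) as [[n Hn]|N].
    - rewrite (G1 s n Hn). apply (app_funs Y); auto. apply (app_funs omega); auto. apply Hn.
    - rewrite G2; auto. now apply (app_funs Y). }
  assert (Ag : forall s, s ∈ Y -> app g s = gs s) by (intros; now apply app_fn).
  clearbody g; clear Dg.
  assert (Lg : lts Y g f ∈ plus Y D U).
  { apply in_plus; split; [intros s Hs; apply in_lts in Hs; tauto|].
    apply (complete_filter_cint Y D (fun n => cup (lts Y (app G n) f) (diff Y (app c n)))); auto.
    - dfn.
    - intros n Hn. destruct (KG n Hn) as [_ K]. destruct (classic (diff Y (app c n) ∈ D)) as [N|N].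
      + apply (complete_filter_up Y D _ _ CF N).
        * intros s Hs; apply in_cup; auto.
        * intros s Hs; apply in_cup in Hs as [Hs|Hs]; [apply in_lts in Hs|apply in_diff in Hs]; tauto.
      + destruct (K N) as [L _]; apply in_plus in L; tauto.
    - intros s Hs; apply in_cup in Hs as [Hs|Hs]; [apply in_lts in Hs|apply in_diff in Hs]; tauto.
    - intros s Hs K; apply in_cup. destruct (classic (s ∈ U)) as [HsU|HsU].
      + left; apply in_lts; split; auto. destruct (FA s HsU) as [n Hn].
        rewrite Ag, (G1 s n Hn); auto.
        destruct (proj1 (in_cup _ _ _) (K n (proj1 Hn))) as [L|L].
        * apply in_lts in L; tauto.
        * apply in_diff in L as [_ L]; destruct L; apply Hn.
      + right; apply in_diff; auto. }
  assert (S : subset z (rk Y lam (plus Y D U) g)).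
  { intros y Hy.
    (* The pieces are made disjoint. On [c' n] the glued function equals [app G n], whose rank
       remains at least [z] on the smaller piece, so the induction hypothesis for [y] in [z] applies
       to [g] and [c']. *)
    pose (c' := fn omega (fun n => compr (fun s => s ∈ Y /\ fst_at s n))).
    assert (Dc : dfun M (fun n => compr (fun s => s ∈ Y /\ fst_at s n))) by (unfold fst_at; dfn).
    assert (Ac : forall n s, n ∈ omega -> (s ∈ app c' n <-> s ∈ Y /\ fst_at s n)).
    { intros n s Hn. unfold c'; rewrite app_fn by auto.
      apply (in_compr (fun s => s ∈ Y /\ fst_at s n) Y); [unfold fst_at; def|tauto]. }
    assert (Hc1 : c' ∈ funs omega (power Y)).
    { apply funs_fn; auto. intros n Hn; apply in_power; intros s Hs.
      assert (Q : s ∈ app c' n) by (unfold c'; now rewrite app_fn).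
      apply Ac in Q; tauto. }
    clearbody c'.
    assert (EU : cunion Y c' = U).
    { apply ext_eq; intros s; unfold U; split; intros Hs.
      - apply in_cunion in Hs as (Hs & n & Hn & K); apply Ac in K as (_ & K); auto.
        apply in_cunion; split; auto. exists n; split; auto; apply K.
      - assert (HsY := Hs); apply in_cunion in HsY as [HsY _].
        destruct (FA s Hs) as [n Hn]. apply in_cunion; split; auto.
        exists n; split; [apply Hn|]. apply Ac; auto; apply Hn. }
    rewrite <- EU. apply IH; auto; [|now rewrite EU].
    intros n Hn N.
    assert (N' : ~ diff Y (app c n) ∈ D).
    { apply (positive_mono Y D (app c' n)); auto. intros s _ Hs; apply Ac in Hs as [_ Hs]; auto. apply Hs. }
    destruct (KG n Hn) as [HGn K]. destruct (K N') as [_ Kz].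
    assert (Sub : subset (plus Y D (app c n)) (plus Y D (app c' n))).
    { apply plus_anti; auto. intros s _ Hs; apply Ac in Hs as [_ Hs]; auto. apply Hs. }
    assert (P' := plus_proper_filter D _ H N). assert (P := plus_proper_filter D _ H N').
    rewrite (rk_eq (plus Y D (app c' n)) g (app G n) (app c' n)); try assumption.
    - exact (rk_mono _ _ _ P P' Sub HGn y (Kz y Hy)).
    - apply plus_mem; auto. intros s Hs; apply Ac in Hs; tauto.
    - intros s Hs; apply Ac in Hs as [Hs F]; auto. rewrite Ag; auto. }
  assert (L : rk Y lam (plus Y D U) g ∈ rk Y lam (plus Y D U) f) by (apply rk_lt; auto).
  apply ord_subset_iff in S; auto using rk_ord.
  destruct S as [S| ->]; auto. apply (ord_trans _ (rk Y lam (plus Y D U) g)); auto using rk_ord.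
Qed.

Lemma dual_sub D f : complete_filter Y D -> subset D (dual Y lam f D).
Proof.
  intros H Z HZ; apply in_dual; split; auto. now apply (complete_filter_sub Y D).
Qed.

(** Enlarging a filter can only raise the rank, so the inequality in [dual] is a strict increase. *)
Lemma dual_not_mem D f Z : proper_filter D -> f ∈ W -> subset Z Y -> ~ Z ∈ D ->
  (Z ∈ dual Y lam f D <-> rk Y lam D f ∈ rk Y lam (plus Y D (diff Y Z)) f).
Proof.
  intros H Hf S N.
  assert (P : proper_filter (plus Y D (diff Y Z))).
  { apply plus_proper_filter; auto. now rewrite diff_diff. }
  rewrite in_dual. split.
  - intros [_ [K|K]]; [tauto|].
    apply ord_subset_mem; [now apply rk_ord|now apply rk_ord| |congruence].
    apply rk_mono; try assumption. now apply plus_sub, H.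
  - intros K; split; auto. right; intros E; rewrite E in K. exact (mem_irrefl _ K).
Qed.

(** Countable completeness is [rk_cunion] for the complements, with [z] the rank of [f] modulo [D].
    Upward closure holds since a smaller complement generates a larger filter. *)
Lemma dual_proper_filter D f : proper_filter D -> f ∈ W -> proper_filter (dual Y lam f D).
Proof.
  intros H Hf; assert (CF := proj1 H). split; [split; [|split; [|split]]|].
  - intros A HA; apply in_dual in HA; tauto.
  - apply dual_sub; auto. now apply complete_filter_top.
  - intros A B HA S T.
    destruct (classic (B ∈ D)) as [HB|NB]; [now apply dual_sub|].
    assert (NA : ~ A ∈ D) by (intros K; apply NB, (complete_filter_up Y D A); auto).
    assert (SA : subset A Y) by (apply in_dual in HA; tauto).
    apply dual_not_mem in HA; auto. apply dual_not_mem; auto.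
    revert HA; apply rk_mono; auto.
    + apply plus_proper_filter; auto. now rewrite diff_diff.
    + apply plus_proper_filter; auto. now rewrite diff_diff.
    + apply plus_anti; auto. intros s _ Hs; apply in_diff in Hs as [Hs N].
      apply in_diff; split; auto.
  - intros c Hc.
    assert (Sc : forall n, n ∈ omega -> subset (app c n) Y).
    { intros n Hn. assert (K := app_funs _ _ _ _ Hc Hn). apply in_dual in K; tauto. }
    destruct (classic (cint Y c ∈ D)) as [HB|NB]; [now apply dual_sub|].
    assert (SC : subset (cint Y c) Y) by (intros s Hs; apply in_cint in Hs; tauto).
    apply dual_not_mem; auto.
    assert (D' : dfun M (fun n => diff Y (app c n))) by dfn.
    pose (c' := fn omega (fun n => diff Y (app c n))).
    assert (Ac : forall n, n ∈ omega -> app c' n = diff Y (app c n))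
      by (intros; unfold c'; now rewrite app_fn).
    assert (EU : diff Y (cint Y c) = cunion Y c').
    { apply ext_eq; intros s; rewrite in_diff, in_cint, in_cunion. split.
      - intros [Hs N]; split; auto. apply NNPP; intros N'; apply N; split; auto.
        intros n Hn; apply NNPP; intros N2; apply N'; exists n; split; auto.
        rewrite Ac; auto; apply in_diff; auto.
      - intros [Hs (n & Hn & K)]; split; auto. intros [_ L].
        rewrite Ac in K by auto; apply in_diff in K as [_ K]; auto. }
    rewrite EU. apply rk_cunion; auto using rk_ord.
    + apply funs_fn; auto. intros n Hn; apply in_power; intros s Hs; apply in_diff in Hs; tauto.
    + intros n Hn. rewrite Ac by auto. rewrite diff_diff by auto. intros N.
      apply dual_not_mem; auto. now apply (app_funs omega).
    + rewrite <- EU, diff_diff; auto.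
  (* Adding the whole of [Y] to [D] changes nothing, so the rank cannot increase. *)
  - intros K. apply dual_not_mem in K; auto; [|intros z Hz; destruct (in_empty z Hz)|apply H].
    assert (E : plus Y D (diff Y empty) = D); [|rewrite E in K; exact (mem_irrefl _ K)].
    assert (E0 : diff Y (diff Y empty) = empty).
    { apply diff_diff. intros z Hz; destruct (in_empty z Hz). }
    apply ext_eq; intros B; rewrite in_plus, E0.
    assert (EB : cup B empty = B).
    { apply ext_eq; intros z; rewrite in_cup; split; auto. intros [Q|Q]; auto. destruct (in_empty z Q). }
    rewrite EB. split; [tauto|]. intros HB; split; auto. now apply (complete_filter_sub Y D).
Qed.

(** Let [A] be the set where [f] is below [f']. If its complement were not in the dual filter,
    neither rank would increase on passing to [plus Y D A]; but there [f] has the smaller rank,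
    while the ranks modulo [D] agree. *)
Lemma dual_not_lt D f f' : proper_filter D -> f ∈ W -> f' ∈ W ->
  rk Y lam D f = rk Y lam D f' -> dual Y lam f D = dual Y lam f' D ->
  diff Y (lts Y f f') ∈ dual Y lam f D.
Proof.
  intros H Hf Hf' E E2. set (A := lts Y f f').
  assert (SA : subset A Y) by (intros s Hs; apply in_lts in Hs; tauto).
  assert (S : subset (diff Y A) Y) by (intros s Hs; apply in_diff in Hs; tauto).
  destruct (classic (diff Y A ∈ D)) as [K|N]; [now apply dual_sub; [apply H|]|].
  apply NNPP; intros N1. assert (N2 := N1). rewrite E2 in N2.
  rewrite dual_not_mem in N1, N2 by auto. rewrite diff_diff in N1, N2 by auto.
  assert (P := plus_proper_filter D A H N).
  assert (Q : forall g, g ∈ W -> ~ rk Y lam D g ∈ rk Y lam (plus Y D A) g ->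
    rk Y lam D g = rk Y lam (plus Y D A) g).
  { intros g Hg K. apply NNPP; intros NE; apply K, ord_subset_mem; try assumption; try (apply rk_ord; assumption).
    apply rk_mono; try assumption. apply plus_sub, H. }
  assert (L : rk Y lam (plus Y D A) f ∈ rk Y lam (plus Y D A) f').
  { apply rk_lt; auto. apply plus_mem; auto. apply H. }
  rewrite <- (Q f Hf N1), <- (Q f' Hf' N2), E in L. exact (mem_irrefl _ L).
Qed.

Lemma dual_eqs D f f' : proper_filter D -> f ∈ W -> f' ∈ W ->
  rk Y lam D f = rk Y lam D f' -> dual Y lam f D = dual Y lam f' D ->
  eqs Y f f' ∈ dual Y lam f D.
Proof.
  intros H Hf Hf' E E2.
  assert (K := dual_not_lt D f f' H Hf Hf' E E2).
  assert (L := dual_not_lt D f' f H Hf' Hf (eq_sym E) (eq_sym E2)). rewrite <- E2 in L.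
  apply (complete_filter_cap Y _ _ _ _ (proj1 (dual_proper_filter D f H Hf)) K L).
  - intros s Hs; apply in_eqs in Hs; tauto.
  - intros s A B. apply in_diff in A as [Hs A], B as [_ B].
    rewrite in_lts in A, B. apply in_eqs; split; auto.
    destruct (ord_total (app f s) (app f' s)) as [Q|[Q|Q]]; auto using W_ord; tauto.
Qed.
End Ranks.

Opaque rk.

(** * Hulls and towers of filters *)

Definition fld {M : model} (r : M) : M := cup (dom r) (ran r).

Definition cover {M : model} (r v : M) : M :=
  the (fun u => (u ∈ fld r /\ subset v u) /\
    forall u', u' ∈ fld r -> subset v u' -> u' = u \/ pair u u' ∈ r).

Definition cl {M : model} (r U : M) : M :=
  compr (fun x => exists v, subset v U /\ le_card v omega /\ x ∈ cover r v).

(* A small set that contains almost all values of [f] and depends on [f] only modulo [D]. *)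

Definition hull {M : model} (r f D : M) : M :=
  compr (fun x => forall Z, Z ∈ D -> x ∈ cl r (image (app f) Z)).

Definition core {M : model} (Y r f D : M) : M :=
  compr (fun s => s ∈ Y /\ app f s ∈ hull r f D).

Definition dcore {M : model} (Y lam r f D : M) : M := core Y r f (dual Y lam f D).

(** The complete filter generated by the complements of the earlier cores, as an intersection of
    complete filters. The improper filter counts as complete, so there is always some [E], and the
    result may be improper. The parameters come packed in [p], as [rec] demands. *)
Definition tower_step (N : model) (p s : N) : N :=
  compr (fun A => exists Y lam r f, p = pair (pair Y lam) (pair r f) /\ subset A Y /\
    forall E, complete_filter Y E ->
      (forall D, D ∈ s -> diff Y (dcore Y lam r f D) ∈ E) -> A ∈ E).

(** The length is a Hartogs number too large to embed into the set of all families of subsets of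
    [Y], so proper filters cannot keep increasing to the end. *)
Definition tower {M : model} (Y lam r f z : M) : M :=
  app (rec tower_step (pair (pair Y lam) (pair r f)) (hartogs (power (power Y)))
    (memrel (hartogs (power (power Y))))) z.

Definition height {M : model} (Y lam r f : M) : M :=
  the (fun z => z ∈ hartogs (power (power Y)) /\ empty ∈ tower Y lam r f z /\
    forall x, x ∈ z -> ~ empty ∈ tower Y lam r f x).

Definition trk {M : model} (Y lam r f z : M) : M := rk Y lam (tower Y lam r f z) f.

Definition captures {M : model} (Y lam r f v s z : M) : Prop :=
  z ∈ height Y lam r f /\ trk Y lam r f z ∈ v /\
  s ∈ dcore Y lam r f (tower Y lam r f z).

Definition good {M : model} (Y lam r f v : M) : Prop :=
  forall s, s ∈ Y -> exists z, captures Y lam r f v s z.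

(** [v] is required to be infinite because the covers are to be counted by [alpha-star]^aleph_0,
    whose members are infinite. *)
Definition good_covers {M : model} (Y lam r a f : M) : M :=
  compr (fun u => exists v, subset v a /\ le_card v omega /\ le_card omega v /\
    good Y lam r f v /\ u = cover r v).

Definition code_set {M : model} (Y lam r a f : M) : M :=
  the (fun u => u ∈ good_covers Y lam r a f /\
    forall u', u' ∈ good_covers Y lam r a f -> u' = u \/ pair u u' ∈ r).

(** Only stages whose rank lies in [code_set] compete, so that this rank can be recorded by its
    position there. *)
Definition stage {M : model} (Y lam r a f s : M) : M :=
  the (fun z => captures Y lam r f (code_set Y lam r a f) s z /\
    forall x, x ∈ z -> ~ captures Y lam r f (code_set Y lam r a f) s x).

Lemma t_fld r : dterm r -> dterm (fun M e => fld (r M e)).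
Proof. dunfold @fld. Qed.
#[local] Hint Resolve t_fld : defn.

Lemma t_cover r v : dterm r -> dterm v -> dterm (fun M e => cover (r M e) (v M e)).
Proof. dunfold @cover. Qed.
#[local] Hint Resolve t_cover : defn.

Lemma t_cl r v : dterm r -> dterm v -> dterm (fun M e => cl (r M e) (v M e)).
Proof. dunfold @cl. Qed.
#[local] Hint Resolve t_cl : defn.

Lemma t_hull r f D : dterm r -> dterm f -> dterm D ->
  dterm (fun M e => hull (r M e) (f M e) (D M e)).
Proof. dunfold @hull. Qed.
#[local] Hint Resolve t_hull : defn.

Lemma t_core Y r f D : dterm Y -> dterm r -> dterm f -> dterm D ->
  dterm (fun M e => core (Y M e) (r M e) (f M e) (D M e)).
Proof. dunfold @core. Qed.
#[local] Hint Resolve t_core : defn.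

Lemma t_dcore Y lam r f D : dterm Y -> dterm lam -> dterm r -> dterm f -> dterm D ->
  dterm (fun M e => dcore (Y M e) (lam M e) (r M e) (f M e) (D M e)).
Proof. dunfold @dcore. Qed.
#[local] Hint Resolve t_dcore : defn.

Lemma t_tower_step p s : dterm p -> dterm s -> dterm (fun M e => tower_step M (p M e) (s M e)).
Proof. dunfold tower_step. Qed.
#[local] Hint Resolve t_tower_step : defn.

Lemma t_tower Y lam r f z : dterm Y -> dterm lam -> dterm r -> dterm f -> dterm z ->
  dterm (fun M e => tower (Y M e) (lam M e) (r M e) (f M e) (z M e)).
Proof.
  intros; unfold tower; apply t_app; auto. apply t_rec; [exact t_tower_step|dsolve|dsolve|dsolve].
Qed.
#[local] Hint Resolve t_tower : defn.

Lemma t_height Y lam r f : dterm Y -> dterm lam -> dterm r -> dterm f ->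
  dterm (fun M e => height (Y M e) (lam M e) (r M e) (f M e)).
Proof. dunfold @height. Qed.

Lemma t_trk Y lam r f z : dterm Y -> dterm lam -> dterm r -> dterm f -> dterm z ->
  dterm (fun M e => trk (Y M e) (lam M e) (r M e) (f M e) (z M e)).
Proof. dunfold @trk. Qed.
#[local] Hint Resolve t_height t_trk : defn.

Lemma d_captures Y lam r f v s z :
  dterm Y -> dterm lam -> dterm r -> dterm f -> dterm v -> dterm s -> dterm z ->
  dprop (fun M e => captures (Y M e) (lam M e) (r M e) (f M e) (v M e) (s M e) (z M e)).
Proof. dunfold @captures. Qed.
#[local] Hint Resolve d_captures : defn.

Lemma d_good Y lam r f v : dterm Y -> dterm lam -> dterm r -> dterm f -> dterm v ->
  dprop (fun M e => good (Y M e) (lam M e) (r M e) (f M e) (v M e)).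
Proof. dunfold @good. Qed.
#[local] Hint Resolve d_good : defn.

Lemma t_good_covers Y lam r a f : dterm Y -> dterm lam -> dterm r -> dterm a -> dterm f ->
  dterm (fun M e => good_covers (Y M e) (lam M e) (r M e) (a M e) (f M e)).
Proof. dunfold @good_covers. Qed.
#[local] Hint Resolve t_good_covers : defn.

Lemma t_code_set Y lam r a f : dterm Y -> dterm lam -> dterm r -> dterm a -> dterm f ->
  dterm (fun M e => code_set (Y M e) (lam M e) (r M e) (a M e) (f M e)).
Proof. dunfold @code_set. Qed.
#[local] Hint Resolve t_code_set : defn.

Lemma t_stage Y lam r a f s :
  dterm Y -> dterm lam -> dterm r -> dterm a -> dterm f -> dterm s ->
  dterm (fun M e => stage (Y M e) (lam M e) (r M e) (a M e) (f M e) (s M e)).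
Proof. dunfold @stage. Qed.
#[local] Hint Resolve t_stage : defn.

Lemma in_fld {M : model} (r u : M) :
  u ∈ fld r <-> exists v, pair u v ∈ r \/ pair v u ∈ r.
Proof.
  unfold fld; rewrite in_cup, in_dom, in_ran. split.
  - intros [[v Hv]|[v Hv]]; eauto.
  - intros [v [Hv|Hv]]; eauto.
Qed.

(** * Closures under covers, hulls and cores *)

Section Hulls.
Context {M : model}.
Implicit Types a b c f g h k m n s t u v w x y z A B D E U Z : M.
Context (r mu Y lam : M).

(** What is used of a witness of Ax4 and its well ordering. The family is read off as the field of
    [r], since a defining formula has [r] but not the family as a parameter. *)
Definition covering : Prop :=
  ordinal mu /\ wo (fld r) r /\ (forall u, ~ pair u u ∈ r) /\
  (forall u, u ∈ fld r -> subset u mu) /\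
  (forall v, subset v mu -> le_card v omega -> exists u, u ∈ fld r /\ subset v u).

Context (Hr : covering) (Hlam : ordinal lam) (Hmu : subset lam mu).

Lemma fld_least T : subset T (fld r) -> T <> empty ->
  exists m, m ∈ T /\ forall x, x ∈ T -> x = m \/ pair m x ∈ r.
Proof.
  destruct Hr as (_ & (W & _ & C) & _). intros S N.
  destruct (W T S N) as (m & Hm & L). exists m; split; auto.
  intros x Hx. destruct (C x m (S x Hx) (S m Hm)) as [K|[K|K]]; auto.
  destruct (L x Hx K).
Qed.

Lemma r_asym u u' : u ∈ fld r -> u' ∈ fld r -> pair u u' ∈ r -> ~ pair u' u ∈ r.
Proof.
  destruct Hr as (_ & (_ & T & _) & I & _). intros Hu Hu' K L.
  exact (I u (T u u' u Hu Hu' Hu K L)).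
Qed.

Lemma cover_spec v : subset v mu -> le_card v omega ->
  cover r v ∈ fld r /\ subset v (cover r v) /\
  forall u', u' ∈ fld r -> subset v u' -> u' = cover r v \/ pair (cover r v) u' ∈ r.
Proof.
  intros Sv Cv. destruct Hr as (_ & _ & _ & _ & Hcov).
  assert (K : (cover r v ∈ fld r /\ subset v (cover r v)) /\
    forall u', u' ∈ fld r -> subset v u' -> u' = cover r v \/ pair (cover r v) u' ∈ r);
    [|tauto].
  apply (the_ex M (fun u => (u ∈ fld r /\ subset v u) /\
    forall u', u' ∈ fld r -> subset v u' -> u' = u \/ pair u u' ∈ r)).
  assert (HT : forall u, u ∈ compr (fun u => u ∈ fld r /\ subset v u) <-> u ∈ fld r /\ subset v u).
  { apply (in_compr _ (fld r)); [def|tauto]. }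
  destruct (Hcov v Sv Cv) as (u0 & Hu0 & S0).
  destruct (fld_least (compr (fun u => u ∈ fld r /\ subset v u))) as (m & Hm & L).
  - intros u Hu; apply HT in Hu; tauto.
  - apply (mem_nonempty _ u0), HT; auto.
  - apply HT in Hm. exists m; split.
    + split; auto. intros u A B; apply L, HT; auto.
    + intros u' [[A B] C].
      destruct (L u') as [E|E]; [now apply HT|auto|].
      destruct (C m) as [E'|E']; try tauto.
      destruct (r_asym m u'); tauto.
Qed.

(** Every set containing [v'] contains [v], so the search for a cover of [v] ends no later. *)
Lemma cover_mono v v' : subset v v' -> subset v' mu -> le_card v' omega ->
  cover r v' = cover r v \/ pair (cover r v) (cover r v') ∈ r.
Proof.
  intros S S' C'.
  assert (C : le_card v omega) by (apply (le_card_trans _ v'); auto using le_card_subset).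
  destruct (cover_spec v' S' C') as (A & B & _).
  destruct (cover_spec v) as (A' & B' & L); auto.
  - intros z Hz; auto.
  - apply L; auto. intros z Hz; auto.
Qed.

Lemma in_cl U x : subset U mu ->
  (x ∈ cl r U <-> exists v, subset v U /\ le_card v omega /\ x ∈ cover r v).
Proof.
  intros S. apply (in_compr (fun x => exists v, subset v U /\ le_card v omega /\ x ∈ cover r v) mu);
    [def|].
  intros y (v & Sv & Cv & Hy). assert (Sv' : subset v mu) by (intros z Hz; auto).
  destruct (cover_spec v Sv' Cv) as (A & _ & _).
  destruct Hr as (_ & _ & _ & Hs & _). exact (Hs _ A y Hy).
Qed.

Lemma cl_subset U : subset U mu -> subset (cl r U) mu.
Proof.
  intros S x Hx; apply in_cl in Hx as (v & Sv & Cv & Hx); auto.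
  assert (Sv' : subset v mu) by (intros z Hz; auto).
  destruct (cover_spec v Sv' Cv) as (A & _ & _).
  destruct Hr as (_ & _ & _ & Hs & _). exact (Hs _ A x Hx).
Qed.

Lemma cl_mono U U' : subset U' mu -> subset U U' -> subset (cl r U) (cl r U').
Proof.
  intros S' S x Hx; apply in_cl in Hx as (v & Sv & Cv & Hx); [|intros z Hz; auto].
  apply in_cl; auto. exists v; split; [intros z Hz; auto|auto].
Qed.

Lemma in_img f Z y : y ∈ image (app f) Z <-> exists s, s ∈ Z /\ y = app f s.
Proof. apply in_image; dfn. Qed.

Lemma img_subset f Z : f ∈ funs Y lam -> subset Z Y -> subset (image (app f) Z) mu.
Proof.
  intros Hf S y Hy; apply in_img in Hy as (s & Hs & ->). apply Hmu, (app_funs Y); auto.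
Qed.

Lemma img_mono f Z Z' : subset Z Z' -> subset (image (app f) Z) (image (app f) Z').
Proof. intros S y Hy; apply in_img in Hy as (s & Hs & ->); apply in_img; eauto. Qed.

Lemma in_hull f D x : f ∈ funs Y lam -> complete_filter Y D ->
  (x ∈ hull r f D <-> forall Z, Z ∈ D -> x ∈ cl r (image (app f) Z)).
Proof.
  intros Hf H. apply (in_compr (fun x => forall Z, Z ∈ D -> x ∈ cl r (image (app f) Z)) mu); [def|].
  intros y Hy. apply (cl_subset (image (app f) Y)); [apply img_subset; auto; intros z; auto|].
  apply Hy; now apply complete_filter_top.
Qed.

Lemma hull_subset f D : f ∈ funs Y lam -> complete_filter Y D ->
  subset (hull r f D) (cl r (image (app f) Y)).
Proof.
  intros Hf H x Hx; rewrite in_hull in Hx by auto; apply Hx. now apply complete_filter_top.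
Qed.

Lemma in_core f D s : s ∈ core Y r f D <-> s ∈ Y /\ app f s ∈ hull r f D.
Proof.
  apply (in_compr (fun s => s ∈ Y /\ app f s ∈ hull r f D) Y); [def|tauto].
Qed.

(* Otherwise a decreasing sequence [Z n] has values [x n] of [f] on [Z n]
   outside [cl (f [Z (n+1)])]; but the covers of the tails of [x] are
   [r]-decreasing, hence eventually constant. *)

Lemma closed_set_ex f D : f ∈ funs Y lam -> complete_filter Y D ->
  exists Z, Z ∈ D /\ forall Z', Z' ∈ D -> subset Z' Z ->
    subset (image (app f) Z) (cl r (image (app f) Z')).
Proof.
  intros Hf H. apply NNPP; intros N.
  destruct (dependent_choice D (fun Z Z' => subset Z' Z /\
    ~ subset (image (app f) Z) (cl r (image (app f) Z')))) as (F & HF & K).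
  - def.
  - exists Y; now apply complete_filter_top.
  - intros Z HZ; apply NNPP; intros N'; apply N; exists Z; split; auto.
    intros Z' HZ' S; apply NNPP; intros N2; apply N'; eauto.
  - assert (FD : forall n, n ∈ omega -> subset (app F n) Y).
    { intros n Hn; apply (complete_filter_sub Y D); auto. now apply (app_funs omega). }
    pose (P := fun n x => x ∈ image (app f) (app F n) /\ ~ x ∈ cl r (image (app f) (app F (succ n)))).
    assert (EP : forall n, n ∈ omega -> exists x, x ∈ mu /\ P n x).
    { intros n Hn; destruct (K n Hn) as [_ K']. apply NNPP; intros N'; apply K'.
      intros x Hx; apply NNPP; intros N2; apply N'; exists x; split; [|split; auto].
      now apply (img_subset f (app F n)); auto. }
    destruct (countable_choice mu P) as (X & HX & KX); [unfold P; def|auto|].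
    assert (FM : forall m, m ∈ omega -> forall n, n ∈ m -> subset (app F m) (app F n)).
    { apply (omega_ind (fun m => forall n, n ∈ m -> subset (app F m) (app F n))); [def| |].
      - intros n Hn; destruct (in_empty n Hn).
      - intros m Hm IH n Hn. destruct (K m Hm) as [S _].
        apply in_succ in Hn as [Hn| ->]; auto. intros z Hz; apply (IH n Hn); auto. }
    pose (v := fun n => image (app X) (diff omega n)).
    assert (Hv : forall n y, y ∈ v n <-> exists m, m ∈ diff omega n /\ y = app X m).
    { intros n y; apply in_image; dfn. }
    assert (Cv : forall n, le_card (v n) omega).
    { intros n; apply le_card_image; [dfn|]. apply le_card_subset.
      intros z Hz; apply in_diff in Hz; tauto. }
    assert (Sv : forall n, n ∈ omega -> subset (v n) (image (app f) (app F n))).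
    { intros n Hn y Hy; apply Hv in Hy as (m & Hm & ->). apply in_diff in Hm as [Hm Nm].
      destruct (KX m Hm) as [A _].
      destruct (ord_total n m) as [L|[->|L]]; auto using omega_mem_ord; [|tauto].
      revert A; apply img_mono, FM; auto. }
    assert (Sm : forall n, n ∈ omega -> subset (v n) mu).
    { intros n Hn y Hy. apply (img_subset f (app F n)); auto. now apply Sv. }
    assert (HT : forall u, u ∈ image (fun n => cover r (v n)) omega <->
      exists n, n ∈ omega /\ u = cover r (v n)).
    { intros u; apply in_image; unfold v; dfn. }
    destruct (fld_least (image (fun n => cover r (v n)) omega)) as (u & Hu & L).
    + intros u Hu; apply HT in Hu as (n & Hn & ->). apply cover_spec; auto.
    + apply (mem_nonempty _ (cover r (v empty))), HT.
      eauto using zero_omega.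
    + apply HT in Hu as (n & Hn & ->). assert (Hn' := succ_omega n Hn).
      assert (S1 : subset (v (succ n)) (v n)).
      { intros y Hy; apply Hv in Hy as (m & Hm & ->); apply Hv; exists m; split; auto.
        apply in_diff in Hm as [Hm Nm]; apply in_diff; split; auto.
        intros Q; apply Nm, in_succ; auto. }
      assert (E : cover r (v (succ n)) = cover r (v n)).
      { destruct (L (cover r (v (succ n)))) as [E|E]; [apply HT; eauto|auto|].
        destruct (cover_mono (v (succ n)) (v n)) as [E'|E']; auto.
        destruct (r_asym (cover r (v n)) (cover r (v (succ n)))); auto; apply cover_spec; auto. }
      destruct (KX n Hn) as [_ Q]; apply Q. apply in_cl.
      * apply img_subset; auto.
      * exists (v (succ n)); split; [now apply Sv|split; auto]. rewrite E.
        apply cover_spec; auto. apply Hv; exists n; split; auto.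
        apply in_diff; split; auto using mem_irrefl.
Qed.

(** Take [Z] from [closed_set_ex]. For every [Z'] in [D] the values on [Z] lie in the closure of the
    values on [cap Z Z']; so they lie in the hull, and the core contains [Z]. *)
Lemma core_mem f D : f ∈ funs Y lam -> complete_filter Y D -> core Y r f D ∈ D.
Proof.
  intros Hf H. destruct (closed_set_ex f D Hf H) as (Z & HZ & K).
  assert (SZ := complete_filter_sub Y D Z H HZ).
  apply (complete_filter_up Y D Z); auto.
  - intros s Hs; apply in_core; split; auto. apply in_hull; auto.
    intros Z' HZ'. assert (SZ' := complete_filter_sub Y D Z' H HZ').
    apply (cl_mono (image (app f) (cap Z Z'))).
    + now apply img_subset.
    + apply img_mono; intros z Hz; apply in_cap in Hz; tauto.
    + apply K.
      * apply (complete_filter_cap Y D Z Z'); auto.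
        -- intros z Hz; apply in_cap in Hz as [Hz _]; auto.
        -- intros z A B; apply in_cap; auto.
      * intros z Hz; apply in_cap in Hz; tauto.
      * apply in_img; eauto.
  - intros s Hs; apply in_core in Hs; tauto.
Qed.

(** Any [Z] in [D] may be cut down to the points where [f] and [f'] agree. *)
Lemma hull_eqs f f' D : f ∈ funs Y lam -> f' ∈ funs Y lam -> complete_filter Y D ->
  eqs Y f f' ∈ D -> subset (hull r f D) (hull r f' D).
Proof.
  intros Hf Hf' H E x Hx. rewrite in_hull in * by auto. intros Z HZ.
  assert (SZ := complete_filter_sub Y D Z H HZ).
  apply (cl_mono (image (app f) (cap Z (eqs Y f f')))).
  - now apply img_subset.
  - intros y Hy; apply in_img in Hy as (s & Hs & ->). apply in_cap in Hs as [A B].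
    apply in_eqs in B as [_ ->]. apply in_img; eauto.
  - apply Hx. apply (complete_filter_cap Y D _ _ _ H HZ E).
    + intros z Hz; apply in_cap in Hz as [Hz _]; auto.
    + intros z A B; apply in_cap; auto.
Qed.

Lemma hull_eq f f' D : f ∈ funs Y lam -> f' ∈ funs Y lam -> complete_filter Y D ->
  eqs Y f f' ∈ D -> hull r f D = hull r f' D.
Proof.
  intros Hf Hf' H E. apply ext_eq; intros x; split; apply hull_eqs; auto.
  assert (eqs Y f' f = eqs Y f f') as ->; auto.
  apply ext_eq; intros s; rewrite !in_eqs; split; intros [A B]; auto.
Qed.

Lemma funs_succ f : f ∈ funs Y lam -> f ∈ funs Y (succ lam).
Proof.
  intros Hf; assert (K := Hf); apply in_funs in K. apply in_funs.
  apply (maps_weaken _ _ _ _ K). intros x Hx; apply in_succ; left; now apply (app_funs Y).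
Qed.

Lemma in_dcore f D s :
  s ∈ dcore Y lam r f D <-> s ∈ Y /\ app f s ∈ hull r f (dual Y lam f D).
Proof. apply in_core. Qed.

Lemma dcore_mem f D : f ∈ funs Y lam -> proper_filter Y D ->
  dcore Y lam r f D ∈ dual Y lam f D.
Proof.
  intros Hf H. apply core_mem; auto. apply dual_proper_filter; auto. now apply funs_succ.
Qed.

(** The core belongs to the dual filter, which is proper and extends [D]. This is what makes the
    tower strictly increasing. *)
Lemma dcore_not_null f D : f ∈ funs Y lam -> proper_filter Y D ->
  ~ diff Y (dcore Y lam r f D) ∈ D.
Proof.
  intros Hf H K.
  destruct (dual_proper_filter Y lam Hlam D f H (funs_succ f Hf)) as [C P]. apply P.
  assert (K' := dual_sub Y lam D f (proj1 H) _ K).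
  apply (complete_filter_cap Y _ _ _ _ C K' (dcore_mem f D Hf H)).
  - intros z Hz; destruct (in_empty z Hz).
  - intros s A B; apply in_diff in A; tauto.
Qed.
End Hulls.

Opaque fld cover cl hull core dcore.

(** * The tower of filters and the canonical set of ranks *)

Section Towers.
Context {M : model}.
Implicit Types a b c f g h k m n s t u v w x y z A B D E U Z : M.
Context (r mu Y lam : M).
Context (Hr : covering r mu) (Hlam : ordinal lam) (Hmu : subset lam mu).
Context (f : M) (Hf : f ∈ funs Y lam).

Let th : M := hartogs (power (power Y)).
Let T z := tower Y lam r f z.
Let K z := dcore Y lam r f (T z).

Lemma in_tower z A : z ∈ th -> (A ∈ T z <-> subset A Y /\
  forall E, complete_filter Y E -> (forall x, x ∈ z -> diff Y (K x) ∈ E) -> A ∈ E).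
Proof.
  intros Hz.
  assert (W : wf th (memrel th)) by (apply memrel_wo; intros x; apply ord_in, hartogs_ord).
  assert (E0 := proj2 (rec_spec tower_step t_tower_step (pair (pair Y lam) (pair r f)) th _ W) z Hz).
  change (app (rec tower_step (pair (pair Y lam) (pair r f)) th (memrel th)) z) with (T z) in E0.
  assert (HI : forall D, D ∈ image (app (rec tower_step (pair (pair Y lam) (pair r f)) th (memrel th)))
    (pred th (memrel th) z) <-> exists x, x ∈ z /\ D = T x).
  { intros D. rewrite in_image.
    - split; intros (x & Hx & ->); exists x; split; auto.
      + apply in_pred in Hx as [_ Hx]; apply in_memrel in Hx; tauto.
      + assert (x ∈ th) by (apply (ord_trans th z); auto; apply hartogs_ord).
        apply in_pred; split; auto. apply in_memrel; auto.
    - generalize (rec tower_step (pair (pair Y lam) (pair r f)) th (memrel th)). intros F; dfn. }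
  assert (HS : forall s, A ∈ tower_step M (pair (pair Y lam) (pair r f)) s <->
    subset A Y /\ forall E, complete_filter Y E ->
      (forall D, D ∈ s -> diff Y (dcore Y lam r f D) ∈ E) -> A ∈ E).
  { intros s. unfold tower_step.
    rewrite (in_compr _ (power Y)).
    - split.
      + intros (Y' & lam' & r' & f' & E & S). apply pair_inj in E as [E E'].
        apply pair_inj in E as [-> ->], E' as [-> ->]; auto.
      + intros S; exists Y, lam, r, f; auto.
    - def.
    - intros A' (Y' & lam' & r' & f' & E & S & _). apply pair_inj in E as [E _].
      apply pair_inj in E as [-> _]; now apply in_power. }
  clearbody T. rewrite E0, HS. split; intros [S Q]; (split; [exact S|]); intros E HE L; apply Q; try assumption.
  - intros D HD; apply HI in HD as (x & Hx & ->). exact (L x Hx).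
  - intros x Hx. apply (L (T x)), HI. exists x; auto.
Qed.

Opaque tower.

Lemma tower_complete z : z ∈ th -> complete_filter Y (T z).
Proof.
  intros Hz; split; [|split; [|split]].
  - intros A HA; apply in_tower in HA; tauto.
  - apply in_tower; auto; split; [intros s; auto|]. intros E HE _; now apply complete_filter_top.
  - intros A B HA S S'; apply in_tower in HA as [_ HA]; auto.
    apply in_tower; auto; split; auto. intros E HE L.
    apply (complete_filter_up Y E A); auto.
  - intros c Hc. apply in_tower; auto; split; [intros s Hs; apply in_cint in Hs; tauto|].
    intros E HE L. apply HE. apply in_funs in Hc; apply in_funs. apply (maps_weaken _ _ _ _ Hc).
    intros n Hn. assert (Q := proj1 (maps_app _ _ _ _ Hc Hn)). apply in_tower in Q as [_ Q]; auto.
    now apply Q.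
Qed.

Lemma tower_mem z x : z ∈ th -> x ∈ z -> diff Y (K x) ∈ T z.
Proof.
  intros Hz Hx; apply in_tower; auto; split; auto.
  intros s Hs; apply in_diff in Hs; tauto.
Qed.

(** If all stages were proper, the complement of the core of [T x] would belong to every later stage
    but not to [T x]; so [T] would embed the Hartogs number of [power (power Y)] into that set. *)
Lemma tower_collapses : exists z, z ∈ th /\ empty ∈ T z.
Proof.
  apply NNPP; intros N.
  assert (P : forall z, z ∈ th -> proper_filter Y (T z)).
  { intros z Hz; split; [now apply tower_complete|]. intros Q; apply N; eauto. }
  apply (hartogs_not_surj (power (power Y))), (surj_of_le_card _ _ empty).
  - apply empty_in_hartogs.
  - apply (le_card_fn T); [unfold T; dfn| |].
    + intros z Hz; apply in_power; intros A HA; apply in_power.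
      apply in_tower in HA; tauto.
    + assert (L : forall x z, z ∈ th -> x ∈ z -> T x <> T z).
      { intros x z Hz Hx E. assert (Hx' : x ∈ th) by (apply (ord_trans th z); auto; apply hartogs_ord).
        apply (dcore_not_null r mu Y lam Hr Hlam Hmu f (T x) Hf (P x Hx')).
        rewrite E at 2. now apply tower_mem. }
      intros x z Hx Hz E.
      destruct (ord_total x z) as [Q|[Q|Q]]; auto; try (apply (ord_in th); auto; apply hartogs_ord).
      * destruct (L x z Hz Q E).
      * destruct (L z x Hx Q (eq_sym E)).
Qed.

Let eps := height Y lam r f.

Lemma height_spec : eps ∈ th /\ empty ∈ T eps /\ forall x, x ∈ eps -> ~ empty ∈ T x.
Proof.
  apply (the_ex M (fun z => z ∈ th /\ empty ∈ T z /\ forall x, x ∈ z -> ~ empty ∈ T x)).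
  destruct tower_collapses as (z & Hz & Ez). assert (Oth : ordinal th) by apply hartogs_ord.
  destruct (ord_least (fun z => z ∈ th /\ empty ∈ T z) ltac:(unfold T, th; def) z)
    as (y & Oy & [Hy Ey] & L); auto; [now apply (ord_in th)|].
  assert (L' : forall x, x ∈ y -> ~ empty ∈ T x).
  { intros x Hx Q; apply (L x Hx); split; auto. now apply (ord_trans th y). }
  exists y; split; auto. intros z' (Hz' & Ez' & L2).
  destruct (ord_total y z') as [Q|[Q|Q]]; auto; [now apply (ord_in th)| |].
  - destruct (L2 y Q Ey).
  - destruct (L' z' Q Ez').
Qed.

Lemma height_th x : x ∈ eps -> x ∈ th.
Proof.
  intros Hx; apply (ord_trans th eps); auto; [apply hartogs_ord|apply height_spec].
Qed.

Lemma height_ord : ordinal eps.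
Proof. apply (ord_in th); [apply hartogs_ord|apply height_spec]. Qed.

Lemma tower_proper x : x ∈ eps -> proper_filter Y (T x).
Proof.
  intros Hx; split; [apply tower_complete; now apply height_th|now apply height_spec].
Qed.

Context (a : M) (Sa : subset omega a).
Context (Hrk : forall D, proper_filter Y D -> rk Y lam D f ∈ a).

Let P e A := exists z, z ∈ eps /\ (exists n, n ∈ omega /\ app e n = trk Y lam r f z) /\ A ∈ K z.

(** The sets whose complement is captured by countably many ranks form a complete filter [E]. It
    contains every generator of the tower, a single rank being enough, hence also the improper
    filter at the height. So the empty set is in [E], and its complement is [Y]. *)
Lemma countable_cover_ex : exists e, e ∈ funs omega a /\ forall s, s ∈ Y -> P e s.
Proof.
  pose (E := compr (fun A => subset A Y /\ exists e, e ∈ funs omega a /\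
    forall s, s ∈ Y -> ~ s ∈ A -> P e s)).
  assert (HE : forall A, A ∈ E <-> subset A Y /\ exists e, e ∈ funs omega a /\
    forall s, s ∈ Y -> ~ s ∈ A -> P e s).
  { apply (in_compr _ (power Y)); [unfold P, K, T, eps; def|].
    intros A [S _]; now apply in_power. }
  clearbody E.
  assert (CE : complete_filter Y E).
  { split; [|split; [|split]].
    - intros A HA; apply HE in HA; tauto.
    (* No point has to be captured here; the identity is just some sequence in [a], which contains
       omega. *)
    - apply HE; split; [intros s; auto|]. exists (fn omega (fun n => n)); split; [|tauto].
      apply funs_fn; [dfn|auto].
    - intros A B HA S S'; apply HE in HA as [_ (e & He & L)]; apply HE; split; auto.
      exists e; split; auto.
    - intros c Hc.
      destruct (countable_choice (funs omega a) (fun n e => e ∈ funs omega a /\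
        forall s, s ∈ Y -> ~ s ∈ app c n -> P e s)) as (d & Hd & L).
      + unfold P, K, T, eps; def.
      + intros n Hn. assert (Q := app_funs _ _ _ _ Hc Hn). apply HE in Q as [_ (e & He & L)]; eauto.
      (* The chosen sequences are merged into one along an enumeration [p] of the pairs of
         integers. *)
      + destruct (surj_of_le_card (times omega (omega : M)) omega (pair empty empty)) as (p & Hp & Sp).
        { apply pair_in_times; auto using zero_omega. }
        { apply le_card_omega_times. }
        pose (e := fun k => the (fun y => exists n m, app p k = pair n m /\ y = app (app d n) m)).
        assert (De : dfun M e) by (unfold e; dfn).
        assert (Ve : forall k n m, app p k = pair n m -> e k = app (app d n) m).
        { intros k n m E1; apply the_eq; [eauto|]. intros y (n' & m' & E2 & ->).
          rewrite E1 in E2; apply pair_inj in E2 as [-> ->]; auto. }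
        apply HE; split; [intros s Hs; apply in_cint in Hs; tauto|].
        exists (fn omega e); split.
        * apply funs_fn; auto. intros k Hk.
          assert (Q := app_funs _ _ _ _ Hp Hk). apply in_times in Q as (n & m & Hn & Hm & Q).
          rewrite (Ve k n m Q). apply (app_funs omega); auto. now apply (app_funs omega).
        * intros s Hs Ns.
          assert (Q : exists n, n ∈ omega /\ ~ s ∈ app c n).
          { apply NNPP; intros N; apply Ns, in_cint; split; auto.
            intros n Hn; apply NNPP; intros N'; eauto. }
          destruct Q as (n & Hn & N).
          destruct (proj2 (L n Hn) s Hs N) as (z & Hz & (m & Hm & Em) & Kz).
          destruct (Sp (pair n m)) as (k & Hk & Ek); [apply pair_in_times; auto|].
          exists z; split; auto; split; auto. exists k; split; auto.
          now rewrite app_fn, (Ve k n m). }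
  assert (ME : forall x, x ∈ eps -> diff Y (K x) ∈ E).
  { intros x Hx. apply HE; split; [intros s Hs; apply in_diff in Hs; tauto|].
    exists (fn omega (fun _ => trk Y lam r f x)).
    assert (Dc : dfun M (fun _ => trk Y lam r f x)) by dfn. split.
    - apply funs_fn; auto. intros n Hn; apply Hrk; now apply tower_proper.
    - intros s Hs N; exists x; split; auto; split.
      + exists empty; split; [apply zero_omega|]. rewrite app_fn; auto. apply zero_omega.
      + apply NNPP; intros N'; apply N, in_diff; auto. }
  destruct height_spec as (A & B & _). apply in_tower in B as [_ B]; auto.
  destruct (proj1 (HE empty) (B E CE ME)) as [_ (e & He & L)].
  exists e; split; auto. intros s Hs; apply L; auto. apply in_empty.
Qed.
Context (Sam : subset a mu).

Lemma good_mono v v' : subset v v' -> good Y lam r f v -> good Y lam r f v'.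
Proof.
  intros S H s Hs; destruct (H s Hs) as (z & A & B & C); exists z; split; auto.
Qed.

Lemma in_good_covers u : u ∈ good_covers Y lam r a f <-> exists v, subset v a /\
  le_card v omega /\ le_card omega v /\ good Y lam r f v /\ u = cover r v.
Proof.
  apply (in_compr (fun u => exists v, subset v a /\ le_card v omega /\ le_card omega v /\
    good Y lam r f v /\ u = cover r v) (fld r)); [def|].
  intros u' (v & S & C & _ & _ & ->). apply (cover_spec r mu Hr v); auto.
  intros z Hz; auto.
Qed.

Let U := code_set Y lam r a f.

Lemma code_set_spec : U ∈ good_covers Y lam r a f.
Proof.
  apply (the_ex M (fun u => u ∈ good_covers Y lam r a f /\
    forall u', u' ∈ good_covers Y lam r a f -> u' = u \/ pair u u' ∈ r)).
  assert (S : subset (good_covers Y lam r a f) (fld r)).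
  { intros u Hu; apply in_good_covers in Hu as (v & S & C & _ & _ & ->).
    apply (cover_spec r mu Hr v); auto. intros z Hz; auto. }
  destruct (fld_least r mu Hr (good_covers Y lam r a f) S) as (m & Hm & L).
  - destruct countable_cover_ex as (e & He & L).
    assert (HI : forall y, y ∈ image (app e) omega <-> exists n, n ∈ omega /\ y = app e n)
      by (intros; apply in_image; dfn).
    (* Adding omega makes [v] infinite, whatever the range of [e] is. *)
    pose (v := cup omega (image (app e) omega)).
    apply (mem_nonempty _ (cover r v)), in_good_covers.
    exists v; split; [|split; [|split; [|split; auto]]].
    + intros z Hz; apply in_cup in Hz as [Hz|Hz]; auto.
      apply HI in Hz as (n & Hn & ->). now apply (app_funs omega).
    (* A union of two countable sets is contained in the image of a set of pairs whose first entry
       selects one of the two. *)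
    + apply (le_card_trans _ (image (fun p => the (fun y => exists i n, p = pair i n /\
        (i = empty /\ y = n \/ i <> empty /\ y = app e n))) (times omega omega))).
      * apply le_card_subset; intros z Hz; apply in_image; [dfn|].
        apply in_cup in Hz as [Hz|Hz].
        -- exists (pair empty z); split; [apply pair_in_times; auto using zero_omega|].
           symmetry; apply the_eq; [exists empty, z; auto|].
           intros y (i & n & E & Q); apply pair_inj in E as [<- <-]; tauto.
        -- apply HI in Hz as (n & Hn & ->).
           exists (pair (succ empty) n); split;
             [apply pair_in_times; auto using zero_omega, succ_omega|].
           symmetry; apply the_eq.
           ++ exists (succ empty), n; split; auto. right; split; auto. apply succ_neq_empty.
           ++ intros y (i & n' & E & Q); apply pair_inj in E as [<- <-].
              destruct Q as [[Q _]|[_ Q]]; auto. destruct (succ_neq_empty _ Q).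
      * apply le_card_image; [dfn|apply le_card_omega_times].
    + apply le_card_subset; intros z Hz; apply in_cup; auto.
    + intros s Hs. destruct (L s Hs) as (z & Hz & (n & Hn & En) & Kz).
      exists z; split; auto; split; auto. apply in_cup; right; apply HI; eauto.
  - exists m; split; auto. intros u [Hu Lu].
    destruct (L u Hu) as [E|E]; auto. destruct (Lu m Hm) as [E'|E']; auto.
    destruct (r_asym r mu Hr m u); auto.
Qed.

Lemma code_set_good : good Y lam r f U.
Proof.
  assert (H := code_set_spec). apply in_good_covers in H as (v & S & C & _ & G & ->).
  apply (good_mono v); auto. apply (cover_spec r mu Hr v); auto. intros z Hz; auto.
Qed.

Lemma code_set_fld : U ∈ fld r.
Proof.
  assert (H := code_set_spec). apply in_good_covers in H as (v & S & C & _ & _ & ->).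
  apply (cover_spec r mu Hr v); auto. intros z Hz; auto.
Qed.

Lemma stage_spec s : s ∈ Y -> captures Y lam r f U s (stage Y lam r a f s).
Proof.
  intros Hs.
  assert (Q : captures Y lam r f U s (stage Y lam r a f s) /\
    forall x, x ∈ stage Y lam r a f s -> ~ captures Y lam r f U s x); [|tauto].
  apply (the_ex M (fun z => captures Y lam r f U s z /\
    forall x, x ∈ z -> ~ captures Y lam r f U s x)).
  destruct (code_set_good s Hs) as (z & Hz).
  destruct (ord_least (fun z => captures Y lam r f U s z) ltac:(unfold U; def) z)
    as (y & Oy & Cy & L); auto.
  { apply (ord_in eps); [apply height_ord|apply Hz]. }
  exists y; split; auto. intros z' [Cz' L'].
  destruct (ord_total y z') as [Q|[Q|Q]]; auto.
  - apply (ord_in eps); [apply height_ord|apply Cz'].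
  - destruct (L' y Q Cy).
  - destruct (L z' Q Cz').
Qed.
End Towers.
Opaque tower height good_covers code_set stage trk.

(** * The ordinal alpha-star *)

Definition const_fn {M : model} (Y x : M) : M := fn Y (fun _ => x).

Definition rank_bound {M : model} (Y lam : M) : M :=
  bigU (image (fun D => rk Y lam D (const_fn Y lam)) (compr (fun D => proper_filter Y D))).

Lemma d_proper_filter Y D : dterm Y -> dterm D ->
  dprop (fun M e => proper_filter (Y M e) (D M e)).
Proof. dunfold @proper_filter. Qed.

Lemma t_const_fn Y x : dterm Y -> dterm x -> dterm (fun M e => const_fn (Y M e) (x M e)).
Proof. dunfold @const_fn. Qed.
#[local] Hint Resolve d_proper_filter t_const_fn : defn.

Lemma t_rank_bound Y lam : dterm Y -> dterm lam ->
  dterm (fun M e => rank_bound (Y M e) (lam M e)).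
Proof. dunfold @rank_bound. Qed.
#[local] Hint Resolve t_rank_bound : defn.

Section RankBound.
Context {M : model}.
Implicit Types a b c f g h k m n s t u v w x y z A B D E Z : M.
Context (Y lam : M) (Hlam : ordinal lam) (w1_ex : exists w1 : M, is_aleph1 w1).

Let W : M := funs Y (succ lam).

Lemma Fil1_iff D : Fil1 Y D <-> proper_filter Y D.
Proof.
  unfold Fil1, proper_filter. rewrite complete_filter_iff, proper_iff by exact w1_ex. tauto.
Qed.

Lemma lt_mod_iff D g h (B C : class M) : maps g (ext Y) B -> maps h (ext Y) C ->
  (lt_mod Y D g h <-> lts Y g h ∈ D).
Proof.
  intros Hg Hh.
  assert (E : forall s, (s ∈ Y /\ exists b a, rel g s b /\ rel h s a /\ b ∈ a) <-> s ∈ lts Y g h).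
  { intros s; rewrite in_lts; split.
    - intros [Hs (b & a & K & L & Q)]; split; auto.
      apply (app_rel _ _ _ _ _ Hg) in K as [_ ->].
      apply (app_rel _ _ _ _ _ Hh) in L as [_ ->]; auto.
    - intros [Hs Q]; split; auto. exists (app g s), (app h s); split; [|split; auto].
      + now apply (app_rel _ _ _ _ _ Hg).
      + now apply (app_rel _ _ _ _ _ Hh). }
  unfold lt_mod; split.
  - intros (A & HA & K). assert (A = lts Y g h) as <-; auto.
    apply ext_eq; intros s; rewrite K; apply E.
  - intros K; exists (lts Y g h); split; auto. intros s; rewrite E; tauto.
Qed.

Lemma eq_mod_iff D g h (B C : class M) : maps g (ext Y) B -> maps h (ext Y) C ->
  (eq_mod Y D g h <-> eqs Y g h ∈ D).
Proof.
  intros Hg Hh.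
  assert (E : forall s, (s ∈ Y /\ exists a, rel g s a /\ rel h s a) <-> s ∈ eqs Y g h).
  { intros s; rewrite in_eqs; split.
    - intros [Hs (a & K & L)]; split; auto.
      apply (app_rel _ _ _ _ _ Hg) in K as [_ ->].
      apply (app_rel _ _ _ _ _ Hh) in L as [_ ->]; auto.
    - intros [Hs Q]; split; auto. exists (app g s); split.
      + now apply (app_rel _ _ _ _ _ Hg).
      + now apply (app_rel _ _ _ _ _ Hh). }
  unfold eq_mod; split.
  - intros (A & HA & K). assert (A = eqs Y g h) as <-; auto.
    apply ext_eq; intros s; rewrite K; apply E.
  - intros K; exists (eqs Y g h); split; auto. intros s; rewrite E; tauto.
Qed.

Lemma W_ord_functions h : h ∈ W -> ord_functions Y h.
Proof.
  intros Hh; assert (K := Hh); apply in_funs in K. apply (maps_weaken _ _ _ _ K).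
  intros s Hs; now apply (W_ord Y lam Hlam).
Qed.

(** Where [g] is not below [h] it is replaced by [h]. This keeps the values in [succ lam] and
    changes [g] only off a set in [D]. *)
Lemma W_represents D g h : complete_filter Y D -> h ∈ W -> ord_functions Y g ->
  lts Y g h ∈ D -> exists g', g' ∈ W /\ eqs Y g' g ∈ D.
Proof.
  intros H Hh Hg L.
  pose (F := fun s => the (fun v => (app g s ∈ app h s /\ v = app g s) \/
    (~ app g s ∈ app h s /\ v = app h s))).
  assert (DF : dfun M F) by (unfold F; dfn).
  assert (F1 : forall s, app g s ∈ app h s -> F s = app g s) by (intros; apply the_case; auto).
  assert (F2 : forall s, ~ app g s ∈ app h s -> F s = app h s) by (intros; apply the_case'; auto).
  exists (fn Y F); split.
  - apply funs_fn; auto. intros s Hs. destruct (classic (app g s ∈ app h s)) as [K|K].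
    + rewrite F1 by auto. apply (ord_trans _ (app h s)); auto using ord_succ.
      now apply (app_funs Y).
    + rewrite F2 by auto. now apply (app_funs Y).
  - apply (complete_filter_up Y D _ _ H L).
    + intros s Hs; apply in_lts in Hs as [Hs K]; apply in_eqs; split; auto.
      rewrite app_fn by auto. now apply F1.
    + intros s Hs; apply in_eqs in Hs; tauto.
Qed.

Lemma is_rk_rk D f : proper_filter Y D -> f ∈ W -> is_rk Y D f (rk Y lam D f).
Proof.
  intros H Hf.
  assert (Dr : dfun M (rk Y lam D)) by dfn.
  assert (Hrho : maps (fn W (rk Y lam D)) (ext W) ordinal).
  { apply fn_maps; auto. intros h Hh; now apply rk_ord. }
  assert (Er : forall h a, rel (fn W (rk Y lam D)) h a <-> h ∈ W /\ a = rk Y lam D h).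
  { intros h a; rewrite (app_rel _ _ _ _ _ Hrho). split; intros [K ->]; split; auto;
      rewrite app_fn; auto. }
  exists W, (fn W (rk Y lam D)); split; [exact W_ord_functions|split; [|split; [auto|split; [|split; [auto|now apply Er]]]]].
  - intros h g Hh Hg L. apply (lt_mod_iff _ _ _ _ _ Hg (W_ord_functions h Hh)) in L.
    destruct (W_represents D g h (proj1 H) Hh Hg L) as (g' & Hg' & E). exists g'; split; auto.
    now apply (eq_mod_iff _ _ _ _ _ (W_ord_functions g' Hg') Hg).
  - intros h a Hh Ha. apply Er in Ha as [_ ->].
    split; [now apply rk_ord|split].
    + intros c (g & b & Hg & L & Hb & Hc). apply Er in Hb as [_ ->]. apply is_succ_iff in Hc as ->.
      apply (lt_mod_iff _ _ _ _ _ (W_ord_functions g Hg) (W_ord_functions h Hh)) in L.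
      assert (K := rk_lt Y lam Hlam D g h H Hg Hh L).
      apply ord_subset_iff; [apply ord_succ; now apply rk_ord|now apply rk_ord|].
      intros z Hz; apply in_succ in Hz as [Hz| ->]; auto.
      apply (ord_trans _ (rk Y lam D g)); auto. now apply rk_ord.
    + intros b Ob Hb. apply ord_subset_iff; auto; [now apply rk_ord|].
      intros z Hz; apply in_rk in Hz as (g & Hg & L & <-); auto.
      assert (K : ord_le (succ (rk Y lam D g)) b).
      { apply Hb. exists g, (rk Y lam D g); split; [auto|split; [|split]].
        - now apply (lt_mod_iff _ _ _ _ _ (W_ord_functions g Hg) (W_ord_functions h Hh)).
        - now apply Er.
        - now apply is_succ_iff. }
      apply ord_subset_iff in K; auto; [|apply ord_succ; now apply rk_ord].
      apply K, mem_succ.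
Qed.

(** The witness [V] of [is_rk] may differ from [W], so ranks are compared for functions equal modulo
    [D], by induction along the order on [W]. Each inequality uses that one of the two sets
    represents, modulo [D], the relevant functions of the other. *)
Lemma is_rk_unique D f alpha : proper_filter Y D -> f ∈ W -> is_rk Y D f alpha ->
  alpha = rk Y lam D f.
Proof.
  intros H Hf (V & rho & HV & Hrep & Hrho & Hsup & HfV & Hal).
  apply (app_rel _ _ _ _ _ Hrho) in Hal as [_ ->].
  assert (CF := proj1 H).
  assert (LT : forall g h, g ∈ V -> h ∈ V -> (lt_mod Y D g h <-> lts Y g h ∈ D)).
  { intros g h Hg Hh; apply (lt_mod_iff D g h ordinal ordinal); now apply HV. }
  assert (Q : forall h, h ∈ W -> forall h', h' ∈ V -> eqs Y h' h ∈ D -> app rho h' = rk Y lam D h).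
  { apply (wf_ind (fun h => forall h', h' ∈ V -> eqs Y h' h ∈ D -> app rho h' = rk Y lam D h) W
      (graph W W (fun g h => lts Y g h ∈ D))); [def|now apply R_wf; auto; apply H|].
    intros h Hh IH h' Hh' E.
    assert (IH' : forall g, g ∈ W -> lts Y g h ∈ D -> forall g', g' ∈ V -> eqs Y g' g ∈ D ->
      app rho g' = rk Y lam D g).
    { intros g Hg L; apply IH; auto. apply (in_graph (fun g h => lts Y g h ∈ D)); [def|auto]. }
    clear IH.
    assert (S := Hsup h' (app rho h') Hh' ltac:(apply (app_rel _ _ _ _ _ Hrho); auto)).
    destruct S as (O1 & Ub & Lst). assert (O2 := rk_ord Y lam D h H Hh).
    assert (A : ord_le (app rho h') (rk Y lam D h)).
    { apply Lst; auto. intros c (g & b & Hg & L & Hb & Hc).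
      apply is_succ_iff in Hc as ->. apply (app_rel _ _ _ _ _ Hrho) in Hb as [_ ->].
      apply LT in L; auto.
      assert (L' : lts Y g h ∈ D).
      { apply (complete_filter_cap Y D _ _ _ CF L E).
        - intros s Hs; apply in_lts in Hs; tauto.
        - intros s A B; apply in_lts in A as [Hs A]; apply in_eqs in B as [_ B].
          apply in_lts; split; auto. now rewrite <- B. }
      destruct (W_represents D g h CF Hh (HV g Hg) L') as (g1 & Hg1 & E1).
      assert (E2 : eqs Y g g1 ∈ D).
      { apply (complete_filter_up Y D _ _ CF E1); intros s Hs; apply in_eqs in Hs as [Hs Q];
          [apply in_eqs; auto|auto]. }
      assert (L1 : lts Y g1 h ∈ D).
      { apply (complete_filter_cap Y D _ _ _ CF L' E1).
        - intros s Hs; apply in_lts in Hs; tauto.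
        - intros s A B; apply in_lts in A as [Hs A]; apply in_eqs in B as [_ B].
          apply in_lts; split; auto. now rewrite B. }
      rewrite (IH' g1 Hg1 L1 g Hg E2).
      assert (K := rk_lt Y lam Hlam D g1 h H Hg1 Hh L1).
      apply ord_subset_iff; auto; [apply ord_succ; now apply rk_ord|].
      intros z Hz; apply in_succ in Hz as [Hz| ->]; auto.
      now apply (ord_trans _ (rk Y lam D g1)). }
    assert (B : subset (rk Y lam D h) (app rho h')).
    { intros z Hz; apply in_rk in Hz as (g & Hg & L & <-); auto.
      assert (L' : lts Y g h' ∈ D).
      { apply (complete_filter_cap Y D _ _ _ CF L E).
        - intros s Hs; apply in_lts in Hs; tauto.
        - intros s A' B; apply in_lts in A' as [Hs A']; apply in_eqs in B as [_ B].
          apply in_lts; split; auto. now rewrite B. }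
      destruct (Hrep h' g Hh' (W_ord_functions g Hg)) as (g' & Hg' & E').
      { apply (lt_mod_iff D g h' ordinal ordinal); auto. now apply W_ord_functions. now apply HV. }
      apply (eq_mod_iff D g' g ordinal ordinal) in E'; [|now apply HV|now apply W_ord_functions].
      rewrite <- (IH' g Hg L g' Hg' E').
      assert (K : ord_le (succ (app rho g')) (app rho h')).
      { apply Ub. exists g', (app rho g'); split; [auto|split; [|split]].
        - apply LT; auto. apply (complete_filter_cap Y D _ _ _ CF L' E').
          + intros s Hs; apply in_lts in Hs; tauto.
          + intros s A' B; apply in_lts in A' as [Hs A']; apply in_eqs in B as [_ B].
            apply in_lts; split; auto. now rewrite B.
        - apply (app_rel _ _ _ _ _ Hrho); auto.
        - now apply is_succ_iff. }
      assert (O3 : ordinal (app rho g')) by (apply (maps_app _ _ _ _ Hrho); auto).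
      apply ord_subset_iff in K; auto using ord_succ. apply K, mem_succ. }
    destruct A as [A|A]; auto. destruct (mem_irrefl _ (B _ A)). }
  apply Q; auto.
  apply (complete_filter_up Y D Y); auto using complete_filter_top.
  - intros s Hs; apply in_eqs; auto.
  - intros s Hs; apply in_eqs in Hs; tauto.
Qed.

Lemma app_const_fn x s : s ∈ Y -> app (const_fn Y x) s = x.
Proof. apply (app_fn (fun _ => x)). dfn. Qed.

Lemma const_fn_W x : x ∈ succ lam -> const_fn Y x ∈ W.
Proof. intros Hx; apply funs_fn; [dfn|auto]. Qed.

Lemma is_rk_const_iff D alpha : proper_filter Y D ->
  (is_rk_const Y D lam alpha <-> alpha = rk Y lam D (const_fn Y lam)).
Proof.
  intros H.
  assert (E : forall f, (forall p, p ∈ f <-> exists s, s ∈ Y /\ is_pair p s lam) <-> f = const_fn Y lam).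
  { assert (Q : forall p, p ∈ const_fn Y lam <-> exists s, s ∈ Y /\ is_pair p s lam).
    { intros p; unfold const_fn; rewrite in_fn by dfn. split; intros (s & Hs & K); exists s;
        rewrite is_pair_iff in *; auto. }
    intros f; split; [|intros ->; exact Q].
    intros K; apply ext_eq; intros p; rewrite K, Q; tauto. }
  assert (Hc : const_fn Y lam ∈ W) by apply const_fn_W, mem_succ.
  split.
  - intros (f & Hf & K); apply E in Hf as ->. now apply is_rk_unique.
  - intros ->; exists (const_fn Y lam); split; [now apply E|now apply is_rk_rk].
Qed.

Lemma in_rank_bound z : z ∈ rank_bound Y lam <->
  exists D, proper_filter Y D /\ z ∈ rk Y lam D (const_fn Y lam).
Proof.
  assert (HF : forall D, D ∈ compr (fun D => proper_filter Y D) <-> proper_filter Y D).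
  { apply (in_compr _ (power (power Y))); [def|].
    intros D H; apply in_power; intros A HA; apply in_power. now apply (complete_filter_sub Y D); [apply H|]. }
  assert (HI : forall a, a ∈ image (fun D => rk Y lam D (const_fn Y lam)) (compr (fun D => proper_filter Y D))
    <-> exists D, proper_filter Y D /\ a = rk Y lam D (const_fn Y lam)).
  { intros a; rewrite in_image by dfn. split; intros (D & A & B); exists D; split; auto; now apply HF. }
  unfold rank_bound; rewrite in_bigU. split.
  - intros (a & Ha & Hz); apply HI in Ha as (D & HD & ->); eauto.
  - intros (D & HD & Hz). exists (rk Y lam D (const_fn Y lam)); split; auto. apply HI; eauto.
Qed.

Lemma rank_bound_ord : ordinal (rank_bound Y lam).
Proof.
  assert (Hc : const_fn Y lam ∈ W) by apply const_fn_W, mem_succ. split.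
  - intros x Hx y Hy; apply in_rank_bound in Hx as (D & HD & Hx); apply in_rank_bound.
    exists D; split; auto. apply (ord_trans _ x); auto. now apply rk_ord.
  - intros x y Hx Hy; apply in_rank_bound in Hx as (D & HD & Hx), Hy as (D' & HD' & Hy).
    apply ord_total;
      [apply (ord_in (rk Y lam D (const_fn Y lam)))|apply (ord_in (rk Y lam D' (const_fn Y lam)))];
      try assumption; now apply rk_ord.
Qed.

Lemma rank_bound_alpha_star : is_alpha_star Y lam (rank_bound Y lam).
Proof.
  assert (Hc : const_fn Y lam ∈ W) by apply const_fn_W, mem_succ. split.
  - intros D HD; apply Fil1_iff in HD. exists (rk Y lam D (const_fn Y lam)).
    now apply is_rk_const_iff.
  - split; [apply rank_bound_ord|split].
    + intros c (D & HD & K). apply Fil1_iff in HD. apply is_rk_const_iff in K as ->; auto.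
      apply ord_subset_iff; [now apply rk_ord|apply rank_bound_ord|].
      intros z Hz; apply in_rank_bound; eauto.
    + intros b Ob Hb. apply ord_subset_iff; auto; [apply rank_bound_ord|].
      intros z Hz; apply in_rank_bound in Hz as (D & HD & Hz).
      assert (K : ord_le (rk Y lam D (const_fn Y lam)) b).
      { apply Hb; exists D; split; [now apply Fil1_iff|now apply is_rk_const_iff]. }
      apply ord_subset_iff in K; auto. now apply rk_ord.
Qed.

Lemma rk_in_rank_bound D f : proper_filter Y D -> f ∈ funs Y lam ->
  rk Y lam D f ∈ rank_bound Y lam.
Proof.
  intros H Hf. assert (Hc : const_fn Y lam ∈ W) by apply const_fn_W, mem_succ.
  apply in_rank_bound; exists D; split; auto.
  apply rk_lt; auto; [now apply funs_succ|].
  apply (complete_filter_up Y D Y); [apply H|apply complete_filter_top, H| |].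
  - intros s Hs; apply in_lts; split; auto. rewrite app_const_fn; auto. now apply (app_funs Y).
  - intros s Hs; apply in_lts in Hs; tauto.
Qed.

(** Modulo the trivial filter, whose only member is [Y], the constant function [x] has rank at least
    [x], by induction on [x]. *)
Lemma lam_subset_rank_bound : Y <> empty -> subset lam (rank_bound Y lam).
Proof.
  intros NY.
  assert (H : proper_filter Y (sing Y)).
  { split; [split; [|split; [|split]]|].
    - intros A HA; apply in_sing in HA as ->; intros z; auto.
    - now apply in_sing.
    - intros A B HA S S'; apply in_sing in HA as ->; apply in_sing.
      apply ext_eq; intros z; split; auto.
    - intros c Hc; apply in_sing, ext_eq; intros z; rewrite in_cint; split; [tauto|].
      intros Hz; split; auto. intros n Hn. assert (K := app_funs _ _ _ _ Hc Hn).
      apply in_sing in K as ->; auto.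
    - intros E; apply in_sing in E; auto. }
  assert (Q : forall x, ordinal x -> x ∈ succ lam -> subset x (rk Y lam (sing Y) (const_fn Y x))).
  { apply (ord_ind (fun x => x ∈ succ lam -> subset x (rk Y lam (sing Y) (const_fn Y x)))); [def|].
    intros x Ox IH Hx y Hy.
    assert (Hy' : y ∈ succ lam) by (apply (ord_trans _ x); auto using ord_succ).
    assert (K := IH y Hy Hy'). assert (Oy := ord_in x y Ox Hy).
    assert (C1 := const_fn_W x Hx). assert (C2 := const_fn_W y Hy').
    assert (L : rk Y lam (sing Y) (const_fn Y y) ∈ rk Y lam (sing Y) (const_fn Y x)).
    { apply rk_lt; auto. apply in_sing, ext_eq; intros s; rewrite in_lts; split; [tauto|].
      intros Hs; split; auto. now rewrite !app_const_fn. }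
    apply ord_subset_iff in K; auto; [|now apply rk_ord].
    destruct K as [K|K]; [|now rewrite K].
    apply (ord_trans _ (rk Y lam (sing Y) (const_fn Y y))); auto. now apply rk_ord. }
  intros z Hz; apply in_rank_bound; exists (sing Y); split; auto.
  apply (Q lam); auto using mem_succ.
Qed.
End RankBound.
Opaque rank_bound const_fn.

(** * The code of a function *)

Definition slice {M : model} (k A s : M) : M := compr (fun x => x ∈ k /\ goedel k s x ∈ A).

(* The product of the filters [app F s], transported from [k * k] to [k]. *)

Definition merge {M : model} (k F : M) : M :=
  compr (fun A => subset A k /\ forall s, s ∈ k -> slice k A s ∈ app F s).

Definition quad {M : model} (x y z w : M) : M := pair (pair (pair x y) z) w.

Definition filter_at {M : model} (k lam r f s : M) : M :=
  tower k lam r f (stage k lam r (rank_bound k lam) f s).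

Definition dual_at {M : model} (k lam r f s : M) : M := dual k lam f (filter_at k lam r f s).

Definition hull_at {M : model} (k lam r f s : M) : M := hull r f (dual_at k lam r f s).

(* [label] and [code] are opaque, as conversion tests between their instances
   would otherwise unfold the whole construction. *)

Lemma label_sig : {l : forall M : model, M -> M -> M -> M -> M |
  l = fun M k lam r f => code_set k lam r (rank_bound k lam) f}.
Proof. eexists; reflexivity. Qed.

Definition label {M : model} (k lam r f : M) : M := proj1_sig label_sig M k lam r f.

Lemma label_eq {M : model} (k lam r f : M) :
  label k lam r f = code_set k lam r (rank_bound k lam) f.
Proof. unfold label; now rewrite (proj2_sig label_sig). Qed.

(** The four entries are those of a member of [Fil4]. The last has to be some member of the second
    filter, and [k] itself is taken. *)
Definition code_filters {M : model} (k lam r f h : M) : M :=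
  quad (merge k (fn k (filter_at k lam r f))) (merge k (fn k (dual_at k lam r f))) h k.

Definition value_pos {M : model} (k lam r f : M) : M :=
  fn k (fun s => pos (hull_at k lam r f s) (app f s)).

Definition rank_pos {M : model} (k lam r f : M) : M :=
  fn k (fun s => pos (label k lam r f) (rk k lam (filter_at k lam r f s) f)).

(** A quadruple has room for one function [h], and two are to be recorded: coordinate 0 carries the
    positions of the values in the hulls, all other coordinates the positions of the ranks in the
    label. *)
Lemma code_sig : {c : forall M : model, M -> M -> M -> M -> M |
  c = fun M k lam r f => fn omega (fun n => the (fun q =>
    (n = empty /\ q = code_filters k lam r f (value_pos k lam r f)) \/
    (n <> empty /\ q = code_filters k lam r f (rank_pos k lam r f))))}.
Proof. eexists; reflexivity. Qed.

Definition code {M : model} (k lam r f : M) : M := proj1_sig code_sig M k lam r f.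

Lemma code_eq {M : model} (k lam r f : M) :
  code k lam r f = fn omega (fun n => the (fun q =>
    (n = empty /\ q = code_filters k lam r f (value_pos k lam r f)) \/
    (n <> empty /\ q = code_filters k lam r f (rank_pos k lam r f)))).
Proof. unfold code; now rewrite (proj2_sig code_sig). Qed.

Lemma t_slice k A s : dterm k -> dterm A -> dterm s ->
  dterm (fun M e => slice (k M e) (A M e) (s M e)).
Proof. dunfold @slice. Qed.
#[local] Hint Resolve t_slice : defn.

Lemma t_merge k F : dterm k -> dterm F -> dterm (fun M e => merge (k M e) (F M e)).
Proof. dunfold @merge. Qed.

Lemma t_quad x y z w : dterm x -> dterm y -> dterm z -> dterm w ->
  dterm (fun M e => quad (x M e) (y M e) (z M e) (w M e)).
Proof. dunfold @quad. Qed.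
#[local] Hint Resolve t_merge t_quad : defn.

Lemma t_filter_at k lam r f s : dterm k -> dterm lam -> dterm r -> dterm f -> dterm s ->
  dterm (fun M e => filter_at (k M e) (lam M e) (r M e) (f M e) (s M e)).
Proof. dunfold @filter_at. Qed.
#[local] Hint Resolve t_filter_at : defn.

Lemma t_dual_at k lam r f s : dterm k -> dterm lam -> dterm r -> dterm f -> dterm s ->
  dterm (fun M e => dual_at (k M e) (lam M e) (r M e) (f M e) (s M e)).
Proof. dunfold @dual_at. Qed.
#[local] Hint Resolve t_dual_at : defn.

Lemma t_hull_at k lam r f s : dterm k -> dterm lam -> dterm r -> dterm f -> dterm s ->
  dterm (fun M e => hull_at (k M e) (lam M e) (r M e) (f M e) (s M e)).
Proof. dunfold @hull_at. Qed.

Lemma t_label k lam r f : dterm k -> dterm lam -> dterm r -> dterm f ->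
  dterm (fun M e => label (k M e) (lam M e) (r M e) (f M e)).
Proof. intros; unfold label; rewrite (proj2_sig label_sig); dlift; dsolve. Qed.

Lemma t_code_filters k lam r f h : dterm k -> dterm lam -> dterm r -> dterm f -> dterm h ->
  dterm (fun M e => code_filters (k M e) (lam M e) (r M e) (f M e) (h M e)).
Proof. dunfold @code_filters. Qed.
#[local] Hint Resolve t_hull_at t_label t_code_filters : defn.

Lemma t_value_pos k lam r f : dterm k -> dterm lam -> dterm r -> dterm f ->
  dterm (fun M e => value_pos (k M e) (lam M e) (r M e) (f M e)).
Proof. dunfold @value_pos. Qed.

Lemma t_rank_pos k lam r f : dterm k -> dterm lam -> dterm r -> dterm f ->
  dterm (fun M e => rank_pos (k M e) (lam M e) (r M e) (f M e)).
Proof. dunfold @rank_pos. Qed.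
#[local] Hint Resolve t_value_pos t_rank_pos : defn.

Lemma t_code k lam r f : dterm k -> dterm lam -> dterm r -> dterm f ->
  dterm (fun M e => code (k M e) (lam M e) (r M e) (f M e)).
Proof. intros; unfold code; rewrite (proj2_sig code_sig); dlift; dsolve. Qed.
#[local] Hint Resolve t_code : defn.

(** * Coding a sequence of filters by one filter *)

Section Merge.
Context {M : model}.
Implicit Types s t x y z A B D F : M.
Context (k : M) (Hk : aleph k).

Lemma aleph_ord : ordinal k.
Proof. apply Hk. Qed.

Lemma aleph_zero : empty ∈ k.
Proof.
  destruct (proj1 (aleph_iff k) Hk) as (O & L & _).
  destruct L as [L|L]; [|rewrite <- L; apply zero_omega].
  apply (ord_trans k omega); auto using zero_omega.
Qed.

Lemma in_slice A s x : x ∈ slice k A s <-> x ∈ k /\ goedel k s x ∈ A.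
Proof. apply (in_compr (fun x => x ∈ k /\ goedel k s x ∈ A) k); [def|tauto]. Qed.

Lemma in_merge F A : A ∈ merge k F <->
  subset A k /\ forall s, s ∈ k -> slice k A s ∈ app F s.
Proof.
  apply (in_compr (fun A => subset A k /\ forall s, s ∈ k -> slice k A s ∈ app F s) (power k));
    [def|]. intros B [H _]; now apply in_power.
Qed.

(** An aleph is closed under the pairing function, so all slices of [k] are full; and slices commute
    with countable intersections. *)
Lemma merge_complete F : (forall s, s ∈ k -> complete_filter k (app F s)) ->
  complete_filter k (merge k F).
Proof.
  intros H.
  assert (S : forall A s, subset (slice k A s) k) by (intros A s x Hx; apply in_slice in Hx; tauto).
  split; [|split; [|split]].
  - intros A HA; apply in_merge in HA; tauto.
  - apply in_merge; split; [intros z; auto|]. intros s Hs.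
    apply (complete_filter_up k _ k); auto; [apply complete_filter_top; auto|].
    intros x Hx; apply in_slice; split; auto using goedel_in.
  - intros A B HA SAB SB; apply in_merge in HA as [_ HA]; apply in_merge; split; auto.
    intros s Hs. apply (complete_filter_up k _ (slice k A s)); auto.
    intros x Hx; apply in_slice in Hx as [Hx K]; apply in_slice; split; auto.
  - intros c Hc. apply in_merge; split; [intros x Hx; apply in_cint in Hx; tauto|].
    intros s Hs. apply (complete_filter_cint k _ (fun n => slice k (app c n) s)); auto; [dfn| |].
    + intros n Hn. assert (K := app_funs _ _ _ _ Hc Hn). apply in_merge in K as [_ K]; auto.
    + intros x Hx K; apply in_slice; split; auto. apply in_cint; split; [now apply goedel_in|].
      intros n Hn; specialize (K n Hn); apply in_slice in K; tauto.
Qed.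

(** The empty set has empty slices, so one proper factor suffices. *)
Lemma merge_proper F : ~ empty ∈ app F empty -> ~ empty ∈ merge k F.
Proof.
  intros N K; apply in_merge in K as [_ K]; apply N.
  assert (Q := K empty aleph_zero).
  assert (E : slice k empty empty = empty); [|now rewrite E in Q].
  apply ext_eq; intros x; rewrite in_slice; split; [intros [_ L]|intros L];
    exfalso; exact (in_empty _ L).
Qed.

Lemma merge_subset F F' : (forall s, s ∈ k -> subset (app F s) (app F' s)) ->
  subset (merge k F) (merge k F').
Proof.
  intros H A HA; apply in_merge in HA as [SA HA]; apply in_merge; split; auto.
  intros s Hs; apply H; auto.
Qed.

(** A member [B] of the filter at [s] is recovered from a set whose slice at [s] is [B] and whose
    other slices are full; injectivity of the pairing function separates the slices. *)
Lemma merge_inj_subset F F' s : (forall s, s ∈ k -> complete_filter k (app F s)) ->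
  (forall s, s ∈ k -> complete_filter k (app F' s)) -> merge k F = merge k F' -> s ∈ k ->
  subset (app F s) (app F' s).
Proof.
  intros H H' E Hs B HB. assert (SB := complete_filter_sub k _ B (H s Hs) HB).
  pose (A := compr (fun x => x ∈ k /\ forall b, b ∈ k -> x = goedel k s b -> b ∈ B)).
  assert (HA : forall x, x ∈ A <-> x ∈ k /\ forall b, b ∈ k -> x = goedel k s b -> b ∈ B).
  { apply (in_compr _ k); [def|tauto]. }
  assert (Ok := aleph_ord).
  assert (K : A ∈ merge k F).
  { apply in_merge; split; [intros x Hx; apply HA in Hx; tauto|]. intros t Ht.
    destruct (classic (t = s)) as [->|N].
    - apply (complete_filter_up k _ B); auto; [|intros x Hx; apply in_slice in Hx; tauto].
      intros x Hx; apply in_slice; split; auto. apply HA; split; [apply goedel_in; auto|].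
      intros b Hb Eb. apply goedel_inj in Eb as [_ <-]; auto.
    - apply (complete_filter_up k _ k); auto; [apply complete_filter_top; auto| |
        intros x Hx; apply in_slice in Hx; tauto].
      intros x Hx; apply in_slice; split; auto. apply HA; split; [apply goedel_in; auto|].
      intros b Hb Eb. apply goedel_inj in Eb as [Eb _]; auto. congruence. }
  rewrite E in K; apply in_merge in K as [_ K]. specialize (K s Hs).
  apply (complete_filter_up k _ _ _ (H' s Hs) K); auto.
  intros x Hx; apply in_slice in Hx as [Hx Q]; apply HA in Q as [_ Q]; auto.
Qed.

Lemma merge_inj F F' s : (forall s, s ∈ k -> complete_filter k (app F s)) ->
  (forall s, s ∈ k -> complete_filter k (app F' s)) -> merge k F = merge k F' -> s ∈ k ->
  app F s = app F' s.
Proof.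
  intros H H' E Hs; apply ext_eq; intros B; split; apply merge_inj_subset; auto.
Qed.
End Merge.
Opaque merge slice.

(** * Codes as elements of X_kappa *)

Section Codes.
Context {M : model}.
Implicit Types f g h s t u v w x y z A B D F : M.

Lemma is_quadruple_iff q x y z w : is_quadruple q x y z w <-> q = quad x y z w.
Proof.
  unfold is_quadruple, quad; split.
  - intros (p & p' & A & B & C). rewrite is_pair_iff in *. now subst.
  - intros ->; exists (pair x y), (pair (pair x y) z). now rewrite !is_pair_iff.
Qed.

Lemma quad_inj x y z w x' y' z' w' : quad x y z w = quad x' y' z' w' ->
  x = x' /\ y = y' /\ z = z' /\ w = w'.
Proof.
  intros E; apply pair_inj in E as [E ->]; apply pair_inj in E as [E ->];
    apply pair_inj in E as [-> ->]; auto.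
Qed.

(** A description takes a default value outside its intended domain, so [G] is not asked to map into
    [b]; stray values are sent to [z]. *)
Lemma surj_partial (G : M -> M) (a b z : M) : dfun M G -> z ∈ b ->
  (forall y, y ∈ b -> exists x, x ∈ a /\ G x = y) -> surj a b.
Proof.
  intros HG Hz H.
  pose (g := fn a G). assert (Hg : forall x, x ∈ a -> app g x = G x) by (intros; now apply app_fn).
  clearbody g.
  pose (F := fun x => the (fun v => (app g x ∈ b /\ v = app g x) \/ (~ app g x ∈ b /\ v = z))).
  assert (DF : dfun M F) by (unfold F; dfn).
  exists (fn a F); split.
  - apply funs_fn; auto. intros x Hx; unfold F.
    destruct (classic (app g x ∈ b)); [rewrite the_case|rewrite the_case']; auto.
  - intros y Hy; destruct (H y Hy) as (x & Hx & E); exists x; split; auto.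
    rewrite app_fn by auto. unfold F. rewrite <- Hg in E by auto.
    rewrite the_case; auto; rewrite E; auto.
Qed.

Context (k lam d r mu : M) (Hk : aleph k) (Hd : aleph d) (w1_ex : exists w1 : M, is_aleph1 w1).
Context (Hlam : ordinal lam) (Hkl : k ∈ lam).
Context (Hr : covering r mu) (Hmu : subset (rank_bound k lam) mu).
Context (Hcard : forall u, u ∈ fld r -> le_card u d /\ ~ le_card d u).

Let a := rank_bound k lam.

Lemma lam_subset_a : subset lam a.
Proof. apply lam_subset_rank_bound; auto. apply (mem_nonempty _ empty), aleph_zero, Hk. Qed.

Lemma lam_subset_mu : subset lam mu.
Proof. intros z Hz; apply Hmu, lam_subset_a, Hz. Qed.

Lemma omega_subset_k : subset omega k.
Proof.
  destruct (proj1 (aleph_iff k) Hk) as (O & L & _). apply ord_subset_iff; auto using omega_ord.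
Qed.

Lemma omega_subset_a : subset omega a.
Proof.
  intros z Hz. apply lam_subset_a, (ord_trans lam k); auto. now apply omega_subset_k.
Qed.

(** Otherwise [d] would be contained in the order type and so embed into [u]. *)
Lemma otype_small u : u ∈ fld r -> otype u (memrel u) ∈ d.
Proof.
  intros Hu. destruct (Hcard u Hu) as [L N].
  assert (Ou : ords u) by (apply (ords_sub u mu); apply Hr; auto).
  assert (W := memrel_wo u Ou). assert (Oo := otype_ord u (memrel u) W).
  assert (Od : ordinal d) by apply Hd.
  apply NNPP; intros Nd. apply ord_not_mem in Nd; auto.
  apply N, (le_card_trans _ (otype u (memrel u))); [now apply le_card_subset|].
  pose (F := fun y => the (fun x => x ∈ u /\ pos u x = y)).
  assert (HF : forall y, y ∈ otype u (memrel u) -> F y ∈ u /\ pos u (F y) = y).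
  { intros y Hy; apply in_otype_pos in Hy as (x & Hx & ->).
    assert (F (pos u x) = x) as ->; auto.
    apply the_eq; auto. intros z [Hz E]; now apply (pos_inj u). }
  apply (le_card_fn F); [unfold F; dfn|intros y Hy; now apply HF|].
  intros x y Hx Hy E. destruct (HF x Hx) as [_ <-], (HF y Hy) as [_ <-]. now rewrite E.
Qed.

Section OneFunction.
Context (f : M) (Hf : f ∈ funs k lam).

Lemma rk_in_a D : proper_filter k D -> rk k lam D f ∈ a.
Proof. intros; now apply rk_in_rank_bound. Qed.

Lemma stage_captures s : s ∈ k ->
  captures k lam r f (label k lam r f) s (stage k lam r a f s).
Proof.
  rewrite label_eq; apply (stage_spec r mu k lam Hr Hlam lam_subset_mu f Hf a omega_subset_a rk_in_a Hmu).
Qed.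

Lemma label_spec : exists v, subset v a /\ le_card v omega /\ le_card omega v /\
  label k lam r f = cover r v.
Proof.
  assert (H := code_set_spec r mu k lam Hr Hlam lam_subset_mu f Hf a omega_subset_a rk_in_a Hmu).
  apply (in_good_covers r mu k lam Hr f a) in H; auto. rewrite label_eq.
  destruct H as (v & A & B & C & _ & E); exists v; auto.
Qed.

Lemma label_fld : label k lam r f ∈ fld r.
Proof.
  rewrite label_eq; exact (code_set_fld r mu k lam Hr Hlam lam_subset_mu f Hf a omega_subset_a rk_in_a Hmu).
Qed.

Lemma filter_at_proper s : s ∈ k -> proper_filter k (filter_at k lam r f s).
Proof.
  intros Hs. destruct (stage_captures s Hs) as (A & _).
  exact (tower_proper r mu k lam Hr Hlam lam_subset_mu f Hf _ A).
Qed.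

Lemma dual_at_proper s : s ∈ k -> proper_filter k (dual_at k lam r f s).
Proof.
  intros Hs. apply dual_proper_filter; auto; [now apply filter_at_proper|now apply funs_succ].
Qed.

Lemma rk_in_label s : s ∈ k -> rk k lam (filter_at k lam r f s) f ∈ label k lam r f.
Proof. intros Hs. destruct (stage_captures s Hs) as (_ & A & _). exact A. Qed.

Lemma value_in_hull s : s ∈ k -> app f s ∈ hull_at k lam r f s.
Proof.
  intros Hs. destruct (stage_captures s Hs) as (_ & _ & A).
  apply in_dcore in A as [_ A]; exact A.
Qed.

Let C := cl r (image (app f) k).

Lemma cl_ords : ords C.
Proof.
  apply (ords_sub C mu); [apply Hr|]. apply cl_subset; auto.
  apply (img_subset mu k lam lam_subset_mu); auto. intros z; auto.
Qed.

Lemma hull_at_subset s : s ∈ k -> subset (hull_at k lam r f s) C.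
Proof.
  intros Hs; apply (hull_subset r mu k lam Hr lam_subset_mu); auto. now apply dual_at_proper.
Qed.

(** The hulls vary with [s], but all lie in the closure [C] of the range of [f], so [pos_mono]
    bounds all positions by one order type. *)
Lemma value_pos_maps : value_pos k lam r f ∈ funs k (otype C (memrel C)).
Proof.
  apply funs_fn; [dfn|]. intros s Hs.
  assert (S := hull_at_subset s Hs). assert (V := value_in_hull s Hs).
  assert (OC := cl_ords).
  assert (K := pos_mono _ _ _ OC S V).
  assert (L := pos_in_otype C (app f s) (S _ V)).
  assert (OO := otype_ord _ _ (memrel_wo C OC)).
  assert (OH : ordinal (pos (hull_at k lam r f s) (app f s))).
  { apply pos_ord; auto. intros z Hz; auto. }
  apply ord_subset_iff in K; auto; [|apply (ord_in (otype C (memrel C))); auto].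
  destruct K as [K| ->]; auto. now apply (ord_trans _ (pos C (app f s))).
Qed.

Let dom_h : M := compr (fun p => prod (subsets_le_aleph0 (ext k)) (ext d) p).

Lemma in_dom_h p : p ∈ dom_h <-> exists v x, subset v k /\ le_card v omega /\ x ∈ d /\ p = pair v x.
Proof.
  assert (E : forall p, prod (subsets_le_aleph0 (ext k)) (ext d) p <->
    exists v x, subset v k /\ le_card v omega /\ x ∈ d /\ p = pair v x).
  { intros q; rewrite prod_iff. split.
    - intros (v & x & A & B & ->). apply subsets_le_aleph0_iff in A as [A A'].
      exists v, x; auto.
    - intros (v & x & A & B & Hx & ->). exists v, x; split; auto.
      apply subsets_le_aleph0_iff; auto. }
  rewrite <- E. apply (in_compr (fun p => prod (subsets_le_aleph0 (ext k)) (ext d) p)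
    (times (power k) d)); [def|].
  intros q Hq; apply E in Hq as (v & x & A & _ & Hx & ->). apply pair_in_times; split; auto.
  now apply in_power.
Qed.

Lemma hrtg_dom_h : is_hrtg (prod (subsets_le_aleph0 (ext k)) (ext d)) (hartogs dom_h).
Proof.
  rewrite (class_eq (prod (subsets_le_aleph0 (ext k)) (ext d)) dom_h); [apply is_hrtg_hartogs|].
  intros p; rewrite in_dom_h, prod_iff. split.
  - intros (v & x & A & B & Hx & ->). exists v, x; split; auto.
    apply subsets_le_aleph0_iff; auto.
  - intros (v & x & A & B & ->). apply subsets_le_aleph0_iff in A as [A A'].
    exists v, x; auto.
Qed.

(** [rank_pos] takes values below [d]; this admits it as the third entry of a quadruple. *)
Lemma d_in_hartogs : d ∈ hartogs dom_h.
Proof.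
  apply in_hartogs; split; [apply Hd|right].
  apply (surj_partial (fun p => the (fun x => exists v, p = pair v x)) _ _ empty); [dfn|now apply aleph_zero|].
  intros x Hx. exists (pair empty x); split.
  - apply in_dom_h; exists empty, x; split; [|split; [|auto]].
    + intros z Hz; destruct (in_empty z Hz).
    + apply le_card_subset; intros z Hz; destruct (in_empty z Hz).
  - apply the_eq; [eauto|]. intros z (v & E); apply pair_inj in E; symmetry; tauto.
Qed.

Lemma img_k_subset : subset (image (app f) k) mu.
Proof. apply (img_subset mu k lam lam_subset_mu); auto. intros z; auto. Qed.

(** A point of [C] lies in the cover of a countable set of values of [f]. It is named by a countable
    set of arguments with these values and by its position in the cover, which is below [d] by
    [otype_small]. *)
Lemma otype_cl_in_hartogs : otype C (memrel C) ∈ hartogs dom_h.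
Proof.
  assert (OC := cl_ords). assert (WC := memrel_wo C OC).
  apply in_hartogs; split; [now apply otype_ord|].
  destruct (classic (otype C (memrel C) = empty)) as [E|E]; auto; right.
  destruct (nonempty_ex _ E) as [z0 Hz0].
  apply (surj_partial (fun p => pos C (the (fun x => exists v y, p = pair v y /\
    x ∈ cover r (image (app f) v) /\ pos (cover r (image (app f) v)) x = y))) _ _ z0); auto.
  { unfold C; dfn. }
  intros y Hy. apply in_otype_pos in Hy as (x & Hx & ->).
  assert (Hx' := Hx). apply (in_cl r mu Hr) in Hx' as (w & Sw & Cw & Hxw); [|apply img_k_subset].
  (* The least preimages of the members of [w]: a countable set of arguments found without
     choice. *)
  pose (v := compr (fun s => s ∈ k /\ app f s ∈ w /\ forall t, t ∈ s -> app f t <> app f s)).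
  assert (Hv : forall s, s ∈ v <-> s ∈ k /\ app f s ∈ w /\ forall t, t ∈ s -> app f t <> app f s).
  { apply (in_compr _ k); [def|tauto]. }
  clearbody v.
  assert (Ok := aleph_ord k Hk).
  assert (Ev : image (app f) v = w).
  { apply ext_eq; intros y; split.
    - intros Hy; apply in_img in Hy as (s & Hs & ->). now apply Hv.
    - intros Hy; assert (Hy' := Sw y Hy). apply in_img in Hy' as (s & Hs & Es).
      destruct (ord_least (fun s => s ∈ k /\ app f s = y) ltac:(def) s) as (t & Ot & [Ht Et] & L); auto.
      { now apply (ord_in k). }
      apply in_img; exists t; split; auto. apply Hv; split; auto; split; [congruence|].
      intros i Hi Ei. apply (L i Hi); split; [apply (ord_trans k t); auto|congruence]. }
  assert (Cv : le_card v omega).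
  { apply (le_card_trans _ w); auto. apply (le_card_fn (app f)); [dfn| |].
    - intros s Hs; now apply Hv.
    - intros s t Hs Ht E'. apply Hv in Hs as (Hs & _ & Ls), Ht as (Ht & _ & Lt).
      destruct (ord_total s t) as [Q|[Q|Q]]; auto; try (now apply (ord_in k)).
      + destruct (Lt s Q E').
      + destruct (Ls t Q (eq_sym E')). }
  assert (Fw : cover r w ∈ fld r).
  { apply (cover_spec r mu Hr w); auto. intros z Hz; apply img_k_subset; auto. }
  assert (Ow : ords (cover r w)).
  { apply (ords_sub _ mu); apply Hr; auto. }
  exists (pair v (pos (cover r w) x)); split.
  - apply in_dom_h; exists v, (pos (cover r w) x); split; [intros s Hs; now apply Hv|].
    split; auto; split; auto. apply (ord_trans d (otype (cover r w) (memrel (cover r w)))).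
    + apply Hd.
    + now apply otype_small.
    + now apply pos_in_otype.
  - f_equal. apply the_eq.
    + exists v, (pos (cover r w) x); rewrite Ev; auto.
    + intros z (v' & y' & E' & Hz & Ez). apply pair_inj in E' as [<- <-]. rewrite Ev in Hz, Ez.
      now apply (pos_inj (cover r w)).
Qed.

Lemma rank_pos_maps : rank_pos k lam r f ∈ funs k d.
Proof.
  apply funs_fn; [dfn|]. intros s Hs. assert (L := rk_in_label s Hs).
  apply (ord_trans d (otype (label k lam r f) (memrel (label k lam r f)))).
  - apply Hd.
  - apply otype_small, label_fld.
  - now apply pos_in_otype.
Qed.

Lemma code_filters_Fil4 h b : b ∈ hartogs dom_h -> h ∈ funs k b ->
  Fil4 d k (code_filters k lam r f h).
Proof.
  intros Hb Hh.
  assert (D1 : dfun M (filter_at k lam r f)) by dfn.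
  assert (D2 : dfun M (dual_at k lam r f)) by dfn.
  assert (E1 : forall s, s ∈ k -> app (fn k (filter_at k lam r f)) s = filter_at k lam r f s)
    by (intros; now apply app_fn).
  assert (E2 : forall s, s ∈ k -> app (fn k (dual_at k lam r f)) s = dual_at k lam r f s)
    by (intros; now apply app_fn).
  assert (C1 : complete_filter k (merge k (fn k (filter_at k lam r f)))).
  { apply merge_complete; auto. intros s Hs; rewrite E1 by auto. now apply filter_at_proper. }
  assert (C2 : complete_filter k (merge k (fn k (dual_at k lam r f)))).
  { apply merge_complete; auto. intros s Hs; rewrite E2 by auto. now apply dual_at_proper. }
  exists (merge k (fn k (filter_at k lam r f))), (merge k (fn k (dual_at k lam r f))), h, k.
  split; [now apply is_quadruple_iff|].
  split; [now apply complete_filter_iff|]. split; [now apply complete_filter_iff|].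
  split; [|split; [|split]].
  - apply merge_subset. intros s Hs; rewrite E1, E2 by auto.
    apply dual_sub. now apply filter_at_proper.
  - apply proper_iff, merge_proper; auto. rewrite E2 by now apply aleph_zero.
    now apply dual_at_proper, aleph_zero.
  - exists (hartogs dom_h), omega, b. split; [exact hrtg_dom_h|].
    split; [now apply is_omega_iff|]. split; auto. now apply in_funs.
  - now apply complete_filter_top.
Qed.

Lemma code_zero : app (code k lam r f) empty = code_filters k lam r f (value_pos k lam r f).
Proof.
  rewrite code_eq, app_fn; [now apply the_case|dfn|apply zero_omega].
Qed.

Lemma code_pos n : n ∈ omega -> n <> empty ->
  app (code k lam r f) n = code_filters k lam r f (rank_pos k lam r f).
Proof.
  intros Hn N. rewrite code_eq, app_fn; [now apply the_case'|dfn|auto].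
Qed.

Lemma code_maps : maps (code k lam r f) (ext omega) (Fil4 d k).
Proof.
  assert (K : maps (code k lam r f) (ext omega) (fun _ => True)) by (rewrite code_eq; apply fn_maps; [dfn|auto]).
  apply (maps_weaken _ _ _ _ K). intros n Hn.
  destruct (classic (n = empty)) as [->|N].
  - rewrite code_zero. apply (code_filters_Fil4 _ _ otype_cl_in_hartogs value_pos_maps).
  - rewrite code_pos by auto. apply (code_filters_Fil4 _ _ d_in_hartogs rank_pos_maps).
Qed.

Lemma code_X : X d k (code k lam r f).
Proof. exists omega; split; [now apply is_omega_iff|exact code_maps]. Qed.
End OneFunction.

(** The decoding is done at each [s]. The merged filters return the filter and its dual; the common
    label turns equal positions into equal ranks; so [f] and [g] agree modulo the dual filter and
    have the same hull, in which equal positions mean equal values. *)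
Lemma code_inj f g : f ∈ funs k lam -> g ∈ funs k lam ->
  label k lam r f = label k lam r g -> code k lam r f = code k lam r g -> f = g.
Proof.
  intros Hf Hg EL EC.
  assert (Q0 := code_zero f). assert (Q1 := code_zero g). rewrite EC, Q1 in Q0. clear Q1.
  assert (Z1 : succ empty ∈ (omega : M)) by apply succ_omega, zero_omega.
  assert (R0 := code_pos f _ Z1 (succ_neq_empty _)).
  assert (R1 := code_pos g _ Z1 (succ_neq_empty _)). rewrite EC, R1 in R0. clear R1.
  apply quad_inj in Q0 as (M1 & M2 & H1 & _), R0 as (_ & _ & H2 & _).
  assert (P : forall f, f ∈ funs k lam -> (forall s, s ∈ k -> app (fn k (filter_at k lam r f)) s = filter_at k lam r f s) /\
    (forall s, s ∈ k -> app (fn k (dual_at k lam r f)) s = dual_at k lam r f s) /\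
    (forall s, s ∈ k -> app (value_pos k lam r f) s = pos (hull_at k lam r f s) (app f s)) /\
    (forall s, s ∈ k -> app (rank_pos k lam r f) s = pos (label k lam r f) (rk k lam (filter_at k lam r f s) f))).
  { intros f' _. unfold value_pos, rank_pos.
    repeat split; intros s Hs; rewrite app_fn; auto; dfn. }
  destruct (P f Hf) as (A1 & A2 & A3 & A4), (P g Hg) as (B1 & B2 & B3 & B4). clear P.
  apply (funs_ext k lam lam); auto. intros s Hs.
  assert (E1 : filter_at k lam r g s = filter_at k lam r f s).
  { rewrite <- (A1 s Hs), <- (B1 s Hs).
    apply (merge_inj k Hk _ _ s); [| |exact M1|exact Hs]; intros t Ht;
      [rewrite B1|rewrite A1]; try exact Ht; now apply filter_at_proper. }
  assert (E2 : dual_at k lam r g s = dual_at k lam r f s).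
  { rewrite <- (A2 s Hs), <- (B2 s Hs).
    apply (merge_inj k Hk _ _ s); [| |exact M2|exact Hs]; intros t Ht;
      [rewrite B2|rewrite A2]; try exact Ht; now apply dual_at_proper. }
  assert (E3 : pos (hull_at k lam r g s) (app g s) = pos (hull_at k lam r f s) (app f s)).
  { rewrite <- (A3 s Hs), <- (B3 s Hs). now rewrite H1. }
  assert (E4 : rk k lam (filter_at k lam r f s) f = rk k lam (filter_at k lam r f s) g).
  { assert (Q : pos (label k lam r g) (rk k lam (filter_at k lam r g s) g) =
      pos (label k lam r f) (rk k lam (filter_at k lam r f s) f)).
    { rewrite <- (A4 s Hs), <- (B4 s Hs). now rewrite H2. }
    assert (L1 := rk_in_label f Hf s Hs). assert (L2 := rk_in_label g Hg s Hs).
    rewrite E1, <- EL in Q, L2. symmetry.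
    apply (pos_inj (label k lam r f)); auto.
    apply (ords_sub _ mu); [apply Hr|]. apply Hr. now apply label_fld. }
  assert (W1 := funs_succ k lam f Hf). assert (W2 := funs_succ k lam g Hg).
  assert (PF := filter_at_proper f Hf s Hs).
  assert (E5 : dual k lam f (filter_at k lam r f s) = dual k lam g (filter_at k lam r f s)).
  { unfold dual_at in E2. now rewrite E1 in E2. }
  assert (EQ := dual_eqs k lam Hlam _ f g PF W1 W2 E4 E5).
  assert (EH : hull_at k lam r g s = hull_at k lam r f s).
  { unfold hull_at. rewrite E2. symmetry.
    apply (hull_eq r mu k lam Hr lam_subset_mu); auto. now apply dual_at_proper. }
  assert (V1 := value_in_hull f Hf s Hs). assert (V2 := value_in_hull g Hg s Hs).
  rewrite EH in E3, V2. symmetry. apply (pos_inj (hull_at k lam r f s)); auto.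
  intros z Hz. apply (cl_ords f Hf), (hull_at_subset f Hf s Hs z Hz).
Qed.
End Codes.
Opaque label code.

(** * The sequence and the theorem *)

Definition code_space {M : model} (d k : M) : M := compr (fun t => X d k t).

Definition coded_by {M : model} (k lam r t : M) : M :=
  compr (fun f => f ∈ funs k lam /\ code k lam r f = t).

(** Among functions with a common code the label determines the function, so this order is linear
    there. *)
Definition label_order {M : model} (k lam r A : M) : M :=
  graph A A (fun f g => pair (label k lam r f) (label k lam r g) ∈ r).

Definition the_sequence {M : model} (k lam d r : M) : M :=
  fn (code_space d k) (fun t =>
    pair (coded_by k lam r t) (label_order k lam r (coded_by k lam r t))).

Definition labels {M : model} (k lam r : M) : M := image (label k lam r) (funs k lam).

(** The ordinal [b] for which [f] belongs to the piece F_b of the partition in clause (d). *)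
Definition index {M : model} (k lam r f : M) : M :=
  rank (labels k lam r) r (label k lam r f).

Lemma t_code_space d k : dterm d -> dterm k -> dterm (fun M e => code_space (d M e) (k M e)).
Proof. dunfold @code_space. Qed.

Lemma t_coded_by k lam r t : dterm k -> dterm lam -> dterm r -> dterm t ->
  dterm (fun M e => coded_by (k M e) (lam M e) (r M e) (t M e)).
Proof. dunfold @coded_by. Qed.

Lemma t_label_order k lam r A : dterm k -> dterm lam -> dterm r -> dterm A ->
  dterm (fun M e => label_order (k M e) (lam M e) (r M e) (A M e)).
Proof.
  intros. unfold label_order.
  apply (t_graph A A (fun M e f g =>
    pair (label (k M e) (lam M e) (r M e) f) (label (k M e) (lam M e) (r M e) g) ∈ r M e));
    auto; dlift; dsolve.
Qed.
#[local] Hint Resolve t_code_space t_coded_by t_label_order : defn.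

Lemma t_the_sequence k lam d r : dterm k -> dterm lam -> dterm d -> dterm r ->
  dterm (fun M e => the_sequence (k M e) (lam M e) (d M e) (r M e)).
Proof. dunfold @the_sequence. Qed.

Lemma t_labels k lam r : dterm k -> dterm lam -> dterm r ->
  dterm (fun M e => labels (k M e) (lam M e) (r M e)).
Proof. dunfold @labels. Qed.
#[local] Hint Resolve t_the_sequence t_labels : defn.

Lemma t_index k lam r f : dterm k -> dterm lam -> dterm r -> dterm f ->
  dterm (fun M e => index (k M e) (lam M e) (r M e) (f M e)).
Proof. dunfold @index. Qed.
#[local] Hint Resolve t_index : defn.

(** * Verification of the clauses of the theorem *)

Section Assembly.
Context {M : model}.
Implicit Types b c f g h s t u v w x y z A B D F S T : M.

(** The point is that X_kappa is a set: the values of [h] are bounded by a Hartogs number or omega,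
    so all quadruples lie in one set [FS]. *)
Lemma in_code_space (d k : M) t : t ∈ code_space d k <-> X d k t.
Proof.
  assert (HF : exists FS, forall q, Fil4 d k q -> q ∈ FS).
  { pose (dh := compr (fun p => prod (subsets_le_aleph0 (ext k)) (ext d) p)).
    assert (Hdh : prod (subsets_le_aleph0 (ext k)) (ext d) = ext dh).
    { apply class_eq. apply (in_compr _ (times (power k) d)); [def|].
      intros p Hp; apply prod_iff in Hp as (u & x & Hu & Hx & ->).
      apply subsets_le_aleph0_iff in Hu as [Hu _].
      apply pair_in_times; split; auto. now apply in_power. }
    exists (times (times (times (power (power k)) (power (power k)))
      (power (times k (cup (hartogs dh) omega)))) (power k)).
    intros q (D1 & D2 & h & Z & E & (F1 & _) & (F2 & _) & _ & _ & (th & w & a & Hth & Hw & Ha & Hh) & HZ).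
    apply is_quadruple_iff in E as ->. unfold quad. rewrite !pair_in_times.
    rewrite Hdh in Hth. apply is_hrtg_iff in Hth as ->. apply is_omega_iff in Hw as ->.
    repeat split; apply in_power.
    - intros A HA; apply in_power; now apply F1.
    - intros A HA; apply in_power; now apply F2.
    - intros p Hp; destruct (proj1 Hh p Hp) as (s & x & Hs & Hx & Ep).
      apply is_pair_iff in Ep as ->. apply pair_in_times; split; auto. apply in_cup.
      destruct Ha as [Ha|Ha]; [left; apply (ord_trans _ a)|right; apply (ord_trans _ a)];
        auto using hartogs_ord, omega_ord.
    - now apply F2. }
  destruct HF as [FS HF].
  apply (in_compr (fun t => X d k t) (power (times omega FS))); [def|].
  intros t' (w & Hw & Ht). apply is_omega_iff in Hw as ->. apply in_power; intros p Hp.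
  destruct (proj1 Ht p Hp) as (n & q & Hn & Hq & E). apply is_pair_iff in E as ->.
  apply pair_in_times; split; auto.
Qed.

Lemma X_eq (d k : M) : X d k = ext (code_space d k).
Proof. apply class_eq, in_code_space. Qed.

Lemma well_orders_graph S (R : M -> M -> Prop) : def2 M R ->
  (forall x, x ∈ S -> ~ R x x) ->
  (forall x y z, x ∈ S -> y ∈ S -> z ∈ S -> R x y -> R y z -> R x z) ->
  (forall x y, x ∈ S -> y ∈ S -> R x y \/ x = y \/ R y x) ->
  (forall T, subset T S -> T <> empty -> exists m, m ∈ T /\ forall x, x ∈ T -> x = m \/ R m x) ->
  well_orders (graph S S R) S.
Proof.
  intros HR I T C L.
  assert (E : forall x y, rel (graph S S R) x y <-> x ∈ S /\ y ∈ S /\ R x y).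
  { intros; rewrite rel_iff; now apply in_graph. }
  split; [|split; [|split; [|split]]].
  - intros p Hp; apply graph_subset in Hp; auto. apply prod_iff.
    apply in_times in Hp as (x & y & A & B & ->); exists x, y; auto.
  - intros x K; apply E in K as (A & _ & B); exact (I x A B).
  - intros x y z K K'; apply E in K as (A & B & K), K' as (_ & B' & K'); apply E.
    split; [auto|split; auto]. apply (T x y z); auto.
  - intros x y Hx Hy; rewrite !E. destruct (C x y Hx Hy) as [|[|]]; auto.
  - intros T' S' [x Hx]. destruct (L T' S' (mem_nonempty _ _ Hx)) as (m & Hm & K).
    exists m; split; auto. intros y Hy; rewrite E. destruct (K y Hy); auto.
Qed.

Context (k lam d r mu : M) (Hk : aleph k) (Hd : aleph d) (w1_ex : exists w1 : M, is_aleph1 w1).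
Context (Hlam : ordinal lam) (Hkl : k ∈ lam).
Context (Hr : covering r mu) (Hmu : subset (rank_bound k lam) mu).
Context (Hcard : forall u, u ∈ fld r -> le_card u d /\ ~ le_card d u).

Let FF := funs k lam.
Let a := rank_bound k lam.

Lemma code_in f : f ∈ FF -> code k lam r f ∈ code_space d k.
Proof. intros Hf; apply in_code_space. now apply (code_X k lam d r mu). Qed.

Lemma label_in f : f ∈ FF -> label k lam r f ∈ fld r.
Proof. apply (label_fld k lam r mu); auto. Qed.

Lemma code_label_inj f g : f ∈ FF -> g ∈ FF ->
  label k lam r f = label k lam r g -> code k lam r f = code k lam r g -> f = g.
Proof. apply (code_inj k lam r mu); auto. Qed.

Lemma label_least A : subset A FF -> A <> empty -> exists m, m ∈ A /\
  forall f, f ∈ A -> label k lam r f = label k lam r m \/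
    pair (label k lam r m) (label k lam r f) ∈ r.
Proof.
  intros S N. destruct (nonempty_ex A N) as [f0 Hf0].
  assert (HI : forall u, u ∈ image (label k lam r) A <-> exists f, f ∈ A /\ u = label k lam r f)
    by (intros; apply in_image; dfn).
  destruct (fld_least r mu Hr (image (label k lam r) A)) as (u & Hu & L).
  - intros u Hu; apply HI in Hu as (f & Hf & ->). apply label_in; auto.
  - apply (mem_nonempty _ (label k lam r f0)), HI; eauto.
  - apply HI in Hu as (m & Hm & ->). exists m; split; [exact Hm|].
    intros f Hf; apply L, HI; eauto.
Qed.

Lemma label_irrefl f : ~ pair (label k lam r f) (label k lam r f) ∈ r.
Proof. apply Hr. Qed.

Lemma label_trans f g h : f ∈ FF -> g ∈ FF -> h ∈ FF ->
  pair (label k lam r f) (label k lam r g) ∈ r ->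
  pair (label k lam r g) (label k lam r h) ∈ r ->
  pair (label k lam r f) (label k lam r h) ∈ r.
Proof.
  destruct Hr as (_ & (_ & T & _) & _). intros; apply (T _ (label k lam r g)); auto using label_in.
Qed.

Lemma label_total f g : f ∈ FF -> g ∈ FF ->
  pair (label k lam r f) (label k lam r g) ∈ r \/ label k lam r f = label k lam r g \/
  pair (label k lam r g) (label k lam r f) ∈ r.
Proof.
  destruct Hr as (_ & (_ & _ & C) & _). intros; apply C; auto using label_in.
Qed.

Lemma in_coded_by t f : f ∈ coded_by k lam r t <-> f ∈ FF /\ code k lam r f = t.
Proof.
  apply (in_compr (fun f => f ∈ FF /\ code k lam r f = t) FF); [unfold FF; def|tauto].
Qed.

Lemma the_sequence_maps : maps (the_sequence k lam d r) (ext (code_space d k)) (fun _ => True).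
Proof. apply fn_maps; [dfn|auto]. Qed.

Lemma the_sequence_entry t S R : X d k t -> entry (the_sequence k lam d r) t S R ->
  S = coded_by k lam r t /\ R = label_order k lam r (coded_by k lam r t).
Proof.
  intros Ht (v & Hv & E). apply is_pair_iff in E.
  apply (app_rel _ _ _ _ _ the_sequence_maps) in Hv as [Ht' ->].
  unfold the_sequence in E; rewrite app_fn in E; [|dfn|auto].
  apply pair_inj in E as [-> ->]; auto.
Qed.

Lemma the_sequence_is_sequence : is_sequence d k (the_sequence k lam d r).
Proof.
  split.
  - unfold is_fun_on; rewrite X_eq. apply the_sequence_maps.
  - intros t v Hv. apply (app_rel _ _ _ _ _ the_sequence_maps) in Hv as [Ht ->].
    unfold the_sequence; rewrite app_fn; [|dfn|auto].
    exists (coded_by k lam r t), (label_order k lam r (coded_by k lam r t)).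
    now apply is_pair_iff.
Qed.

Lemma the_sequence_covers : covers_functions d k lam (the_sequence k lam d r).
Proof.
  intros f. unfold functions. rewrite <- in_funs. split.
  - intros Hf. exists (code k lam r f), (coded_by k lam r (code k lam r f)),
      (label_order k lam r (coded_by k lam r (code k lam r f))).
    split; [now apply in_code_space, code_in|split; [|now apply in_coded_by]].
    exists (app (the_sequence k lam d r) (code k lam r f)); split.
    + apply (app_rel _ _ _ _ _ the_sequence_maps); split; auto. now apply code_in.
    + unfold the_sequence; rewrite app_fn; [now apply is_pair_iff|dfn|now apply code_in].
  - intros (t & S & R & Ht & E & Hf). apply the_sequence_entry in E as [-> _]; auto.
    apply in_coded_by in Hf; tauto.
Qed.

Lemma the_sequence_well_ordered : terms_well_ordered d k (the_sequence k lam d r).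
Proof.
  intros t S R Ht E. apply the_sequence_entry in E as [-> ->]; auto.
  assert (Sub : forall f, f ∈ coded_by k lam r t -> f ∈ FF /\ code k lam r f = t)
    by (intros; now apply in_coded_by).
  apply well_orders_graph.
  - def.
  - intros f _; apply label_irrefl.
  - intros f g h Hf Hg Hh; apply label_trans; now apply Sub.
  - intros f g Hf Hg. apply Sub in Hf as [Hf Ef], Hg as [Hg Eg].
    destruct (label_total f g Hf Hg) as [K|[K|K]]; [left; exact K| |right; right; exact K].
    right; left; apply code_label_inj; try assumption; congruence.
  - intros A SA NA. destruct (label_least A) as (m & Hm & L); auto.
    { intros f Hf; apply Sub; auto. }
    exists m; split; [exact Hm|]. intros f Hf. destruct (L f Hf) as [K|K]; [left|right; exact K].
    destruct (Sub f (SA f Hf)), (Sub m (SA m Hm)). apply code_label_inj; try assumption; congruence.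
Qed.

(** Functions with the same label are equivalent. The classes are ordered by their labels, and the
    code is injective on each class. *)
Lemma quotient_well_ordered : well_ordered_quotient d k lam.
Proof.
  unfold well_ordered_quotient. rewrite X_eq.
  assert (EF : functions (ext k) (ext lam) = ext FF) by (apply class_eq; apply in_funs).
  rewrite EF.
  pose (E := graph FF FF (fun f g => label k lam r f = label k lam r g)).
  assert (HE : forall f g, rel E f g <-> f ∈ FF /\ g ∈ FF /\ label k lam r f = label k lam r g).
  { intros; rewrite rel_iff.
    apply (in_graph (fun f g => label k lam r f = label k lam r g) FF FF); def. }
  pose (cls := fun f => compr (fun g => g ∈ FF /\ label k lam r f = label k lam r g)).
  assert (Hc : forall f g, g ∈ cls f <-> g ∈ FF /\ label k lam r f = label k lam r g).
  { intros f; apply (in_compr _ FF); [def|tauto]. }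
  pose (Q := image cls FF).
  assert (HQ : forall c, c ∈ Q <-> exists f, f ∈ FF /\ c = cls f).
  { intros c; apply in_image; unfold cls; dfn. }
  exists E, Q; split; [|split; [|split]].
  - split; [|split; [|split]].
    + intros p Hp. apply graph_subset in Hp; [|def]. apply prod_iff.
      apply in_times in Hp as (x & y & A & B & ->); exists x, y; auto.
    + intros f Hf; apply HE; auto.
    + intros f g K; apply HE in K as (A & B & K); apply HE; auto.
    + intros f g h K K'; apply HE in K as (A & B & K), K' as (_ & B' & K'); apply HE.
      split; [auto|split; auto]. congruence.
  - intros c; rewrite HQ; split; intros (f & Hf & K); exists f; split; auto.
    + intros g; rewrite K, Hc, HE. split; [tauto|]. intros (_ & B & C); auto.
    + apply ext_eq; intros g; rewrite K, Hc, HE. split; [tauto|]. intros [A B]; auto.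
  - assert (Rc : forall f g, f ∈ FF -> g ∈ FF ->
      ((exists x y, x ∈ cls f /\ y ∈ cls g /\ pair (label k lam r x) (label k lam r y) ∈ r)
       <-> pair (label k lam r f) (label k lam r g) ∈ r)).
    { intros f g Hf Hg; split.
      - intros (x & y & Hx & Hy & K). apply Hc in Hx as [_ ->], Hy as [_ ->]; auto.
      - intros K; exists f, g; split; [now apply Hc|split; [now apply Hc|auto]]. }
    assert (Ec : forall f g, label k lam r f = label k lam r g -> cls f = cls g).
    { intros f g K; apply ext_eq; intros z; rewrite !Hc, K; tauto. }
    exists (graph Q Q (fun c c' => exists x y, x ∈ c /\ y ∈ c' /\
      pair (label k lam r x) (label k lam r y) ∈ r)).
    apply well_orders_graph; [def| | | |].
    + intros c Hc'; apply HQ in Hc' as (f & Hf & ->). rewrite Rc by auto. apply label_irrefl.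
    + intros c1 c2 c3 H1 H2 H3; apply HQ in H1 as (f1 & H1 & ->), H2 as (f2 & H2 & ->),
        H3 as (f3 & H3 & ->). rewrite !Rc by auto. now apply label_trans.
    + intros c1 c2 H1 H2; apply HQ in H1 as (f1 & H1 & ->), H2 as (f2 & H2 & ->).
      rewrite !Rc by assumption.
      destruct (label_total f1 f2 H1 H2) as [K|[K|K]];
        [left; exact K|right; left; now apply Ec|right; right; exact K].
    + intros T ST NT. destruct (nonempty_ex T NT) as [c0 Hc0].
      assert (HA : forall f, f ∈ compr (fun f => f ∈ FF /\ cls f ∈ T) <-> f ∈ FF /\ cls f ∈ T).
      { apply (in_compr _ FF); [unfold cls; def|tauto]. }
      destruct (label_least (compr (fun f => f ∈ FF /\ cls f ∈ T))) as (m & Hm & L).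
      * intros f Hf; apply HA in Hf; tauto.
      * assert (K := ST c0 Hc0). apply HQ in K as (f & Hf & K).
        apply (mem_nonempty _ f), HA; split; auto. now rewrite <- K.
      * apply HA in Hm as [Hm Tm]. exists (cls m); split; auto. intros c Hc'.
        assert (K := ST c Hc'). apply HQ in K as (f & Hf & ->).
        destruct (L f) as [K|K]; [now apply HA| |].
        -- left; now apply Ec.
        -- right; now apply Rc.
  - intros c Hc'; apply HQ in Hc' as (f & Hf & ->). apply card_le_iff.
    apply (le_card_fn (code k lam r)); [dfn| |].
    + intros g Hg; apply Hc in Hg as [Hg _]; now apply code_in.
    + intros g h Hg Hh; apply Hc in Hg as [Hg Eg], Hh as [Hh Eh].
      apply code_label_inj; try assumption; congruence.
Qed.

Lemma in_labels u : u ∈ labels k lam r <-> exists f, f ∈ FF /\ u = label k lam r f.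
Proof. apply in_image; dfn. Qed.

Lemma labels_wo : wo (labels k lam r) r.
Proof.
  assert (S : subset (labels k lam r) (fld r)).
  { intros u Hu; apply in_labels in Hu as (f & Hf & ->). now apply label_in. }
  destruct Hr as (_ & (W & T & C) & _). split; [|split].
  - intros t St Nt; apply W; auto. intros u Hu; auto.
  - intros x y z Hx Hy Hz; apply T; auto.
  - intros x y Hx Hy; apply C; auto.
Qed.

Lemma label_labels f : f ∈ FF -> label k lam r f ∈ labels k lam r.
Proof. intros Hf; apply in_labels; eauto. Qed.

Lemma index_eq f g : f ∈ FF -> g ∈ FF -> index k lam r f = index k lam r g ->
  label k lam r f = label k lam r g.
Proof.
  intros Hf Hg; apply (rank_inj (labels k lam r) r); auto using label_labels, labels_wo.
Qed.

Let beta := otype (labels k lam r) r.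

Lemma in_beta b : b ∈ beta <-> exists f, f ∈ FF /\ b = index k lam r f.
Proof.
  unfold beta; rewrite in_otype; split.
  - intros (u & Hu & ->); apply in_labels in Hu as (f & Hf & ->); exists f; auto.
  - intros (f & Hf & ->); exists (label k lam r f); split; auto. now apply label_labels.
Qed.

(** Each label is the cover of a countably infinite subset of alpha-star, so sending such a set to
    the rank of its cover among the labels reaches all of [beta]. *)
Lemma beta_in_hrtg : exists alpha theta, is_alpha_star k lam alpha /\
  is_hrtg (subsets_aleph0 (ext alpha)) theta /\ beta ∈ theta.
Proof.
  pose (P := compr (fun v => subsets_aleph0 (ext a) v)).
  assert (HP : forall v, v ∈ P <-> subsets_aleph0 (ext a) v).
  { apply (in_compr _ (power a)); [def|]. intros v [H _]; now apply in_power. }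
  exists a, (hartogs P); split; [|split].
  - now apply rank_bound_alpha_star.
  - rewrite (class_eq (subsets_aleph0 (ext a)) P) by exact HP. apply is_hrtg_hartogs.
  - apply in_hartogs; split; [apply otype_ord, labels_wo|].
    destruct (classic (beta = empty)) as [E|E]; auto; right.
    destruct (nonempty_ex _ E) as [z0 Hz0].
    apply (surj_partial (fun v => rank (labels k lam r) r (cover r v)) _ _ z0); auto.
    + dfn.
    + intros y Hy; apply in_beta in Hy as (f & Hf & ->).
      destruct (label_spec k lam r mu Hk Hlam Hkl Hr Hmu f Hf) as (v & Sv & C1 & C2 & El).
      exists v; split; [|unfold index; now rewrite El].
      apply HP, subsets_aleph0_iff; auto.
Qed.

(** S_t consists of the indices of the functions with code [t]. Code and index together determine
    the function, so [g] is the inverse of [key]; clause (delta) holds because the index depends on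
    the function alone. *)
Lemma represented : well_ordered_representation d k lam.
Proof.
  unfold well_ordered_representation. rewrite X_eq.
  assert (EF : functions (ext k) (ext lam) = ext FF) by (apply class_eq; apply in_funs).
  rewrite EF.
  pose (Sx := fun t => image (index k lam r) (coded_by k lam r t)).
  assert (HSx : forall t b, b ∈ Sx t <-> exists f, f ∈ FF /\ code k lam r f = t /\ b = index k lam r f).
  { intros t b; unfold Sx; rewrite in_image by dfn. split.
    - intros (f & Hf & ->); apply in_coded_by in Hf as [Hf E]; eauto.
    - intros (f & Hf & E & ->); exists f; split; auto. now apply in_coded_by. }
  assert (DS : dfun M Sx) by (unfold Sx; dfn).
  pose (Sb := fn (code_space d k) Sx).
  assert (HSb : maps Sb (ext (code_space d k)) (fun _ => True)) by (apply fn_maps; auto).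
  assert (ES : forall t s, rel Sb t s <-> t ∈ code_space d k /\ s = Sx t).
  { intros t s; rewrite (app_rel _ _ _ _ _ HSb). unfold Sb. split; intros [A ->]; split; auto;
      now rewrite app_fn. }
  pose (key := fun f => pair (code k lam r f) (index k lam r f)).
  pose (IP := image key FF).
  assert (HIP : forall p, p ∈ IP <-> exists f, f ∈ FF /\ p = key f).
  { intros p; apply in_image; unfold key; dfn. }
  assert (EIP : index_pairs d k Sb = ext IP).
  { unfold index_pairs; rewrite X_eq. apply class_eq. intros p; rewrite HIP; split.
    - intros (f & Hf & ->). exists (code k lam r f), (Sx (code k lam r f)), (index k lam r f).
      split; [now apply code_in|split; [|split; [|now apply is_pair_iff]]].
      + apply ES; split; auto. now apply code_in.
      + apply HSx; eauto.
    - intros (t & s & b & Ht & Hs & Hb & E). apply ES in Hs as [_ ->]. apply is_pair_iff in E as ->.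
      apply HSx in Hb as (f & Hf & <- & ->). exists f; auto. }
  assert (KI : forall f g, f ∈ FF -> g ∈ FF -> key f = key g -> f = g).
  { intros f g Hf Hg E; apply pair_inj in E as [E1 E2]. apply code_label_inj; auto.
    now apply index_eq. }
  pose (G := fun p => the (fun f => f ∈ FF /\ p = key f)).
  assert (HG : forall f, f ∈ FF -> G (key f) = f).
  { intros f Hf; apply the_eq; auto. intros g [Hg E]; auto. }
  assert (DG : dfun M G) by (unfold G, key, FF; dfn).
  assert (Hg : maps (fn IP G) (ext IP) (fun _ => True)) by (apply fn_maps; auto).
  assert (Eg : forall p f, rel (fn IP G) p f <-> f ∈ FF /\ p = key f).
  { intros p f; rewrite (app_rel _ _ _ _ _ Hg). split.
    - intros [Hp ->]. rewrite app_fn by auto. apply HIP in Hp as (f & Hf & ->). rewrite HG; auto.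
    - intros [Hf ->]. assert (key f ∈ IP) by (apply HIP; eauto). split; auto.
      rewrite app_fn, HG; auto. }
  pose (part := fun b => compr (fun f => f ∈ FF /\ index k lam r f = b)).
  assert (Hpart : forall b f, f ∈ part b <-> f ∈ FF /\ index k lam r f = b).
  { intros b; apply (in_compr _ FF); [def|tauto]. }
  assert (DP : dfun M part) by (unfold part, FF; dfn).
  assert (HF : maps (fn beta part) (ext beta) (fun _ => True)) by (apply fn_maps; auto).
  assert (EP : forall b P, rel (fn beta part) b P <-> b ∈ beta /\ P = part b).
  { intros b P; rewrite (app_rel _ _ _ _ _ HF). split; intros [A ->]; split; auto;
      now rewrite app_fn. }
  clearbody Sb.
  exists (fn IP G), Sb, (fn beta part), beta. rewrite EIP.
  split; [exact HSb|split; [exact Hg|split; [apply otype_ord, labels_wo|split; [exact beta_in_hrtg|]]]].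
  split; [|split; [|split; [|split]]].
  - intros b; rewrite in_beta; split.
    + intros (f & Hf & ->). exists (code k lam r f), (Sx (code k lam r f)).
      split; [now apply code_in|split].
      * apply ES; split; auto. now apply code_in.
      * apply HSx; eauto.
    + intros (t & s & _ & Hs & Hb). apply ES in Hs as [_ ->].
      apply HSx in Hb as (f & Hf & _ & ->); eauto.
  - intros f; split.
    + intros Hf; exists (key f); split; [apply HIP; eauto|]. now apply Eg.
    + intros (p & _ & K); apply Eg in K; apply K.
  - intros t1 b1 p1 t2 b2 p2 f E1 E2 R1 R2. rewrite is_pair_iff in E1, E2.
    apply Eg in R1 as [_ R1], R2 as [_ R2]. subst p1 p2.
    apply pair_inj in R1 as [_ ->], R2 as [_ ->]; reflexivity.
  - split; [exact HF|split; [|split]].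
    + intros b P K; apply EP in K as [Hb ->]. apply in_beta in Hb as (f & Hf & ->).
      intros N; apply (N f). now apply Hpart.
    + intros b b' P P' f K K' A A'. apply EP in K as [_ ->], K' as [_ ->].
      apply Hpart in A as [_ <-], A' as [_ <-]; auto.
    + intros f; split.
      * intros Hf; exists (index k lam r f), (part (index k lam r f)); split; [|now apply Hpart].
        apply EP; split; auto. apply in_beta; eauto.
      * intros (b & P & K & A). apply EP in K as [_ ->]. apply Hpart in A; apply A.
  (* The code embeds the piece into X_kappa; as the piece is nonempty, the embedding can be reversed
     to a surjection. *)
  - intros b P K. apply EP in K as [Hb ->]. apply in_beta in Hb as (f & Hf & ->). right.
    apply surj_iff. apply (surj_of_le_card _ _ f); [now apply Hpart|].
    apply (le_card_fn (code k lam r)); [dfn| |].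
    + intros g A; apply Hpart in A as [A _]; now apply code_in.
    + intros g h A B; apply Hpart in A as [A EA], B as [B EB]. apply code_label_inj; auto.
      apply index_eq; auto; congruence.
Qed.

Lemma the_sequence_good : good_sequence d k lam (the_sequence k lam d r).
Proof.
  split; [exact the_sequence_is_sequence|split; [exact the_sequence_covers|]].
  split; [exact the_sequence_well_ordered|split; [exact quotient_well_ordered|exact represented]].
Qed.
End Assembly.

(* The set [S] is the field of its well ordering [r], as it has at least two
   elements: a single member of [S] would cover [mu] and so have size [>= d]. *)

Lemma witness_covering {M : model} (mu d S r : M) : (exists w1 : M, is_aleph1 w1) ->
  ordinal mu -> subset d mu -> Ax4_witness mu d S -> well_orders r S ->
  covering r mu /\ forall u, u ∈ fld r -> le_card u d /\ ~ le_card d u.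
Proof.
  intros [w1 Hw] Omu Sd (HS & _ & HC) (W1 & W2 & W3 & W4 & W5).
  assert (HS' : forall u, u ∈ S -> subset u mu /\ le_card u d /\ ~ le_card d u).
  { intros u Hu. destruct (HS u Hu) as (A & B & C). rewrite card_le_iff in B, C; auto. }
  assert (Hcov : forall v, subset v mu -> le_card v omega -> exists u, u ∈ S /\ subset v u).
  { intros v Sv Cv. apply HC, (countable_subsets_lt_aleph1 _ _ w1); auto. }
  assert (ES : fld r = S).
  { apply ext_eq; intros u; rewrite in_fld; split.
    - intros (v & [K|K]); apply W1, prod_iff in K as (x & y & A & B & E);
        apply pair_inj in E as [-> ->]; auto.
    - intros Hu.
      assert (E : exists u', u' ∈ S /\ u' <> u).
      { apply NNPP; intros N. destruct (HS' u Hu) as (_ & _ & Nd). apply Nd, le_card_subset.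
        intros x Hx. destruct (Hcov (sing x)) as (u' & Hu' & S').
        - intros z Hz; apply in_sing in Hz as ->; auto.
        - apply (le_card_fn (fun _ => empty)); [dfn|intros; apply zero_omega|].
          intros y z Hy Hz _; apply in_sing in Hy, Hz; congruence.
        - assert (u' = u) as ->; [apply NNPP; eauto|]. apply S', in_sing; auto. }
      destruct E as (u' & Hu' & N).
      destruct (W4 u u' Hu Hu') as [K|[K|K]]; [|congruence|];
        apply rel_iff in K; exists u'; auto. }
  rewrite <- ES in HS', Hcov, W4, W5.
  split; [|intros u Hu; now apply HS'].
  split; [auto|split; [split; [|split]|split; [|split]]].
  - intros T ST NT. destruct (W5 T ST (nonempty_ex T NT)) as (m & Hm & L).
    exists m; split; auto. intros y Hy K. rewrite <- rel_iff in K.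
    destruct (L y Hy) as [->|Q]; [exact (W2 _ K)|]. exact (W2 _ (W3 _ _ _ Q K)).
  - intros x y z _ _ _. rewrite <- !rel_iff. apply W3.
  - intros x y Hx Hy. rewrite <- !rel_iff. now apply W4.
  - intros u. rewrite <- rel_iff. apply W2.
  - intros u Hu; now apply HS'.
  - exact Hcov.
Qed.

(** [mu0] is chosen so that alpha-star is contained in every [mu] from [mu0] on; then all countable
    sets of ranks have covers. The sequence is a term in [kap], [lam], [d] and [r] in which [mu]
    does not occur. *)
Lemma the_sequence_uniform (phi : formula) :
  (forall (N : model) (e : nat -> N),
     sat e phi <-> e 0 = the_sequence (e 1) (e 2) (e 3) (e 4)) ->
  forall (M : model) (d kap lam : M),
    aleph d -> (exists w1 : M, is_aleph1 w1) -> aleph kap -> aleph lam ->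
    ord_le d lam -> kap ∈ lam ->
    uniformly_defines phi d kap lam (good_sequence d kap lam).
Proof.
  intros Hphi M d kap lam Hd w1_ex Hk Hlam Hdl Hkl.
  assert (Ol : ordinal lam) by apply Hlam.
  assert (Oa := rank_bound_ord kap lam).
  assert (Sl : subset lam (rank_bound kap lam)).
  { apply lam_subset_rank_bound; auto. apply (mem_nonempty _ empty). now apply aleph_zero. }
  assert (So : subset omega (rank_bound kap lam)).
  { destruct (proj1 (aleph_iff lam) Hlam) as (_ & L & _).
    apply ord_subset_iff in L; auto using omega_ord. intros z Hz; auto. }
  exists (hartogs (rank_bound kap lam)); split; [now apply hartogs_aleph|].
  intros mu Hmu L _ _ S r HS Hr.
  assert (Omu : ordinal mu) by apply Hmu.
  assert (Sa : subset (rank_bound kap lam) mu).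
  { apply ord_subset_iff in L; auto using hartogs_ord.
    apply ord_subset_iff; auto. left. apply L. now apply mem_hartogs. }
  assert (Sd : subset d mu).
  { apply ord_subset_iff in Hdl; auto; [|apply Hd]. intros z Hz; auto. }
  destruct (witness_covering mu d S r w1_ex Omu Sd HS Hr) as [Hcov Hcard].
  exists (the_sequence kap lam d r); split.
  - split; [now apply (Hphi M)|]. now apply (the_sequence_good kap lam d r mu).
  - intros y [Hy _]. apply (Hphi M) in Hy. symmetry; exact Hy.
Qed.

Theorem theorem2p19 :
  exists phi : formula,
    forall (M : structure), ZF M -> DC M ->
    forall d kap lam : M,
      aleph d -> (exists w1, is_aleph1 w1 /\ ord_le w1 d) ->
      aleph kap -> aleph lam -> ord_le d lam ->
      Ax4 lam d ->
      kap ∈ lam ->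
      uniformly_defines phi d kap lam (good_sequence d kap lam).
Proof.
  (* The closure lemmas for all the constructions yield the formula here, before any model is
     fixed. *)
  assert (D : dprop (fun N e => e 0 = the_sequence (e 1) (e 2) (e 3) (e 4))) by dsolve.
  destruct D as [phi Hphi]. exists phi.
  intros M HZF HDC d kap lam Hd (w1 & Hw & _) Hk Hlam Hdl _ Hkl.
  apply (the_sequence_uniform phi Hphi (Model M HZF HDC)); try assumption.
  now exists w1.
Qed.
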